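(* Partial Connected Red-Blue Dominating Set is W[1]-hard when parameterized by $k$, even when the coverage graph is $3$-degenerate and the connectivity graph is a clique; and also even when the coverage graph is $3$-degenerate and the connectivity graph is a star.
   Context: An instance of Partial Connected Red-Blue Dominating Set is $(G_{\mathrm{conn}},G_{\mathrm{cov}},k,t)$ where $G_{\mathrm{conn}}=(R,E)$ is an arbitrary graph (connectivity graph), $G_{\mathrm{cov}}=(R\uplus B,E')$ is a bipartite graph with sides $R$ and $B$ (coverage graph), and $k,t$ non-negative integers; the question is whether there is $S\subseteq R$ with $|S|\le k$, $G_{\mathrm{conn}}[S]$ connected and $|N_{G_{\mathrm{cov}}}(S)|\ge t$. *)

(* Defs.v *)
From mathcomp Require Import all_boot.

Set Implicit Arguments.
Unset Strict Implicit.
Unset Printing Implicit Defensive.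

(* Machine model: structured programs over finitely many stacks of bits, each
   elementary step costing 1.  Two stacks simulate one tape and a tape simulates
   a stack, so these are the deterministic multi-tape Turing machines with their
   usual running time, up to constant factors. *)

Definition store := nat -> seq bool.

Definition upd (s : store) (x : nat) (w : seq bool) : store :=
  fun y => if y == x then w else s y.

Inductive com :=
| Skip
| Push of nat & bool
| Pop of nat
| Seq of com & com
| Case of nat & com & com & com   (* empty stack / top bit 0 / top bit 1 *)
| While of nat & com.             (* as long as the stack is nonempty *)

(* [exec c s t s']: started in [s], [c] halts in [s'] after exactly [t] steps. *)
Inductive exec : com -> store -> nat -> store -> Prop :=
| ExecSkip s : exec Skip s 1 s
| ExecPush x b s : exec (Push x b) s 1 (upd s x (b :: s x))
| ExecPop x s : exec (Pop x) s 1 (upd s x (behead (s x)))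
| ExecSeq c1 c2 s1 s2 s3 t1 t2 :
    exec c1 s1 t1 s2 -> exec c2 s2 t2 s3 -> exec (Seq c1 c2) s1 (t1 + t2) s3
| ExecCase x c0 cf ct s s' t :
    exec (match s x with
          | [::] => c0
          | false :: _ => cf
          | true :: _ => ct
          end) s t s' ->
    exec (Case x c0 cf ct) s t.+1 s'
| ExecWhileStop x c s : s x = [::] -> exec (While x c) s 1 s
| ExecWhileStep x c s1 s2 s3 t1 t2 :
    s1 x <> [::] -> exec c s1 t1 s2 -> exec (While x c) s2 t2 s3 ->
    exec (While x c) s1 (t1 + t2).+1 s3.

Definition init (ws : seq (seq bool)) : store := fun x => nth [::] ws x.

Definition unary (n : nat) : seq bool := nseq n true.

Definition computable (f : nat -> nat) : Prop :=
  exists c : com, forall n, exists t s,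
    exec c (init [:: unary n]) t s /\ s 0 = unary (f n).

(* A parameterized problem is a subset of {0,1}^* x N. *)
Definition pproblem := seq bool -> nat -> Prop.

(* The input (x, k) is given on stacks 0 and 1, and the output (x', k') is left
   there; the other stacks may hold garbage at the end.  The time bound is
   f(k) * |x|^O(1); the successor only matters for the empty word, and the
   length of the unary parameter is absorbed by f. *)
Definition fpt_reducible (P Q : pproblem) : Prop :=
  exists (c : com) (f g : nat -> nat) (e : nat),
    [/\ computable f, computable g &
        forall x k, exists t s k',
          [/\ exec c (init [:: x; unary k]) t s,
              s 1 = unary k',
              t <= f k * (size x).+1 ^ e,
              k' <= g k &
              P x k <-> Q (s 0) k']].

(* Prefix-free, hence injective, coding of sequences of numbers: n |-> 1^n 0. *)
Definition enc_seq (s : seq nat) : seq bool :=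
  flatten [seq rcons (unary n) false | n <- s].

(* Boolean circuits: node j is the j-th gate of the list.  As usual a node of
   in-degree 0 is an input, a node of in-degree 1 is a negation, and a node of
   in-degree at least 2 is a conjunction or a disjunction. *)
Inductive gate :=
| Input
| Neg of nat
| Conj of seq nat
| Disj of seq nat.

Definition preds (g : gate) : seq nat :=
  match g with
  | Input => [::]
  | Neg i => [:: i]
  | Conj s | Disj s => s
  end.

Definition is_input (g : gate) : bool := if g is Input then true else false.

(* Large nodes are those of in-degree greater than 2. *)
Definition large (g : gate) : bool := 2 < size (preds g).

Record circuit := Circuit { gates : seq gate; out : nat }.

Definition node (C : circuit) (j : nat) : gate := nth Input (gates C) j.

Definition wire (C : circuit) : rel nat := fun i j => i \in preds (node C j).

(* Acyclicity is ensured by listing the nodes in a topological order. *)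
Definition gate_ok (j : nat) (g : gate) : bool :=
  all (fun i => i < j) (preds g) &&
  match g with
  | Input | Neg _ => true
  | Conj s | Disj s => (1 < size s) && uniq s
  end.

Definition circuit_ok (C : circuit) : Prop :=
  [/\ forall j, j < size (gates C) -> gate_ok j (node C j),
      out C < size (gates C) &
      forall j, ~~ wire C (out C) j].

Definition depth_le (d : nat) (C : circuit) : Prop :=
  forall i p, is_input (node C i) -> path (wire C) i p -> last i p = out C ->
    size p <= d.

Definition weft_le (t : nat) (C : circuit) : Prop :=
  forall i p, is_input (node C i) -> path (wire C) i p -> last i p = out C ->
    count (fun j => large (node C j)) (i :: p) <= t.

(* The values of all the nodes; by acyclicity they are determined by those of
   the input nodes, which are arbitrary. *)
Definition valuation (C : circuit) (v : nat -> bool) : Prop :=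
  forall j, j < size (gates C) ->
    match node C j with
    | Input => True
    | Neg i => v j = ~~ v i
    | Conj s => v j = all v s
    | Disj s => v j = has v s
    end.

Definition weight (C : circuit) (v : nat -> bool) : nat :=
  count (fun j => is_input (node C j) && v j) (iota 0 (size (gates C))).

Definition gate_code (g : gate) : seq nat :=
  match g with
  | Input => [:: 0]
  | Neg i => [:: 1; i]
  | Conj s => [:: 2, size s & s]
  | Disj s => [:: 3, size s & s]
  end.

Definition enc_circuit (C : circuit) : seq bool :=
  enc_seq [:: size (gates C), out C & flatten (map gate_code (gates C))].

(* Weighted Circuit Satisfiability for circuits of weft <= t and depth <= d,
   parameterized by the weight k: is there a satisfying assignment with exactly
   k inputs set to true? *)
Definition WCS (t d : nat) : pproblem := fun x k =>
  exists C : circuit,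
    [/\ circuit_ok C, weft_le t C, depth_le d C, x = enc_circuit C &
        exists v, [/\ valuation C v, weight C v = k & v (out C)]].

Definition in_W (t : nat) (P : pproblem) : Prop :=
  exists d, fpt_reducible P (WCS t d).

Definition W_hard (t : nat) (Q : pproblem) : Prop :=
  forall P, in_W t P -> fpt_reducible P Q.

Record sgraph (T : finType) := SGraph {
  adj : rel T;
  adj_sym : symmetric adj;
  adj_irr : irreflexive adj }.

Definition neighborhood (T : finType) (G : sgraph T) (S : {set T}) : {set T} :=
  [set v | (v \notin S) && [exists u in S, adj G u v]].

(* The induced subgraph G[S] is connected (the empty graph counts as such). *)
Definition connected_on (T : finType) (G : sgraph T) (S : {set T}) : Prop :=
  {in S &, forall u v,
    connect (fun x y => [&& x \in S, y \in S & adj G x y]) u v}.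

Definition is_clique (T : finType) (G : sgraph T) : Prop :=
  forall u v, adj G u v = (u != v).

Definition is_star (T : finType) (G : sgraph T) : Prop :=
  exists c, forall u v, adj G u v = (u != v) && ((u == c) || (v == c)).

Definition degenerate (d : nat) (T : finType) (G : sgraph T) : Prop :=
  forall U : {set T}, U != set0 ->
    exists2 v, v \in U & #|[set u in U | adj G v u]| <= d.

Definition in_left (A B : Type) (v : A + B) : bool :=
  if v is inl _ then true else false.

(* An instance of Partial Connected Red-Blue Dominating Set without its
   parameter k; R = 'I_nR and B = 'I_nB. *)
Record pcrbds := PCRBDSInstance {
  nR : nat;
  nB : nat;
  Gconn : sgraph 'I_nR;
  Gcov : sgraph ('I_nR + 'I_nB)%type;
  cov_bipartite : forall u v, adj Gcov u v -> in_left u != in_left v;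
  target : nat }.

Definition solvable (I : pcrbds) (k : nat) : Prop :=
  exists S : {set 'I_(nR I)},
    [/\ #|S| <= k,
        connected_on (Gconn I) S &
        target I <= #|neighborhood (Gcov I) [set inl u | u in S]|].

Definition enc_pcrbds (I : pcrbds) : seq bool :=
  enc_seq ([:: nR I; nB I; target I]
    ++ [seq nat_of_bool (adj (Gconn I) u v) |
          u <- enum 'I_(nR I), v <- enum 'I_(nR I)]
    ++ [seq nat_of_bool (adj (Gcov I) (inl u) (inr w)) |
          u <- enum 'I_(nR I), w <- enum 'I_(nB I)]).

(* The problem parameterized by k, restricted to the class K of instances. *)
Definition PCRBDS (K : pcrbds -> Prop) : pproblem := fun x k =>
  exists I : pcrbds, [/\ x = enc_pcrbds I, K I & solvable I k].

(* Main.v *)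
Require Import Defs.
From mathcomp Require Import all_boot zify.
From Stdlib Require Import FunctionalExtensionality.

(** Let [C] be a circuit of weft 1 and depth [d].  A [k]-element set of true
    inputs is a sequence of [k] numbers; whether a given node of bounded height
    has a given value is witnessed by boundedly many consecutive pairs of this
    sequence, and the value of a large gate by the index of one predecessor or
    by the claim that there is none.  So satisfiability is a constraint problem
    on [k + O(1)] variables whose constraints have bounded arity.  Take as red
    vertices the tuples (of this arity) of pairs (variable, value) which violate
    no constraint: a solution is a set of pairwise compatible tuples, one for
    each tuple of variables, that is, an independent set of prescribed size in
    the graph of conflicts.  Give all red vertices the same number of blue
    neighbours, every blue vertex being private to a red one or shared by two
    conflicting ones: the largest coverage by [t] red vertices is reached exactly
    by the independent sets.  Blue vertices have degree at most 2, and an extra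
    vertex without conflicts serves as the centre of the star.

    Everything is computed by bounded primitive recursion on unary numbers,
    which the stack programs carry out in polynomial time. *)

Set Implicit Arguments.
Unset Strict Implicit.
Unset Printing Implicit Defensive.

(** * Programs on relocated stacks *)

(** That an input is not chosen is a statement about all [k] variables. Listing the chosen inputs in
    increasing order between two sentinels makes it local: two neighbouring values enclosing an
    input exclude it.

    Weft 1 enters twice. Below a large gate there is no other one, so the values of its predecessors
    have certificates whose size depends on the depth only; between the output and the large gates
    all in-degrees are at most 2, so the claims are indexed by boundedly many addresses. The claim
    that no predecessor decides a large gate is universal, yet each violation of it shows in one
    tuple, made of the claim and a certificate for one predecessor.

    Conflicts are binary and constraints are not, hence whole tuples as vertices. A word that
    encodes no admissible circuit leaves only the extra vertex with blue neighbours, and the target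
    is out of reach. Connectivity matters only when a solution is built; the converse is pure
    counting of coverage.

    On the machine side, a program that is merely assumed to exist may use any stacks and leave
    garbage on them, so it has to be moved to stacks of its own. *)

Fixpoint ren (r : nat -> nat) (c : com) : com :=
  match c with
  | Skip => Skip
  | Push x b => Push (r x) b
  | Pop x => Pop (r x)
  | Seq c1 c2 => Seq (ren r c1) (ren r c2)
  | Case x c0 c1 c2 => Case (r x) (ren r c0) (ren r c1) (ren r c2)
  | While x c => While (r x) (ren r c)
  end.

Definition splice (q : nat -> option nat) (s S : store) : store :=
  fun z => if q z is Some y then s y else S z.

(** A relocated program touches only the stacks in the range of [r] and leaves the others as in [S].
    This framing property is what allows programs with unknown stack usage to be combined. *)
Lemma exec_ren (r : nat -> nat) (q : nat -> option nat) c s t s' S :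
  pcancel r q -> ocancel q r ->
  exec c s t s' -> (forall y, S (r y) = s y) ->
  exec (ren r c) S t (splice q s' S).
Proof.
move=> rK qK ex eqS.
have eS s0 : (forall y, S (r y) = s0 y) -> S = splice q s0 S.
  move=> e; apply: functional_extensionality => z; rewrite /splice.
  by case E: (q z) => [y|//]; have := qK z; rewrite E /= => <-.
rewrite {1}(eS _ eqS) => {eqS eS}.
have mr s0 x : splice q s0 S (r x) = s0 x by rewrite /splice rK.
have um s0 x w : upd (splice q s0 S) (r x) w = splice q (upd s0 x w) S.
  apply: functional_extensionality => z; rewrite /upd /splice.
  case: eqP => [->|ne]; first by rewrite rK eqxx.
  case E: (q z) => [y|//]; case: eqP => // e; case: ne.
  by have := qK z; rewrite E /= => <-; rewrite e.
elim: ex => {c s t s'} /=.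
- by move=> s; constructor.
- move=> x b s; rewrite -um -(mr s x); constructor.
- move=> x s; rewrite -um -(mr s x); constructor.
- by move=> c1 c2 s1 s2 s3 t1 t2 _ e1 _ e2; apply: ExecSeq e1 e2.
- move=> x c0 cf ct s s' t _ IH; constructor; rewrite mr.
  by case: (s x) IH => [|[] ?].
- by move=> x c s e; constructor; rewrite mr.
- move=> x c s1 s2 s3 t1 t2 ne _ e1 _ e2; apply: ExecWhileStep e1 e2.
  by rewrite mr.
Qed.

(** Each step pushes at most one bit. Time bounds thus bound unary results, and also the word
    produced by an arbitrary reduction. *)
Lemma exec_size c s t s' y : exec c s t s' -> size (s' y) <= size (s y) + t.
Proof.
elim=> {c s t s'} [s|x b s|x s|c1 c2 s1 s2 s3 t1 t2 _ IH1 _ IH2|||];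
  rewrite /upd; try lia.
- by case: eqP => [->|] /=; lia.
- by case: eqP => [->|]; rewrite ?size_behead; lia.
Qed.

(* [mv a b] moves the bits of [a] to [b], reversing their order. *)
Definition mv (a b : nat) : com :=
  While a (Case a Skip (Seq (Pop a) (Push b false)) (Seq (Pop a) (Push b true))).

Lemma exec_mv a b s : a != b ->
  exec (mv a b) s (4 * size (s a)).+1
    (upd (upd s b (rev (s a) ++ s b)) a [::]).
Proof.
move=> ab; move E: (s a) => w; elim: w s E => [|c w IH] s E.
  suff -> : upd (upd s b (rev [::] ++ s b)) a [::] = s by apply: ExecWhileStop.
  apply: functional_extensionality => y; rewrite /upd /rev /=.
  by case: eqP => [->|_]; [rewrite E | case: eqP => // ->].
have -> : (4 * size (c :: w)).+1 = (3 + (4 * size w).+1).+1 by rewrite /=; lia.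
apply: (@ExecWhileStep a _ s (upd (upd s a w) b (c :: s b))); first by rewrite E.
  constructor; rewrite E.
  have -> : w = behead (s a) by rewrite E.
  have -> : s b = upd s a (behead (s a)) b by rewrite /upd eq_sym (negPf ab).
  by case: c E => _; apply: (@ExecSeq _ _ _ _ _ 1 1); constructor.
have := IH (upd (upd s a w) b (c :: s b)).
rewrite {1}/upd {1}/upd (negPf ab) eqxx => /(_ erefl).
congr exec; apply: functional_extensionality => y; rewrite /upd /=.
by case: (y == a) => //; case: eqP => // _; rewrite eqxx rev_cons cat_rcons.
Qed.

(* Stack [0] holds a word and stack [i + 1] the number [v i] in unary. *)
Definition lay (x : seq bool) (v : nat -> nat) : store :=
  fun y => if y is i.+1 then unary (v i) else x.

Definition vupd (v : nat -> nat) (i n : nat) : nat -> nat :=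
  fun j => if j == i then n else v j.

Lemma upd_lay x v i n : upd (lay x v) i.+1 (unary n) = lay x (vupd v i n).
Proof.
apply: functional_extensionality => -[|j] //=.
by rewrite /upd /vupd eqSS; case: eqP.
Qed.

Lemma exec_push x v i :
  exec (Push i.+1 true) (lay x v) 1 (lay x (vupd v i (v i).+1)).
Proof. rewrite -upd_lay; exact: ExecPush. Qed.

Lemma exec_pop x v i :
  exec (Pop i.+1) (lay x v) 1 (lay x (vupd v i (v i).-1)).
Proof.
rewrite -upd_lay; have -> : unary (v i).-1 = behead (lay x v i.+1).
  by rewrite /=; case: (v i).
exact: ExecPop.
Qed.

(** [V m] describes the numbers after [m] rounds; the controlling stack holds the number [n - m] of
    rounds still to come. *)
Lemma exec_while_lay x c i (V : nat -> nat -> nat) (n T : nat) :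
  (forall m, m <= n -> V m i = n - m) ->
  (forall m, m < n -> exists2 t, exec c (lay x (V m)) t (lay x (V m.+1)) & t <= T) ->
  exists2 t, exec (While i.+1 c) (lay x (V 0)) t (lay x (V n)) & t <= n * T.+1 + 1.
Proof.
move=> Vi step.
suff: forall r m, m + r = n ->
  exists2 t, exec (While i.+1 c) (lay x (V m)) t (lay x (V n)) & t <= r * T.+1 + 1.
  exact.
elim=> [|r IH] m e.
  exists 1 => //; rewrite -e addn0; apply: ExecWhileStop.
  by rewrite /= Vi; [have -> : n - m = 0 by lia | lia].
have [|t1 e1 l1] := step m; first lia.
have [|t2 e2 l2] := IH m.+1; first lia.
exists (t1 + t2).+1; last by nia.
apply: ExecWhileStep e1 e2; rewrite /= Vi; last lia.
by have -> : n - m = (n - m).-1.+1 by lia.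
Qed.

Definition clear (i : nat) : com := While i.+1 (Pop i.+1).

Lemma exec_clear x v i :
  exists2 t, exec (clear i) (lay x v) t (lay x (vupd v i 0)) & t <= 2 * v i + 1.
Proof.
have [||t e l] := @exec_while_lay x (Pop i.+1) i (fun m => vupd v i (v i - m)) (v i) 1.
- by move=> m _; rewrite /vupd eqxx.
- move=> m lm; exists 1 => //.
  have := exec_pop x (vupd v i (v i - m)) i.
  congr exec; congr lay; apply: functional_extensionality => j.
  by rewrite /vupd eqxx; case: eqP => // _; lia.
exists t; last lia.
move: e; congr exec; congr lay; apply: functional_extensionality => j; rewrite /vupd; case: eqP => [?|//]; subst; lia.
Qed.

Definition transfer (i j : nat) : com := While i.+1 (Seq (Pop i.+1) (Push j.+1 true)).

Lemma exec_transfer x v i j : i != j ->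
  exists2 t, exec (transfer i j) (lay x v) t (lay x (vupd (vupd v i 0) j (v j + v i)))
    & t <= 3 * v i + 1.
Proof.
move=> ij.
have [||t e l] := @exec_while_lay x (Seq (Pop i.+1) (Push j.+1 true)) i
   (fun m => vupd (vupd v i (v i - m)) j (v j + m)) (v i) 2.
- by move=> m _; rewrite /vupd eqxx (negPf ij).
- move=> m lm; exists 2 => //; apply: (@ExecSeq _ _ _ _ _ 1 1); first exact: exec_pop.
  have := exec_push x (vupd (vupd (vupd v i (v i - m)) j (v j + m)) i
     (vupd (vupd v i (v i - m)) j (v j + m) i).-1) j.
  have ji : (j == i) = false by rewrite eq_sym (negPf ij).
  congr exec; congr lay; apply: functional_extensionality => y.
  by rewrite /vupd !eqxx ?(negPf ij) ?ji; do 2?[case: eqP => // _]; lia.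
exists t; last lia.
by move: e; congr exec; congr lay; apply: functional_extensionality => y; rewrite /vupd;
  do 2?[case: eqP => [?|?] //]; subst; lia.
Qed.

(** * Functions computable in polynomial time *)

Section PolynomialBounds.
Variables (E : Type) (mu : E -> nat).

(** Polynomially bounded in [mu]. A single constant serves as summand and exponent, so that bounds
    only grow with it and two of them can be merged. *)
Definition pb (F : E -> nat) : Prop := exists c, forall e, F e <= (mu e + c) ^ c.

Lemma pb_le F G : (forall e, F e <= G e) -> pb G -> pb F.
Proof. by move=> FG [c Gc]; exists c => e; apply: leq_trans (FG e) (Gc e). Qed.

Lemma pow_mono m c C : c <= C -> (m + c) ^ c <= (m + C) ^ C.
Proof.
case: c => [|c] cC; first by case: C cC => [|C] _; rewrite ?expn0 // expn_gt0; lia.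
by apply: (@leq_trans ((m + C) ^ c.+1)); [rewrite leq_exp2r; lia | rewrite leq_pexp2l; lia].
Qed.

Lemma pb_id : pb mu.
Proof. by exists 1 => e; rewrite expn1; lia. Qed.

Lemma pb_const n : pb (fun=> n).
Proof.
exists n.+1 => e; rewrite expnS.
have : 0 < (mu e + n.+1) ^ n by rewrite expn_gt0; lia.
by nia.
Qed.

Lemma pb_mul F G : pb F -> pb G -> pb (fun e => F e * G e).
Proof.
move=> [c Fc] [d Gd]; exists (c + d) => e; rewrite expnD.
apply: leq_mul; [apply: leq_trans (Fc e) _ | apply: leq_trans (Gd e) _].
  by case: c {Fc} => // c; rewrite leq_exp2r; lia.
by case: d {Gd} => // d; rewrite leq_exp2r; lia.
Qed.

Lemma pb_add F G : pb F -> pb G -> pb (fun e => F e + G e).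
Proof.
move=> [c Fc] [d Gd]; have : pb (fun e => 2 * (mu e + (c + d)) ^ (c + d)).
  by apply: pb_mul; [exact: pb_const | exists (c + d)].
apply: pb_le => e; rewrite mul2n -addnn; apply: leq_add.
  by apply: leq_trans (Fc e) (pow_mono _ _); lia.
by apply: leq_trans (Gd e) (pow_mono _ _); lia.
Qed.

Lemma pb_exp F n : pb F -> pb (fun e => F e ^ n).
Proof.
move=> Fb; elim: n => [|n IH]; first exact: pb_const.
by apply: pb_le (pb_mul Fb IH) => e; rewrite expnS.
Qed.

Lemma pb_pow F c : pb F -> pb (fun e => (F e + c) ^ c).
Proof. by move=> Fb; apply/pb_exp/pb_add => //; apply: pb_const. Qed.
End PolynomialBounds.

Ltac pbs := repeat first [assumption | apply: pb_id | apply: pb_pow | apply: pb_exp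
  | apply: pb_add | apply: pb_mul | apply: pb_const].

(* Insertion of [n] new stacks after the stacks [0], ..., [p]. *)
Definition insr (p n y : nat) : nat := if y <= p then y else y + n.

Definition insq (p n z : nat) : option nat :=
  if z <= p then Some z else if z <= p + n then None else Some (z - n).

(** The stacks [ins] become invisible to [c]: what it would find or leave right after [s1] is found
    or left after [ins]. *)
Lemma exec_ins c x t s1 ins s2 s2' :
  exec c (lay x (nth 0 (s1 ++ s2))) t (lay x (nth 0 (s1 ++ s2'))) ->
  exec (ren (insr (size s1) (size ins)) c) (lay x (nth 0 (s1 ++ ins ++ s2))) t
    (lay x (nth 0 (s1 ++ ins ++ s2'))).
Proof.
set p := size s1; set n := size ins => ex.
have rK : pcancel (insr p n) (insq p n).
  move=> y; rewrite /insr /insq; case: (leqP y p) => h; first by rewrite h.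
  by rewrite ifN; [rewrite ifN; [congr Some|]|]; lia.
have qK : ocancel (insq p n) (insr p n).
  move=> z; rewrite /insr /insq; case: (leqP z p) => h /=; first by rewrite h.
  by case: (leqP z (p + n)) => h' //=; rewrite ifN; lia.
have hS y : lay x (nth 0 (s1 ++ ins ++ s2)) (insr p n y) = lay x (nth 0 (s1 ++ s2)) y.
  case: y => [|y] //; rewrite /insr; case: ifP => h /=; congr unary; rewrite !nth_cat -/p.
    by rewrite h.
  by rewrite -/n !ifN; [congr nth|..]; lia.
have := exec_ren rK qK ex hS; congr exec; apply: functional_extensionality => z.
rewrite /splice /insq; case: (leqP z p) => h.
  by case: z h => [|z] //= h; congr unary; rewrite !nth_cat -/p h.
case: z h => // z h; case: (leqP z.+1 (p + n)) => h' /=.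
  by congr unary; rewrite !nth_cat -/p -/n (ltnNge z p) -ltnS h /= !ifT //; lia.
have -> : z.+1 - n = (z - n).+1 by lia.
by rewrite /=; congr unary; rewrite !nth_cat -/p -/n !ifN; [congr nth|..]; lia.
Qed.

Lemma vupd_cat s1 a s2 b : vupd (nth 0 (s1 ++ a :: s2)) (size s1) b = nth 0 (s1 ++ b :: s2).
Proof.
apply: functional_extensionality => j; rewrite /vupd !nth_cat; case: eqP => [->|ne].
  by rewrite ltnn subnn.
by case: ltnP => // h; have -> : j - size s1 = (j - size s1).-1.+1 by lia.
Qed.

Lemma nth_zeros s n : nth 0 (s ++ nseq n 0) = nth 0 s.
Proof.
apply: functional_extensionality => j; rewrite nth_cat; case: ltnP => // h.
by rewrite nth_nseq if_same nth_default.
Qed.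

Lemma nth_mid (s1 : seq nat) a s2 : nth 0 (s1 ++ a :: s2) (size s1) = a.
Proof. by rewrite nth_cat ltnn subnn. Qed.

Lemma exec_push_cat x s1 a s2 :
  exec (Push (size s1).+1 true) (lay x (nth 0 (s1 ++ a :: s2))) 1
    (lay x (nth 0 (s1 ++ a.+1 :: s2))).
Proof. by have := exec_push x (nth 0 (s1 ++ a :: s2)) (size s1); rewrite nth_mid vupd_cat. Qed.

Lemma exec_pop_cat x s1 a s2 :
  exec (Pop (size s1).+1) (lay x (nth 0 (s1 ++ a :: s2))) 1
    (lay x (nth 0 (s1 ++ a.-1 :: s2))).
Proof. by have := exec_pop x (nth 0 (s1 ++ a :: s2)) (size s1); rewrite nth_mid vupd_cat. Qed.

Lemma exec_clear_cat x s1 a s2 :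
  exists2 t, exec (clear (size s1)) (lay x (nth 0 (s1 ++ a :: s2))) t
    (lay x (nth 0 (s1 ++ 0 :: s2))) & t <= 2 * a + 1.
Proof. by have := exec_clear x (nth 0 (s1 ++ a :: s2)) (size s1); rewrite nth_mid vupd_cat. Qed.

Lemma exec_transfer_cat x s1 a s2 b s3 :
  exists2 t, exec (transfer (size s1 + (size s2).+1) (size s1)) (lay x (nth 0 (s1 ++ a :: s2 ++ b :: s3))) t
    (lay x (nth 0 (s1 ++ (a + b) :: s2 ++ 0 :: s3))) & t <= 3 * b + 1.
Proof.
have ne : size s1 + (size s2).+1 != size s1 by lia.
have es y : s1 ++ a :: s2 ++ y = (s1 ++ a :: s2) ++ y by rewrite -catA.
have ez : size s1 + (size s2).+1 = size (s1 ++ a :: s2) by rewrite size_cat.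
have := exec_transfer x (nth 0 (s1 ++ a :: s2 ++ b :: s3)) ne.
rewrite nth_mid; have -> : nth 0 (s1 ++ a :: s2 ++ b :: s3) (size s1 + (size s2).+1) = b.
  by rewrite es ez nth_mid.
suff -> : vupd (nth 0 (s1 ++ a :: s2 ++ b :: s3)) (size s1 + (size s2).+1) 0 =
  nth 0 (s1 ++ a :: s2 ++ 0 :: s3) by rewrite vupd_cat.
by rewrite ez es vupd_cat -es.
Qed.

Fixpoint clears (m n : nat) : com :=
  if n is n'.+1 then Seq (clear m) (clears m.+1 n') else Skip.

Lemma exec_clears x s1 ins s2 :
  exists2 t, exec (clears (size s1) (size ins)) (lay x (nth 0 (s1 ++ ins ++ s2))) t
    (lay x (nth 0 (s1 ++ nseq (size ins) 0 ++ s2))) & t <= 2 * sumn ins + size ins + 1.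
Proof.
elim: ins s1 => [|a ins IH] s1 /=; first by exists 1 => //; constructor.
have [t1 e1 l1] := exec_clear_cat x s1 a (ins ++ s2).
have [] := IH (rcons s1 0); rewrite size_rcons !cat_rcons => t2 e2 l2.
by exists (t1 + t2); [apply: ExecSeq e1 e2 | lia].
Qed.

Section Computable.
Variables (E : Type) (wd : E -> seq bool) (vs : seq (E -> nat)).

Definition vals (us : seq (E -> nat)) (e : E) : seq nat := [seq v e | v <- us].

Definition mu (e : E) : nat := size (wd e) + sumn (vals vs e).

(* [f] is computed in polynomial time from the word [wd] and the numbers [vs],
   the numbers being given and returned in unary. *)
Definition pt (f : E -> nat) : Prop :=
  exists c T, pb mu T /\
    forall e, exists2 t,
      exec c (lay (wd e) (nth 0 (vals vs e))) t (lay (wd e) (nth 0 (vals vs e ++ [:: f e])))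
      & t <= T e.

Lemma pt_ext f g : (forall e, f e = g e) -> pt f -> pt g.
Proof. by move=> /functional_extensionality ->. Qed.

Lemma pt_pb f : pt f -> pb mu f.
Proof.
case=> c [T [Tb ex]]; apply: pb_le Tb => e; have [t et lt] := ex e.
apply: leq_trans lt; have := exec_size (size (vals vs e)).+1 et.
by rewrite /= nth_mid nth_default // !size_nseq.
Qed.

Fixpoint pts (us : seq (E -> nat)) : Prop :=
  if us is f :: us' then pt f /\ pts us' else True.

Lemma pts_run us : pts us ->
  exists c T, pb mu T /\
    forall e, exists2 t,
      exec c (lay (wd e) (nth 0 (vals vs e))) t (lay (wd e) (nth 0 (vals vs e ++ vals us e)))
      & t <= T e.
Proof.
elim: us => [_|f us IH /= [[cf [Tf [Tfb exf]]] /IH [c [T [Tb ex]]]]].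
  exists Skip, (fun=> 1); split; first exact: pb_const.
  by move=> e; exists 1; rewrite ?cats0 //; constructor.
exists (Seq cf (ren (insr (size vs) 1) c)), (fun e => Tf e + T e); split; first by pbs.
move=> e; have [t1 e1 l1] := exf e; have [t2 e2 l2] := ex e.
exists (t1 + t2); last lia; apply: (ExecSeq e1).
have := @exec_ins c (wd e) t2 (vals vs e) [:: f e] [::] (vals us e).
by rewrite size_map !cats0 => /(_ e2).
Qed.

Lemma pts_pb us : pts us -> pb mu (fun e => sumn (vals us e)).
Proof.
elim: us => [_|f us IH /= [/pt_pb fb /IH ub]]; first exact: pb_const.
exact: pb_add.
Qed.

Lemma pt_zero : pt (fun=> 0).
Proof.
exists Skip, (fun=> 1); split; first exact: pb_const.
move=> e; exists 1 => //; rewrite (@nth_zeros _ 1); constructor.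
Qed.

Lemma pt_succ f : pt f -> pt (fun e => (f e).+1).
Proof.
case=> c [T [Tb ex]]; exists (Seq c (Push (size vs).+1 true)), (fun e => T e + 1).
split; first by pbs.
move=> e; have [t et lt] := ex e; exists (t + 1); last lia.
apply: (ExecSeq et); have := exec_push_cat (wd e) (vals vs e) (f e) [::].
by rewrite size_map.
Qed.

Lemma pt_const n : pt (fun=> n).
Proof. by elim: n => [|n]; [exact: pt_zero | exact: pt_succ]. Qed.
End Computable.

(** Composition: the arguments are computed behind the inputs, [c0] runs on them with the inputs
    hidden, the arguments are erased and the result moves down to the first free stack. This is
    modular because a program witnessing [pt] restores its inputs and leaves every other stack
    empty. *)
Lemma pt_subst E0 (wd0 : E0 -> seq bool) vs0 F E (wd : E -> seq bool) vs (p : E -> E0) us :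
  pt wd0 vs0 F -> pts wd vs us ->
  (forall e, wd0 (p e) = wd e) -> (forall e, vals vs0 (p e) = vals us e) ->
  pt wd vs (fun e => F (p e)).
Proof.
move=> [c0 [T0 [[k T0b] ex0]]] pus ewd evs.
have [c [T [Tb ex]]] := pts_run pus.
pose m := size vs; pose n := size us.
pose fin := Seq (clears m n) (if n == 0 then Skip else transfer (m + n) m).
have Fb : pb (mu wd vs) (fun e => T0 (p e)).
  apply: (@pb_le _ _ _ (fun e => ((mu wd vs e + sumn (vals us e)) + k) ^ k)).
    move=> e; apply: leq_trans (T0b _) _.
    case: k {T0b} => // k; rewrite leq_exp2r // /mu ewd evs; lia.
  by apply: pb_pow; apply: pb_add; [exact: pb_id | exact: pts_pb].
have Fl e : F (p e) <= T0 (p e).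
  have [t et lt] := ex0 (p e); apply: leq_trans lt.
  have := exec_size (size (vals vs0 (p e))).+1 et.
  by rewrite /= nth_mid nth_default // !size_nseq.
exists (Seq c (Seq (ren (insr 0 m) c0) fin)),
  (fun e => T e + T0 (p e) + (2 * sumn (vals us e) + n + 1) + (3 * T0 (p e) + 1)).
split; first by pbs; exact: pts_pb.
move=> e; have [t1 e1 l1] := ex e; have [t2 e2 l2] := ex0 (p e).
rewrite ewd evs in e2.
have e3 := @exec_ins c0 (wd e) t2 [::] (vals vs e) (vals us e) _ e2.
rewrite /= size_map -/m in e3.
have [t4] := exec_clears (wd e) (vals vs e) (vals us e) [:: F (p e)].
rewrite !size_map -/m -/n => e4 l4.
have [t5 e5 l5] : exists2 t, exec (if n == 0 then Skip else transfer (m + n) m)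
  (lay (wd e) (nth 0 (vals vs e ++ nseq n 0 ++ [:: F (p e)]))) t
  (lay (wd e) (nth 0 (vals vs e ++ [:: F (p e)]))) & t <= 3 * T0 (p e) + 1.
  case: n {e4 l4 fin} => [|n'] /=; first by exists 1; [constructor | lia].
  have [t et lt] := exec_transfer_cat (wd e) (vals vs e) 0 (nseq n' 0) (F (p e)) [::].
  exists t; last by have := Fl e; lia.
  move: et; rewrite size_map size_nseq -/m add0n; congr exec; congr lay.
  by rewrite -(nth_zeros (vals vs e ++ [:: F (p e)]) n'.+1) -catA -[n'.+1]addn1 nseqD.
exists (t1 + (t2 + (t4 + t5))); last by lia.
apply: (ExecSeq e1); apply: (ExecSeq e3); apply: (ExecSeq e4); exact: e5.
Qed.

(** Bounded primitive recursion. The bound [B] on all intermediate values keeps the time polynomial: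
    iterating a polynomial-time step could otherwise produce values of exponential length. *)
Lemma pt_iter E (wd : E -> seq bool) vs (n a B : E -> nat) (g : E -> nat -> nat -> nat) :
  pt wd vs n -> pt wd vs a ->
  pt (fun p : E * nat * nat => wd p.1.1)
     ([seq (fun p : E * nat * nat => v p.1.1) | v <- vs]
        ++ [:: (fun p => p.1.2); (fun p => p.2)])
     (fun p => g p.1.1 p.1.2 p.2) ->
  pb (mu wd vs) B -> (forall e m, m <= n e -> iteri m (g e) (a e) <= B e) ->
  pt wd vs (fun e => iteri (n e) (g e) (a e)).
Proof.
move=> ptn pta [cg [Tg [[k Tgb] exg]]] Bb hB.
have nb := pt_pb ptn; case: ptn pta => cn [Tn [Tnb exn]] [ca [Ta [Tab exa]]].
pose m := size vs.
(* Behind the inputs lie the number of remaining rounds, the index and the accumulator. The program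
   for [g] runs with the first of them hidden, and its result replaces the old accumulator. *)
pose body := Seq (Pop m.+1) (Seq (ren (insr m 1) cg)
   (Seq (clear m.+2) (Seq (transfer m.+3 m.+2) (Push m.+2 true)))).
pose TS e := 1 + ((mu wd vs e + n e + B e + k) ^ k + ((2 * B e + 1) + ((3 * B e + 1) + 1))).
exists (Seq cn (Seq (ren (insr m 2) ca) (Seq (While m.+1 body) (Seq (clear m.+1) (transfer m.+2 m))))),
  (fun e => Tn e + (Ta e + ((n e * (TS e + 1) + 1) + ((2 * n e + 1) + (3 * B e + 1))))).
split; first by rewrite /TS; pbs.
move=> e; set x := wd e; set s := vals vs e; pose acc j := iteri j (g e) (a e).
have sm : size s = m by rewrite size_map.
have [t1 e1 l1] := exn e; have [t2 e2 l2] := exa e.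
have e2' := @exec_ins ca x t2 s [:: n e; 0] [::] [:: a e].
rewrite cats0 sm in e2'; move/(_ e2): e2' => e2'.
pose V j := nth 0 (s ++ [:: n e - j; j; acc j]).
have [||t3 e3 l3] := @exec_while_lay x body m V (n e) (TS e).
- by move=> j _; rewrite /V -sm nth_mid.
- move=> j lj.
  have [u1 f1 k1] := exg (e, j, acc j).
  have sz : vals ([seq (fun p : E * nat * nat => v p.1.1) | v <- vs]
        ++ [:: (fun p => p.1.2); (fun p => p.2)]) (e, j, acc j) = s ++ [:: j; acc j].
    by rewrite /vals map_cat -map_comp.
  rewrite sz -/x /= -catA in f1.
  have f1' := @exec_ins cg x u1 s [:: (n e - j).-1] _ _ f1; rewrite sm /= in f1'.
  have [u2 f2 k2] := exec_clear_cat x (s ++ [:: (n e - j).-1; j]) (acc j) [:: acc j.+1].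
  have [u3 f3 k3] := exec_transfer_cat x (s ++ [:: (n e - j).-1; j]) 0 [::] (acc j.+1) [::].
  have f4 := exec_push_cat x (s ++ [:: (n e - j).-1]) j [:: acc j.+1; 0].
  rewrite size_cat sm addn2 -!catA /= in f2; rewrite !size_cat sm addn2 addn1 -!catA /= in f3.
  rewrite size_cat sm addn1 -!catA /= in f4.
  have f0 := exec_pop_cat x s (n e - j) [:: j; acc j]; rewrite sm in f0.
  exists (1 + (u1 + (u2 + (u3 + 1)))).
    apply: (ExecSeq f0); apply: (ExecSeq f1'); apply: (ExecSeq f2); apply: (ExecSeq f3).
    move: f4; congr exec; congr lay; rewrite /V.
    have -> : n e - j.+1 = (n e - j).-1 by lia.
    by rewrite -(@nth_zeros (s ++ [:: _; _; _]) 1) -catA.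
  have b1 : acc j <= B e by apply: hB; lia.
  have b2 : acc j.+1 <= B e by apply: hB; lia.
  have b3 : u1 <= (mu wd vs e + n e + B e + k) ^ k.
    apply: leq_trans k1 _; apply: leq_trans (Tgb _) _.
    rewrite {1}/mu sz sumn_cat -/x /=; case: (k) => // k'; rewrite leq_exp2r // /mu -/x -/s; lia.
  by rewrite /TS; lia.
have [t4 e4 l4] := exec_clear_cat x (s ++ [:: 0]) (n e) [:: acc (n e)].
have [t5 e5 l5] := exec_transfer_cat x s 0 [:: 0] (acc (n e)) [::].
rewrite size_cat sm addn1 -!catA /= in e4; rewrite sm addn2 add0n in e5.
have b : acc (n e) <= B e by apply: hB.
exists (t1 + (t2 + (t3 + (t4 + t5)))); last by rewrite /TS in l3 *; lia.
apply: (ExecSeq e1).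
apply: (@ExecSeq _ _ _ (lay x (V 0))).
  move: e2'; congr exec; congr lay.
    by rewrite -(@nth_zeros (s ++ [:: n e]) 1) -catA.
  by rewrite /V subn0.
apply: (ExecSeq e3).
apply: (@ExecSeq _ _ _ (lay x (nth 0 (s ++ [:: 0; 0; acc (n e)])))).
  by move: e4; rewrite /V subnn.
move: e5; congr exec; congr lay.
by rewrite -(@nth_zeros (s ++ [:: _]) 2) -catA.
Qed.

(* [dup a b c] moves the bits of [a] to both [b] and [c], reversing their order. *)
Definition dup (a b c : nat) : com :=
  While a (Case a Skip
    (Seq (Pop a) (Seq (Push b false) (Push c false)))
    (Seq (Pop a) (Seq (Push b true) (Push c true)))).

Lemma exec_dup a b c s : a != b -> a != c -> b != c ->
  exec (dup a b c) s (5 * size (s a)).+1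
    (upd (upd (upd s c (rev (s a) ++ s c)) b (rev (s a) ++ s b)) a [::]).
Proof.
move=> ab ac bc; move E: (s a) => w; elim: w s E => [|d w IH] s E.
  suff -> : upd (upd (upd s c (rev [::] ++ s c)) b (rev [::] ++ s b)) a [::] = s.
    exact: ExecWhileStop.
  apply: functional_extensionality => y; rewrite /upd /rev /=.
  case: eqP => [->|_]; first by rewrite E.
  by do 2!case: eqP => [->|_] //.
have -> : (5 * size (d :: w)).+1 = (4 + (5 * size w).+1).+1 by rewrite /=; lia.
pose s1 := upd s a w; pose s2 := upd s1 b (d :: s1 b).
apply: (@ExecWhileStep a _ s (upd s2 c (d :: s2 c))); first by rewrite E.
  constructor; rewrite E /s2 /s1.
  have -> : w = behead (s a) by rewrite E.
  by case: d {s1 s2 E}; apply: (@ExecSeq _ _ _ _ _ 1 2); repeat constructor;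
    apply: (@ExecSeq _ _ _ _ _ 1 1); constructor.
have := IH (upd s2 c (d :: s2 c)).
have bb : (b == a) = false by rewrite eq_sym (negPf ab).
have cc : (c == a) = false by rewrite eq_sym (negPf ac).
have cb : (c == b) = false by rewrite eq_sym (negPf bc).
rewrite /s2 /s1 /upd !eqxx ?(negPf ab) ?(negPf ac) ?(negPf bc) ?bb ?cc ?cb => /(_ erefl).
congr exec; apply: functional_extensionality => y; rewrite /upd /=.
case: eqP => // _; rewrite rev_cons cat_rcons.
by do 2!case: eqP => // _; rewrite cat_rcons.
Qed.

(** * Reading the input word *)

Section Word.
Variables (E : Type) (wd : E -> seq bool) (vs : seq (E -> nat)).

Let m := size vs.

(** Two reversals put the word back on stack 0 and leave a copy on stack [m + 3], from which as many
    bits are removed as the number on stack [m + 1] says. *)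
Let drp : com := Seq (mv 0 m.+2) (Seq (dup m.+2 0 m.+3)
  (While m.+1 (Seq (Pop m.+1) (Pop m.+3)))).

Let updw x v w := upd (lay x v) m.+3 w.

Let exec_drop (s : seq nat) x a : size s = m ->
  exists2 t, exec drp (lay x (nth 0 (s ++ [:: a]))) t (updw x (nth 0 s) (drop a x))
    & t <= 9 * size x + 3 * a + 3.
Proof.
move=> sm; pose v := nth 0 (s ++ [:: a]).
have e1 := @exec_mv 0 m.+2 (lay x v) erefl.
have ve i : m < i -> lay x v i.+1 = [::].
  by move=> h; rewrite /= /v nth_default // size_cat sm /=; lia.
have ve2 : lay x v m.+2 = [::] by apply: ve.
have ve3 : lay x v m.+3 = [::] by apply: ve.
rewrite ve2 cats0 in e1.
pose S1 := upd (upd (lay x v) m.+2 (rev x)) 0 [::].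
have h1 : m.+2 != m.+3 by lia.
have S1a : S1 m.+2 = rev x by rewrite /S1 /upd /= eqxx.
have S1b : S1 m.+3 = [::] by rewrite /S1 /upd /= ifN ?ve3 //; lia.
have := @exec_dup m.+2 0 m.+3 S1 erefl h1 erefl.
rewrite S1a S1b size_rev revK !cats0 => e2.
have e3 r j w : j + r = a ->
  exists2 t, exec (While m.+1 (Seq (Pop m.+1) (Pop m.+3))) (updw x (nth 0 (s ++ [:: r])) w) t
    (updw x (nth 0 s) (drop r w)) & t <= 3 * r + 1.
  elim: r j w => [|r IH] j w h.
    exists 1 => //; rewrite drop0 (@nth_zeros s 1); apply: ExecWhileStop.
    by rewrite /updw /upd ifN /= ?nth_default ?sm //; lia.
  have [|t et lt] := IH j.+1 (behead w); first lia.
  exists (2 + t).+1; last lia.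
  apply: (@ExecWhileStep _ _ _ (updw x (nth 0 (s ++ [:: r])) (behead w))).
  - by rewrite /updw /upd ifN /= -?sm ?nth_mid //; lia.
  - have d1 := ExecPop m.+1 (updw x (nth 0 (s ++ [:: r.+1])) w).
    apply: (@ExecSeq _ _ _ (updw x (nth 0 (s ++ [:: r])) w) _ 1 1).
      move: d1; congr exec; rewrite /updw.
      have := upd_lay x (nth 0 (s ++ [:: r.+1])) m r; rewrite -{2}sm vupd_cat => <-.
      apply: functional_extensionality => y; rewrite /upd.
      case: (eqVneq y m.+1) => [->|//].
      by rewrite !ifN //= -?sm ?nth_mid //; lia.
    have := ExecPop m.+3 (updw x (nth 0 (s ++ [:: r])) w); congr exec.
    by apply: functional_extensionality => y; rewrite /updw /upd eqxx; case: eqP.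
  - by move: et; rewrite -drop1 drop_drop addn1.
have [//|t3 e3' l3] := e3 a 0 x.
exists ((4 * size x).+1 + ((5 * size x).+1 + t3)); last lia.
apply: (ExecSeq e1); apply: ExecSeq e3'; move: e2; congr exec.
apply: functional_extensionality => y; rewrite /updw /upd -/v.
case: y => [|y] /=; first by [].
case: (eqVneq y.+1 m.+2) => [ey|ne]; last by rewrite /S1 /upd /= (negPf ne).
by rewrite ifN; [move: ve2; rewrite -ey /= => -> | lia].
Qed.

(** The wanted bit is on top of what remains of the copy. Beyond the end of the word the copy is
    empty, in agreement with the default [false]. *)
Lemma pt_bit a : pt wd vs a -> pt wd vs (fun e => nth false (wd e) (a e)).
Proof.
move=> pta; have ab := pt_pb pta; case: pta => c [T [Tb ex]].
exists (Seq c (Seq drp (Seq (Case m.+3 Skip Skip (Push m.+1 true)) (While m.+3 (Pop m.+3))))),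
  (fun e => T e + ((9 * mu wd vs e + 3 * a e + 3) + (2 + (2 * mu wd vs e + 1)))).
split; first by pbs.
move=> e; set x := wd e; set s := vals vs e.
have sm : size s = m by rewrite size_map.
have [t1 e1 l1] := ex e; have [t2 e2 l2] := exec_drop x (a e) sm.
set b := nth false x (a e).
have e3 : exec (Case m.+3 Skip Skip (Push m.+1 true)) (updw x (nth 0 s) (drop (a e) x)) 2
   (updw x (nth 0 (s ++ [:: nat_of_bool b])) (drop (a e) x)).
  constructor; rewrite /updw {1}/upd eqxx.
  have -> : b = head false (drop (a e) x) by rewrite -nth0 nth_drop addn0.
  case: (drop (a e) x) => [|[] w] /=; rewrite ?(@nth_zeros s 1); try by constructor.
  have := ExecPush m.+1 true (upd (lay x (nth 0 s)) m.+3 (true :: w)); congr exec.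
  have := upd_lay x (nth 0 (s ++ [:: 0])) m 1; rewrite -{2}sm vupd_cat (@nth_zeros s 1) => <-.
  apply: functional_extensionality => y; rewrite /upd.
  case: (eqVneq y m.+1) => [->|//].
  have -> : (m.+1 == m.+3) = false by lia.
  by rewrite /= nth_default ?sm.
have e4 w : exec (While m.+3 (Pop m.+3)) (updw x (nth 0 (s ++ [:: nat_of_bool b])) w)
   (2 * size w).+1 (lay x (nth 0 (s ++ [:: nat_of_bool b]))).
  elim: w => [|d w IH].
    have -> : updw x (nth 0 (s ++ [:: nat_of_bool b])) [::] = lay x (nth 0 (s ++ [:: nat_of_bool b])).
      apply: functional_extensionality => y; rewrite /updw /upd; case: eqP => // -> /=.
      by rewrite nth_default // size_cat sm /=; lia.
    by apply: ExecWhileStop; rewrite /= nth_default // size_cat sm /=; lia.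
  have -> : (2 * size (d :: w)).+1 = (1 + (2 * size w).+1).+1 by rewrite /=; lia.
  apply: ExecWhileStep IH; first by rewrite /updw /upd eqxx.
  have := ExecPop m.+3 (updw x (nth 0 (s ++ [:: nat_of_bool b])) (d :: w)); congr exec.
  by apply: functional_extensionality => y; rewrite /updw /upd eqxx; case: eqP.
exists (t1 + (t2 + (2 + (2 * size (drop (a e) x)).+1))); last first.
  by rewrite size_drop /mu -/x in l2 *; lia.
by apply: (ExecSeq e1); apply: (ExecSeq e2); apply: (ExecSeq e3).
Qed.

Lemma pt_size : pt wd vs (fun e => size (wd e)).
Proof.
exists (Seq drp (While m.+3 (Seq (Pop m.+3) (Push m.+1 true)))),
  (fun e => (9 * mu wd vs e + 3) + (3 * mu wd vs e + 1)).
split; first by pbs.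
move=> e; set x := wd e; set s := vals vs e.
have sm : size s = m by rewrite size_map.
have [t2] := exec_drop x 0 sm; rewrite drop0 (@nth_zeros s 1) => e2 l2.
have e4 w j : exec (While m.+3 (Seq (Pop m.+3) (Push m.+1 true))) (updw x (nth 0 (s ++ [:: j])) w)
   (3 * size w).+1 (lay x (nth 0 (s ++ [:: size w + j]))).
  elim: w j => [|d w IH] j.
    have -> : updw x (nth 0 (s ++ [:: j])) [::] = lay x (nth 0 (s ++ [:: j])).
      apply: functional_extensionality => y; rewrite /updw /upd; case: eqP => // -> /=.
      by rewrite nth_default // size_cat sm /=; lia.
    by apply: ExecWhileStop; rewrite /= nth_default // size_cat sm /=; lia.
  have -> : (3 * size (d :: w)).+1 = (2 + (3 * size w).+1).+1 by rewrite /=; lia.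
  have -> : size (d :: w) + j = size w + j.+1 by rewrite /=; lia.
  apply: ExecWhileStep (IH _); first by rewrite /updw /upd eqxx.
  apply: (@ExecSeq _ _ _ (updw x (nth 0 (s ++ [:: j])) w) _ 1 1).
    have := ExecPop m.+3 (updw x (nth 0 (s ++ [:: j])) (d :: w)); congr exec.
    by apply: functional_extensionality => y; rewrite /updw /upd eqxx; case: eqP.
  have := ExecPush m.+1 true (updw x (nth 0 (s ++ [:: j])) w); congr exec; rewrite /updw.
  have := upd_lay x (nth 0 (s ++ [:: j])) m j.+1; rewrite -{2}sm vupd_cat => <-.
  apply: functional_extensionality => y; rewrite /upd.
  case: (eqVneq y m.+1) => [->|//].
  by rewrite !ifN //= -?sm ?nth_mid //; lia.
exists (t2 + (3 * size x).+1); last by rewrite /mu -/x; lia.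
apply: (ExecSeq e2); have := e4 x 0; rewrite addn0; congr exec.
by rewrite (@nth_zeros s 1).
Qed.
End Word.

(** A stack is read by emptying it: the number goes to a scratch stack and from there both back to
    its place and to the result. *)
Lemma pt_var E (wd : E -> seq bool) vs i f :
  i < size vs -> (forall e, nth 0 (vals vs e) i = f e) -> pt wd vs f.
Proof.
set m := size vs => im vf.
pose body := Seq (Pop m.+2) (Seq (Push i.+1 true) (Push m.+1 true)).
exists (Seq (transfer i m.+1) (While m.+2 body)),
  (fun e => (3 * mu wd vs e + 1) + (mu wd vs e * 4 + 1)).
split; first by pbs.
move=> e; set x := wd e; set s := vals vs e; set v := nth 0 s.
have sm : size s = m by rewrite size_map.
have va : v i = f e by apply: vf.
have fe : f e <= mu wd vs e.
  suff: f e <= sumn s by rewrite /mu -/s; lia.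
  rewrite -va /v; have : i < size s by rewrite sm.
  elim: (s) (i) => [|b s' IH] [|j] //= h; first by lia.
  by apply: leq_trans (IH _ h) _; lia.
have vm j : m <= j -> v j = 0 by move=> h; rewrite /v nth_default ?sm.
have im1 : i != m.+1 by lia.
have [t1 e1 l1] := exec_transfer x v im1.
pose V j := vupd (vupd (vupd v m.+1 (f e - j)) i j) m j.
have [||t2 e2 l2] := @exec_while_lay x body m.+1 V (f e) 3.
- by move=> j _; rewrite /V /vupd eqxx !ifN //; lia.
- move=> j lj; exists (1 + (1 + 1)) => //.
  apply: (ExecSeq (exec_pop _ _ _)); apply: (ExecSeq (exec_push _ _ _)).
  move: (exec_push x) => /(_ _ _); set w := vupd (vupd (V j) _ _) _ _ => /(_ w m).
  congr exec; congr lay; apply: functional_extensionality => y.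
  rewrite /w /V /vupd; do ![case: eqP => ? //]; subst; lia.
exists (t1 + t2); last by rewrite va in l1; lia.
apply: (@ExecSeq _ _ _ (lay x (V 0))).
  move: e1; rewrite va vm // add0n; congr exec; congr lay; apply: functional_extensionality => y.
  rewrite /V /vupd subn0; case: (eqVneq y m) => [->|_]; first by rewrite !ifN ?vm //; lia.
  by do 2![case: eqP => ? //]; subst; lia.
move: e2; congr exec; congr lay; apply: functional_extensionality => y.
rewrite /V /vupd subnn nth_cat sm -/v.
case: (eqVneq y m) => [->|ne]; first by rewrite ltnn subnn.
case: (eqVneq y i) => [->|_]; first by rewrite im va.
case: (eqVneq y m.+1) => [->|_]; first by rewrite ltnNge leqnSn /= subSnn.
by case: ltnP => // h; rewrite vm // nth_default //=; lia.
Qed.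

Lemma ptsP E (wd : E -> seq bool) vs us :
  (forall i, i < size us -> pt wd vs (nth (fun=> 0) us i)) -> pts wd vs us.
Proof.
elim: us => // f us IH h; split; first exact: (h 0).
by apply: IH => i; apply: (h i.+1).
Qed.

Lemma pt_lift E E' (wd : E -> seq bool) vs (p : E' -> E) post f :
  pt wd vs f -> pt (fun e => wd (p e)) ([seq (fun e => v (p e)) | v <- vs] ++ post) (fun e => f (p e)).
Proof.
move=> ptf; apply: (@pt_subst _ _ _ _ _ _ _ _ [seq (fun e => v (p e)) | v <- vs] ptf) => //.
  apply: ptsP => i; rewrite size_map => h; apply: (@pt_var _ _ _ i).
    by rewrite size_cat size_map; lia.
  move=> e; rewrite /vals map_cat nth_cat !size_map h.
  by rewrite -map_comp /= (nth_map (fun=> 0)) // (nth_map (fun=> 0)).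
by move=> e; rewrite /vals -map_comp.
Qed.

(** * Arithmetic, Boolean operations and bounded sums *)

Section Derived.
Variables (E : Type) (wd : E -> seq bool) (vs : seq (E -> nat)).
Notation PT := (pt wd vs).

Let vs2 := [seq (fun p : E * nat * nat => v p.1.1) | v <- vs]
        ++ [:: (fun p => p.1.2); (fun p => p.2)].
Let wd2 := fun p : E * nat * nat => wd p.1.1.

Let pt_idx : pt wd2 vs2 (fun p => p.1.2).
Proof.
apply: (@pt_var _ _ _ (size vs)); first by rewrite size_cat size_map /=; lia.
by move=> e; rewrite /vals map_cat nth_cat !size_map ltnn subnn.
Qed.

Let pt_acc : pt wd2 vs2 (fun p => p.2).
Proof.
apply: (@pt_var _ _ _ (size vs).+1); first by rewrite size_cat size_map /=; lia.
by move=> e; rewrite /vals map_cat nth_cat !size_map ltnNge leqnSn subSnn.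
Qed.

Lemma pt_add a b : PT a -> PT b -> PT (fun e => a e + b e).
Proof.
move=> pa pb'; apply: (@pt_ext _ _ _ (fun e => iteri (b e) (fun _ acc => acc.+1) (a e))).
  by move=> e; elim: (b e) => [|n IH] /=; lia.
apply: (@pt_iter _ _ _ _ _ (fun e => a e + b e) (fun _ _ acc => acc.+1)) => //.
- exact: pt_succ.
- by apply: pb_add; apply: pt_pb.
- by move=> e m; have -> : iteri m (fun _ acc => acc.+1) (a e) = a e + m
    by [elim: m => [|n IH] /=; lia]; lia.
Qed.

(** The index of the last of [n] rounds is the predecessor of [n], and the initial value 0 remains
    if there is no round. *)
Lemma pt_pred a : PT a -> PT (fun e => (a e).-1).
Proof.
move=> pa; apply: (@pt_ext _ _ _ (fun e => iteri (a e) (fun i _ => i) 0)).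
  by move=> e; case: (a e).
apply: (@pt_iter _ _ _ _ _ a (fun _ i _ => i)) => //; first exact: pt_zero.
  exact: pt_pb.
by move=> e [|m] //=; apply: ltnW.
Qed.

Lemma pt_sub a b : PT a -> PT b -> PT (fun e => a e - b e).
Proof.
move=> pa pb'; apply: (@pt_ext _ _ _ (fun e => iteri (b e) (fun _ acc => acc.-1) (a e))).
  by move=> e; elim: (b e) => [|n IH] /=; lia.
apply: (@pt_iter _ _ _ _ _ a (fun _ _ acc => acc.-1)) => //.
- apply: (@pt_subst _ _ _ _ _ _ _ (fun p => (wd2 p, p.2)) [:: (fun p => p.2)]
    (_ : pt fst [:: snd] (fun p => p.2.-1))) => //.
  apply: (@pt_ext _ _ _ (fun p => iteri p.2 (fun i _ => i) 0)); first by case=> x [].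
  apply: (@pt_iter _ _ _ _ _ (fun p => p.2) (fun _ i _ => i)).
  + exact: (@pt_var _ _ _ 0).
  + exact: pt_zero.
  + exact: (@pt_var _ _ _ 1).
  + exact: pt_pb (@pt_var _ _ _ 0 _ _ _).
  + by move=> e [|m] //=; apply: ltnW.
- exact: pt_pb.
- by move=> e m _; elim: m => //= m; apply: leq_trans; lia.
Qed.

Lemma pt_sum n (g : E -> nat -> nat) :
  PT n ->
  pt (fun p : E * nat => wd p.1)
     ([seq (fun p : E * nat => v p.1) | v <- vs] ++ [:: snd]) (fun p => g p.1 p.2) ->
  PT (fun e => \sum_(0 <= i < n e) g e i).
Proof.
move=> pn pg.
apply: (@pt_ext _ _ _ (fun e => iteri (n e) (fun i acc => acc + g e i) 0)).
  by move=> e; elim: (n e) => [|m /= ->]; [rewrite big_geq | rewrite big_nat_recr].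
have [k gk] := pt_pb pg.
apply: (@pt_iter _ _ _ _ _ (fun e => n e * (mu wd vs e + n e + k) ^ k) (fun e i acc => acc + g e i)) => //.
- exact: pt_zero.
- have pg2 : pt wd2 vs2 (fun p => g p.1.1 p.1.2).
    have := @pt_lift _ (E * nat * nat) _ _ fst [:: (fun p => p.2)] _ pg.
    by rewrite map_cat -map_comp -catA.
  apply: (@pt_ext _ _ _ (fun p => iteri (g p.1.1 p.1.2) (fun _ acc => acc.+1) p.2)).
    by move=> p; elim: (g p.1.1 p.1.2) => [|m IH] /=; lia.
  apply: (@pt_iter _ _ _ _ _ (fun p => g p.1.1 p.1.2 + p.2) (fun _ _ acc => acc.+1)) => //.
  + apply: pt_succ; apply: (@pt_var _ _ _ (size vs2).+1); first by rewrite size_cat size_map addn2.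
    by move=> e; rewrite /vals map_cat nth_cat !size_map ltnNge leqnSn subSnn.
  + by apply: pb_add; apply: pt_pb.
  + move=> e m h; have -> : iteri m (fun _ acc => acc.+1) e.2 = e.2 + m.
      by elim: m {h} => [|m' IH] /=; lia.
    by lia.
- by pbs; exact: pt_pb.
- move=> e m le; apply: (@leq_trans (m * (mu wd vs e + n e + k) ^ k)); last by rewrite leq_mul2r le orbT.
  elim: m le => //= m IH le; rewrite mulSn addnC leq_add ?IH //; last by lia.
  apply: leq_trans (gk (e, m)) _.
  have ev : vals ([seq (fun p : E * nat => v p.1) | v <- vs] ++ [:: snd]) (e, m) = vals vs e ++ [:: m].
    by rewrite /vals map_cat -map_comp.
  by rewrite {1}/mu ev sumn_cat /=; case: (k) => // k'; rewrite leq_exp2r // /mu; lia.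
Qed.

Lemma pt_mul a b : PT a -> PT b -> PT (fun e => a e * b e).
Proof.
move=> pa pb'; apply: (@pt_ext _ _ _ (fun e => \sum_(0 <= i < b e) a e)).
  by move=> e; rewrite sum_nat_const_nat subn0 mulnC.
by apply: pt_sum => //; exact: (@pt_lift _ (E * nat) _ _ fst [:: snd] _ pa).
Qed.

Lemma pt_exp a c : PT a -> PT (fun e => a e ^ c).
Proof.
move=> pa; elim: c => [|c IH]; first exact: (pt_const wd vs 1).
by apply: (@pt_ext _ _ _ (fun e => a e * a e ^ c)); [move=> e; rewrite expnS | exact: pt_mul].
Qed.

Lemma pt_eq0 a : PT a -> PT (fun e => a e == 0 : nat).
Proof.
move=> pa; apply: (@pt_ext _ _ _ (fun e => 1 - a e)); first by move=> e; case: (a e).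
by apply: pt_sub => //; apply: pt_const.
Qed.

Lemma pt_negb (b : E -> bool) : PT (fun e => b e) -> PT (fun e => ~~ b e).
Proof.
move=> /pt_eq0; apply: pt_ext => e; by case: (b e).
Qed.

Lemma pt_andb (b c : E -> bool) : PT (fun e => b e) -> PT (fun e => c e) -> PT (fun e => b e && c e).
Proof. by move=> pa pc; apply: pt_ext (pt_mul pa pc) => e; rewrite mulnb. Qed.

Lemma pt_orb (b c : E -> bool) : PT (fun e => b e) -> PT (fun e => c e) -> PT (fun e => b e || c e).
Proof.
move=> pa pc; apply: pt_ext (pt_negb (pt_andb (pt_negb pa) (pt_negb pc))) => e.
by rewrite negb_and !negbK.
Qed.

Lemma pt_implb (b c : E -> bool) : PT (fun e => b e) -> PT (fun e => c e) -> PT (fun e => b e ==> c e).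
Proof. by move=> pa pc; apply: pt_ext (pt_orb (pt_negb pa) pc) => e; rewrite implybE. Qed.

Lemma pt_eqb (b c : E -> bool) : PT (fun e => b e) -> PT (fun e => c e) -> PT (fun e => b e == c e).
Proof.
move=> pa pc; apply: pt_ext (pt_andb (pt_implb pa pc) (pt_implb pc pa)) => e.
by case: (b e); case: (c e).
Qed.

Lemma pt_addb (b c : E -> bool) : PT (fun e => b e) -> PT (fun e => c e) -> PT (fun e => b e (+) c e).
Proof.
by move=> pa pc; apply: pt_ext (pt_negb (pt_eqb pa pc)) => e; case: (b e); case: (c e).
Qed.

Lemma pt_leq a b : PT a -> PT b -> PT (fun e => a e <= b e).
Proof. by move=> pa pb'; apply: pt_eq0; apply: pt_sub. Qed.

Lemma pt_eqn a b : PT a -> PT b -> PT (fun e => a e == b e).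
Proof.
move=> pa pb'; apply: pt_ext (pt_andb (pt_leq pa pb') (pt_leq pb' pa)) => e.
by rewrite eqn_leq.
Qed.

Lemma pt_if (b : E -> bool) (x y : E -> nat) : PT (fun e => b e) -> PT x -> PT y ->
  PT (fun e => if b e then x e else y e).
Proof.
move=> pa px py; apply: pt_ext (pt_add (pt_mul pa px) (pt_mul (pt_negb pa) py)) => e.
by case: (b e) => /=; lia.
Qed.

Lemma pt_ifb (b x y : E -> bool) : PT (fun e => b e) -> PT (fun e => x e) -> PT (fun e => y e) ->
  PT (fun e => if b e then x e else y e).
Proof. by move=> pa px py; apply: pt_ext (pt_if pa px py) => e; case: (b e). Qed.

End Derived.

Section Application.
Variables (E : Type) (wd : E -> seq bool) (vs : seq (E -> nat)).
Notation W := (seq bool).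

(** This lemma and the following ones reduce an arbitrary environment to a canonical one, with the
    word and the numerical arguments as independent variables. Recursive definitions need to be
    treated only there. *)
Lemma pt_app0 F : pt (fun x : W => x) [::] F -> pt wd vs (fun e => F (wd e)).
Proof. by move=> pF; apply: (pt_subst (p := wd) (us := [::]) pF). Qed.

Lemma pt_app1 (F : W -> nat -> nat) a :
  pt fst [:: snd] (fun p => F p.1 p.2) -> pt wd vs a -> pt wd vs (fun e => F (wd e) (a e)).
Proof. by move=> pF pa; apply: (pt_subst (p := fun e => (wd e, a e)) (us := [:: a]) pF). Qed.

Lemma pt_app2 (F : W -> nat -> nat -> nat) a b :
  pt (fun p => p.1.1) [:: (fun p => p.1.2); (fun p => p.2)] (fun p => F p.1.1 p.1.2 p.2) ->
  pt wd vs a -> pt wd vs b -> pt wd vs (fun e => F (wd e) (a e) (b e)).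
Proof.
by move=> pF pa pb'; apply: (pt_subst (p := fun e => (wd e, a e, b e)) (us := [:: a; b]) pF).
Qed.

Lemma pt_app3 (F : W -> nat -> nat -> nat -> nat) a b c :
  pt (fun p => p.1.1.1) [:: (fun p => p.1.1.2); (fun p => p.1.2); (fun p => p.2)]
     (fun p => F p.1.1.1 p.1.1.2 p.1.2 p.2) ->
  pt wd vs a -> pt wd vs b -> pt wd vs c -> pt wd vs (fun e => F (wd e) (a e) (b e) (c e)).
Proof.
by move=> pF pa pb' pc;
  apply: (pt_subst (p := fun e => (wd e, a e, b e, c e)) (us := [:: a; b; c]) pF).
Qed.

Lemma pt_app4 (F : W -> nat -> nat -> nat -> nat -> nat) a b c d :
  pt (fun p => p.1.1.1.1)
     [:: (fun p => p.1.1.1.2); (fun p => p.1.1.2); (fun p => p.1.2); (fun p => p.2)]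
     (fun p => F p.1.1.1.1 p.1.1.1.2 p.1.1.2 p.1.2 p.2) ->
  pt wd vs a -> pt wd vs b -> pt wd vs c -> pt wd vs d ->
  pt wd vs (fun e => F (wd e) (a e) (b e) (c e) (d e)).
Proof.
by move=> pF pa pb' pc pd;
  apply: (pt_subst (p := fun e => (wd e, a e, b e, c e, d e)) (us := [:: a; b; c; d]) pF).
Qed.

Lemma pt_app5 (F : W -> nat -> nat -> nat -> nat -> nat -> nat) a b c d g :
  pt (fun p => p.1.1.1.1.1)
     [:: (fun p => p.1.1.1.1.2); (fun p => p.1.1.1.2); (fun p => p.1.1.2); (fun p => p.1.2);
         (fun p => p.2)]
     (fun p => F p.1.1.1.1.1 p.1.1.1.1.2 p.1.1.1.2 p.1.1.2 p.1.2 p.2) ->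
  pt wd vs a -> pt wd vs b -> pt wd vs c -> pt wd vs d -> pt wd vs g ->
  pt wd vs (fun e => F (wd e) (a e) (b e) (c e) (d e) (g e)).
Proof.
by move=> pF pa pb' pc pd pg;
  apply: (pt_subst (p := fun e => (wd e, a e, b e, c e, d e, g e)) (us := [:: a; b; c; d; g]) pF).
Qed.

Lemma pt_count n (g : E -> nat -> bool) :
  pt wd vs n ->
  pt (fun p : E * nat => wd p.1)
     ([seq (fun p : E * nat => v p.1) | v <- vs] ++ [:: snd]) (fun p => g p.1 p.2) ->
  pt wd vs (fun e => count (g e) (iota 0 (n e))).
Proof.
move=> pn pg; apply: pt_ext (pt_sum (g := fun e i => g e i) pn pg) => e.
by rewrite /index_iota subn0 -sum1_count [RHS]big_mkcond; apply: eq_bigr => i _; case: (g e i).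
Qed.

Lemma pt_has n (g : E -> nat -> bool) :
  pt wd vs n ->
  pt (fun p : E * nat => wd p.1)
     ([seq (fun p : E * nat => v p.1) | v <- vs] ++ [:: snd]) (fun p => g p.1 p.2) ->
  pt wd vs (fun e => has (g e) (iota 0 (n e))).
Proof.
move=> pn pg; apply: pt_ext (pt_leq (pt_const _ _ 1) (pt_count pn pg)) => e.
by rewrite has_count.
Qed.

Lemma pt_all n (g : E -> nat -> bool) :
  pt wd vs n ->
  pt (fun p : E * nat => wd p.1)
     ([seq (fun p : E * nat => v p.1) | v <- vs] ++ [:: snd]) (fun p => g p.1 p.2) ->
  pt wd vs (fun e => all (g e) (iota 0 (n e))).
Proof.
move=> pn pg; apply: pt_ext (pt_negb (pt_has (g := fun e i => ~~ g e i) pn (pt_negb pg))) => e.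
by rewrite -all_predC; congr nat_of_bool; apply: eq_all => i /=; rewrite negbK.
Qed.
End Application.

(* [pt_hook] is redefined below, as more functions become available. *)
Ltac pt_hook := fail.
Ltac pt_lookup :=
  first [ apply: (@pt_var _ _ _ 0); [done | reflexivity]
        | apply: (@pt_var _ _ _ 1); [done | reflexivity]
        | apply: (@pt_var _ _ _ 2); [done | reflexivity]
        | apply: (@pt_var _ _ _ 3); [done | reflexivity]
        | apply: (@pt_var _ _ _ 4); [done | reflexivity]
        | apply: (@pt_var _ _ _ 5); [done | reflexivity]
        | apply: (@pt_var _ _ _ 6); [done | reflexivity]
        | apply: (@pt_var _ _ _ 7); [done | reflexivity] ].
Ltac pt_step :=
  lazymatch goal with
  | |- pt _ _ (fun _ => ?n) => apply: pt_const
  | |- pt _ _ (fun p => snd _) => pt_lookup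
  | |- pt _ _ snd => pt_lookup
  | |- pt _ _ size => apply: pt_size
  | |- pt _ _ (fun p => addn _ _) => apply: pt_add
  | |- pt _ _ (fun p => muln _ _) => apply: pt_mul
  | |- pt _ _ (fun p => subn _ _) => apply: pt_sub
  | |- pt _ _ (fun p => expn _ _) => apply: pt_exp
  | |- pt _ _ (fun p => S _) => apply: pt_succ
  | |- pt _ _ (fun p => predn _) => apply: pt_pred
  | |- pt _ _ (fun p => if _ then _ else _) => apply: pt_if
  | |- pt _ _ (fun p => nat_of_bool (if _ then _ else _)) => apply: pt_ifb
  | |- pt _ _ (fun p => nat_of_bool (andb _ _)) => apply: pt_andb
  | |- pt _ _ (fun p => nat_of_bool (orb _ _)) => apply: pt_orb
  | |- pt _ _ (fun p => nat_of_bool (implb _ _)) => apply: pt_implb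
  | |- pt _ _ (fun p => nat_of_bool (negb _)) => apply: pt_negb
  | |- pt _ _ (fun p => nat_of_bool (addb _ _)) => apply: pt_addb
  | |- pt _ _ (fun p => nat_of_bool (leq _ _)) => apply: pt_leq
  | |- pt _ _ (fun p => nat_of_bool (@eq_op Datatypes_bool__canonical__eqtype_Equality _ _)) =>
    apply: pt_eqb
  | |- pt _ _ (fun p => nat_of_bool (eq_op _ _)) => apply: pt_eqn
  | |- pt _ _ (fun p => nat_of_bool (all _ (iota 0 _))) => apply: pt_all; cbn [map cat fst snd]
  | |- pt _ _ (fun p => nat_of_bool (has _ (iota 0 _))) => apply: pt_has; cbn [map cat fst snd]
  | |- pt _ _ (fun p => count _ (iota 0 _)) => apply: pt_count; cbn [map cat fst snd]
  | |- pt _ _ (fun p => bigop _ _ _) => apply: pt_sum; cbn [map cat fst snd]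
  | |- pt _ _ (fun p => size _) => first [apply: pt_size | pt_hook]
  | |- pt _ _ (fun p => nat_of_bool (nth false _ _)) => apply: pt_bit
  | |- pt _ _ _ => first [assumption | pt_hook]
  end.
Ltac pt_auto := repeat (lazy beta; pt_step).

Lemma pt_div E (wd : E -> seq bool) vs a b :
  pt wd vs a -> pt wd vs b -> pt wd vs (fun e => a e %/ b e).
Proof.
apply: (pt_app2 (F := fun _ a b => a %/ b)).
(* The quotient counts the positive multiples of the divisor up to the dividend; the first factor
   gives 0 for the divisor 0. *)
apply: (@pt_ext _ _ _ (fun p => (0 < p.2) * \sum_(0 <= i < p.1.2) (i.+1 * p.2 <= p.1.2))).
  case=> -[x m] d /=; case: (posnP d) => [->|d0]; first by rewrite divn0.
  set q := m %/ d; rewrite mul1n (eq_bigr (fun i => nat_of_bool (i < q))); last first.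
    by move=> i _; rewrite leq_divRL.
  rewrite /index_iota subn0 -(subnKC (leq_div m d)) iotaD big_cat /=.
  rewrite (eq_big_seq (fun=> 1)); last by move=> i; rewrite mem_iota => /andP[_ ->].
  rewrite sum1_size size_iota big1_seq ?addn0 // => i; rewrite mem_iota add0n => /andP[_ /andP[h _]].
  by rewrite ltnNge h.
pt_auto.
Qed.

Lemma pt_mod E (wd : E -> seq bool) vs a b :
  pt wd vs a -> pt wd vs b -> pt wd vs (fun e => a e %% b e).
Proof.
move=> pa pb'; apply: pt_ext (pt_sub pa (pt_mul (pt_div pa pb') pb')) => e.
by rewrite {1}(divn_eq (a e) (b e)) addKn.
Qed.

(** * Decoding circuits *)

Definition zeros (x : seq bool) (p : nat) : nat := count (fun q => ~~ nth false x q) (iota 0 p).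

(** The ones of the [j]-th unary block are exactly those preceded by [j] zeros. Decoding by counting
    needs no parser, and it is meaningful for every word. *)
Definition num (x : seq bool) (j : nat) : nat :=
  count (fun p => nth false x p && (zeros x p == j)) (iota 0 (size x)).

(** Codes are the words ending with 0, and the empty word, which passes thanks to the default
    bit. *)
Definition is_code (x : seq bool) : bool := ~~ nth false x (size x).-1.

Lemma iotaSn n : iota 0 n.+1 = 0 :: map succn (iota 0 n).
Proof. by rewrite /= -[1]addn0 iotaDl. Qed.

Lemma zeros_cons b x p : zeros (b :: x) p.+1 = ~~ b + zeros x p.
Proof. by rewrite /zeros iotaSn /= count_map. Qed.

Lemma num_true x j : num (true :: x) j = (j == 0) + num x j.
Proof.
rewrite /num [size _]/= iotaSn /= count_map [0 == j]eq_sym; congr (_ + _).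
by apply: eq_count => p /=; rewrite zeros_cons.
Qed.

Lemma num_false x j : num (false :: x) j = if j is j'.+1 then num x j' else 0.
Proof.
rewrite /num [size _]/= iotaSn /= count_map add0n; case: j => [|j].
  by rewrite (@eq_count _ _ pred0) ?count_pred0 // => p /=; rewrite zeros_cons andbF.
by apply: eq_count => p /=; rewrite zeros_cons.
Qed.

Lemma enc_cons a s : enc_seq (a :: s) = nseq a true ++ false :: enc_seq s.
Proof. by rewrite /enc_seq /= cat_rcons. Qed.

Lemma num_enc s j : num (enc_seq s) j = nth 0 s j.
Proof.
elim: s j => [|a s IH] j; first by rewrite nth_nil.
rewrite enc_cons; elim: a => [|a IHa] /=; first by rewrite num_false; case: j.
by rewrite num_true IHa; case: j {IHa}.
Qed.

Lemma zeros_enc s : zeros (enc_seq s) (size (enc_seq s)) = size s.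
Proof.
elim: s => [|a s IH] //; rewrite enc_cons.
by elim: a => [|a IHa] /=; rewrite zeros_cons ?IH ?IHa.
Qed.

Lemma enc_seq_inj : injective enc_seq.
Proof.
move=> s t e; apply: (@eq_from_nth _ 0); first by rewrite -!zeros_enc e.
by move=> i _; rewrite -!num_enc e.
Qed.

Lemma is_codeP x : reflect (exists s, x = enc_seq s) (is_code x).
Proof.
apply: (iffP idP) => [|[s ->]].
  elim: x => [|b [|c x] IH]; first by exists [::].
    by case: b {IH} => // _; exists [:: 0].
  move=> /IH [[|a s] e] //; case: b {IH}; first by exists (a.+1 :: s); rewrite enc_cons e enc_cons.
  by exists [:: 0, a & s]; rewrite enc_cons e.
elim: s => // a s; rewrite enc_cons /is_code size_cat /= addnS /=.
rewrite nth_cat size_nseq ltnNge leq_addr /= addKn; case: (enc_seq s) => //= b w.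
Qed.

Lemma num_le x j : num x j <= size x.
Proof. by rewrite /num (leq_trans (count_size _ _)) // size_iota. Qed.

Definition code_len (x : seq bool) (p : nat) : nat :=
  if num x p == 0 then 1 else if num x p == 1 then 2 else (num x p.+1).+2.

(** Index, among the coded numbers, of the tag of gate [j]; the number of gates and the output come
    before the first gate. *)
Definition pos (x : seq bool) (j : nat) : nat := iteri j (fun _ p => p + code_len x p) 2.

Definition gate_at (x : seq bool) (j : nat) : gate :=
  let p := pos x j in
  if num x p == 0 then Input else if num x p == 1 then Neg (num x p.+1) else
  let s := mkseq (fun q => num x (p.+2 + q)) (num x p.+1) in
  if num x p == 2 then Conj s else Disj s.

Definition circ (x : seq bool) : circuit := Circuit (mkseq (gate_at x) (num x 0)) (num x 1).

(** The last gate has to end where the sequence of numbers ends. Tags above 3 are excluded here,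
    since [gate_at] takes any of them for a disjunction. *)
Definition is_circ (x : seq bool) : bool :=
  [&& is_code x, pos x (num x 0) == zeros x (size x) &
      all (fun j => num x (pos x j) <= 3) (iota 0 (num x 0))].

Lemma mkseq_nth_drop (s : seq nat) p n : p + n <= size s ->
  mkseq (fun q => nth 0 s (p + q)) n = take n (drop p s).
Proof.
move=> le; apply: (@eq_from_nth _ 0).
  by rewrite size_mkseq size_take size_drop; case: ltnP => //; lia.
by move=> i; rewrite size_mkseq => h; rewrite nth_mkseq // nth_take // nth_drop.
Qed.

Lemma enc_circuitK C : is_circ (enc_circuit C) /\ circ (enc_circuit C) = C.
Proof.
case: C => gs o; rewrite /enc_circuit /=; set s := [:: _, _ & _].
have np p : num (enc_seq s) p = nth 0 s p by rewrite num_enc.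
have sz j k : j < size gs ->
    num (enc_seq s) ((2 + size (flatten [seq gate_code i | i <- take j gs])) + k) =
    nth 0 (gate_code (nth Input gs j) ++ flatten (map gate_code (drop j.+1 gs))) k.
  move=> lj; rewrite np.
  have -> : s = [:: size gs, o & flatten (map gate_code (take j gs))] ++
     (gate_code (nth Input gs j) ++ flatten (map gate_code (drop j.+1 gs))).
    rewrite /s -[_ ++ flatten _]/(flatten (map gate_code (nth Input gs j :: drop j.+1 gs))).
    by rewrite -drop_nth //= -flatten_cat -map_cat cat_take_drop.
  by rewrite nth_cat ltnNge leq_addr /= addKn.
have P j : j <= size gs -> pos (enc_seq s) j = 2 + size (flatten (map gate_code (take j gs))).
  elim: j => [|j IH] lj; first by rewrite take0.
  rewrite /pos /= -/(pos _ j) IH ?(ltnW lj) // (take_nth Input lj) map_rcons flatten_rcons size_cat addnA.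
  congr (_ + _); rewrite /code_len.
  have := sz j 0 lj; have := sz j 1 lj; rewrite addn1 addn0 => -> ->.
  by case: (nth Input gs j).
have G j : j < size gs -> num (enc_seq s) (pos (enc_seq s) j) <= 3 /\ gate_at (enc_seq s) j = nth Input gs j.
  move=> lj; rewrite /gate_at P ?(ltnW lj) //.
  have := sz j 0 lj; have := sz j 1 lj; rewrite addn1 addn0 => -> ->.
  have mk t n : (forall q, q < size t -> nth 0 t q = nth 0 (gate_code (nth Input gs j) ++ flatten (map gate_code (drop j.+1 gs))) q.+2) ->
    n = size t ->
    mkseq (fun q : nat => num (enc_seq s) ((2 + size (flatten [seq gate_code i | i <- take j gs])).+2 + q)) n = t.
    move=> h ->; apply: (@eq_from_nth _ 0); rewrite size_mkseq // => q lq.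
    by rewrite nth_mkseq // h // -sz //; congr num; lia.
  case: (nth Input gs j) mk => [|i|t|t] mk //=; split => //.
    by congr Conj; apply: mk => // q lq /=; rewrite nth_cat lq.
  by congr Disj; apply: mk => // q lq /=; rewrite nth_cat lq.
split; last first.
  rewrite /circ !np /=; congr Circuit; apply: (@eq_from_nth _ Input); rewrite size_mkseq // => j lj.
  by rewrite nth_mkseq //; have [] := G j lj.
apply/and3P; split; first by apply/is_codeP; exists s.
  by rewrite zeros_enc np /= P // take_size.
by rewrite np /=; apply/allP => j; rewrite mem_iota add0n => /andP[_ /G []].
Qed.

Lemma is_circ_enc x : is_circ x -> x = enc_circuit (circ x).
Proof.
case/and3P => /is_codeP [s ->] {x}; rewrite zeros_enc => /eqP pn /allP le3.
have np p : num (enc_seq s) p = nth 0 s p by rewrite num_enc.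
rewrite /enc_circuit /= size_mkseq; congr enc_seq; rewrite !np in pn le3 *.
set n := nth 0 s 0 in pn le3 *; set x := enc_seq s in pn le3 np *.
have mono i j : i <= j -> pos x i <= pos x j.
  move=> /subnKC <-; elim: (j - i) => [|k IH]; rewrite ?addn0 // addnS.
  by apply: (leq_trans IH); rewrite {2}/pos /= leq_addr.
have P j : j <= n -> take (pos x j) s = [:: nth 0 s 0, nth 0 s 1 & flatten (map gate_code (mkseq (gate_at x) j))].
  elim: j => [|j IH] lj.
    have : 1 < size s by rewrite -pn; apply: (leq_trans _ (mono 0 n _)).
    by case: (s) => [|a [|b s']] //= _; rewrite take0.
  have lp : pos x j.+1 <= size s by rewrite -pn; apply: mono.
  rewrite /mkseq -[j.+1]addn1 iotaD map_cat map_cat flatten_cat -/(mkseq _ _) addn1 /= add0n cats0.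
  rewrite -!cat_cons -IH 1?ltnW //.
  move: lp; rewrite {1 2}/pos /= -/(pos x j) => lp.
  rewrite takeD; congr (_ ++ _).
  have l3 : num x (pos x j) <= 3 by apply: le3; rewrite mem_iota add0n.
  move: lp l3; rewrite /gate_at /code_len !np; set p := pos x j.
  have dr : p < size s -> drop p s = nth 0 s p :: drop p.+1 s by move=> h; rewrite (drop_nth 0 h).
  have dr' : p.+1 < size s -> drop p.+1 s = nth 0 s p.+1 :: drop p.+2 s by move=> h; rewrite (drop_nth 0 h).
  have mk : p + (nth 0 s p.+1).+2 <= size s ->
    mkseq (fun q => num x (p.+2 + q)) (nth 0 s p.+1) = take (nth 0 s p.+1) (drop p.+2 s).
    move=> h; rewrite -mkseq_nth_drop; last lia.
    by apply: eq_mkseq => q; rewrite np.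
  have [e|ne0] := eqVneq (nth 0 s p) 0.
    by move=> lp _; rewrite dr ?e /= ?take0 //; lia.
  have [e|ne1] := eqVneq (nth 0 s p) 1.
    move=> lp _; rewrite dr; last lia.
    by rewrite dr' ?e /= ?take0 //; lia.
  move=> lp l3; rewrite dr; last lia.
  rewrite dr'; last lia.
  rewrite mk //=; set b := nth 0 s p.+1 in lp *.
  have sz : size (take b (drop p.+2 s)) = b by rewrite size_take size_drop; case: ltnP => //; lia.
  have [e|ne2] := eqVneq (nth 0 s p) 2; first by rewrite /= sz e.
  by rewrite /= sz; congr (_ :: _); move: ne0 ne1 ne2 l3; case: (nth 0 s p) => [|[|[|[|]]]].
by have := P n (leqnn n); rewrite pn take_size.
Qed.

Definition is_neg (g : gate) : bool := if g is Neg _ then true else false.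
Definition is_conj (g : gate) : bool := if g is Conj _ then true else false.

Lemma node_circ x j : node (circ x) j = if j < num x 0 then gate_at x j else Input.
Proof.
by rewrite /node /circ /=; case: ltnP => h; [rewrite nth_mkseq | rewrite nth_default ?size_mkseq].
Qed.

(** The bound required for iterating [code_len]; it has to hold for words that encode no circuit
    too. *)
Lemma pos_le x j : pos x j <= 2 + j * (2 + size x).
Proof.
elim: j => // j IH; rewrite /pos /= -/(pos x j) /code_len.
by have := num_le x (pos x j).+1; case: eqP => _; [|case: eqP => _]; lia.
Qed.

Section Accessors.
Variables (E : Type) (wd : E -> seq bool) (vs : seq (E -> nat)).
Implicit Types j q : E -> nat.

Lemma pt_zeros j : pt wd vs j -> pt wd vs (fun e => zeros (wd e) (j e)).
Proof. by apply: (pt_app1 (F := zeros)); rewrite /zeros; pt_auto. Qed.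
End Accessors.

Ltac pt_hook ::= apply: pt_zeros.

Section Accessors.
Variables (E : Type) (wd : E -> seq bool) (vs : seq (E -> nat)).
Implicit Types j q : E -> nat.

Lemma pt_num j : pt wd vs j -> pt wd vs (fun e => num (wd e) (j e)).
Proof. by apply: (pt_app1 (F := num)); rewrite /num; pt_auto. Qed.
End Accessors.

Ltac pt_hook ::= lazymatch goal with
  | |- pt _ _ (fun e => zeros _ _) => apply: pt_zeros
  | |- pt _ _ (fun e => num _ _) => apply: pt_num
  | |- pt _ _ (fun e => divn _ _) => apply: pt_div
  | |- pt _ _ (fun e => modn _ _) => apply: pt_mod
  end.

Section Accessors.
Variables (E : Type) (wd : E -> seq bool) (vs : seq (E -> nat)).
Implicit Types j q : E -> nat.

Lemma pt_pos j : pt wd vs j -> pt wd vs (fun e => pos (wd e) (j e)).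
Proof.
apply: (pt_app1 (F := pos)); rewrite /pos.
apply: (@pt_iter _ _ _ _ _ (fun p => 2 + p.2 * (2 + size p.1))
   (fun p _ acc => acc + code_len p.1 acc)); cbn [map cat].
- by pt_auto.
- by pt_auto.
- by rewrite /code_len; pt_auto.
- by apply: pt_pb; pt_auto.
- by move=> p m le; apply: leq_trans (pos_le _ _) _; rewrite leq_add2l leq_mul2r le orbT.
Qed.
End Accessors.

Ltac pt_hook2 := fail.
Ltac pt_hook ::= lazymatch goal with
  | |- pt _ _ (fun e => zeros _ _) => apply: pt_zeros
  | |- pt _ _ (fun e => num _ _) => apply: pt_num
  | |- pt _ _ (fun e => pos _ _) => apply: pt_pos
  | |- pt _ _ (fun e => divn _ _) => apply: pt_div
  | |- pt _ _ (fun e => modn _ _) => apply: pt_mod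
  | |- pt _ _ _ => pt_hook2
  end.

Definition fanin (C : circuit) (j : nat) : nat := size (preds (node C j)).
Definition prd (C : circuit) (j q : nat) : nat := nth 0 (preds (node C j)) q.

Section Accessors.
Variables (E : Type) (wd : E -> seq bool) (vs : seq (E -> nat)).
Implicit Types j q : E -> nat.

Lemma pt_is_circ : pt wd vs (fun e => is_circ (wd e)).
Proof. by apply: (@pt_app0 _ _ _ (fun x => is_circ x)); rewrite /is_circ /is_code; pt_auto. Qed.

Lemma pt_is_input j : pt wd vs j -> pt wd vs (fun e => is_input (node (circ (wd e)) (j e))).
Proof.
apply: (pt_app1 (F := fun x i => is_input (node (circ x) i))).
(* Beyond the last gate [node] returns [Input] by default, hence an implication here and
   conjunctions for the other kinds of gates. *)
apply: (@pt_ext _ _ _ (fun p => (p.2 < num p.1 0) ==> (num p.1 (pos p.1 p.2) == 0))).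
  case=> x i /=; rewrite node_circ; case: ltnP => //= _; rewrite /gate_at.
  by do 3!case: eqP => // _.
by pt_auto.
Qed.

Lemma pt_is_neg j : pt wd vs j -> pt wd vs (fun e => is_neg (node (circ (wd e)) (j e))).
Proof.
apply: (pt_app1 (F := fun x i => is_neg (node (circ x) i))).
apply: (@pt_ext _ _ _ (fun p => (p.2 < num p.1 0) && (num p.1 (pos p.1 p.2) == 1))).
  case=> x i /=; rewrite node_circ; case: ltnP => //= _; rewrite /gate_at.
  by case: (num _ (pos _ _)) => [|[|[]]].
by pt_auto.
Qed.

Lemma pt_is_conj j : pt wd vs j -> pt wd vs (fun e => is_conj (node (circ (wd e)) (j e))).
Proof.
apply: (pt_app1 (F := fun x i => is_conj (node (circ x) i))).
apply: (@pt_ext _ _ _ (fun p => (p.2 < num p.1 0) && (num p.1 (pos p.1 p.2) == 2))).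
  case=> x i /=; rewrite node_circ; case: ltnP => //= _; rewrite /gate_at.
  by case: (num _ (pos _ _)) => [|[|[]]].
by pt_auto.
Qed.

Lemma pt_fanin j : pt wd vs j -> pt wd vs (fun e => fanin (circ (wd e)) (j e)).
Proof.
apply: (pt_app1 (F := fun x i => fanin (circ x) i)).
apply: (@pt_ext _ _ _ (fun p => (p.2 < num p.1 0) *
   (if num p.1 (pos p.1 p.2) == 0 then 0 else if num p.1 (pos p.1 p.2) == 1 then 1
    else num p.1 (pos p.1 p.2).+1))).
  case=> x i /=; rewrite /fanin node_circ; case: ltnP => //= _; rewrite /gate_at mul1n.
  by case: (num _ (pos _ _)) => [|[|[]]] * //=; rewrite size_mkseq.
by pt_auto.
Qed.
End Accessors.

Ltac pt_hook2 ::= lazymatch goal with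
  | |- pt _ _ (fun e => fanin _ _) => apply: pt_fanin
  | |- pt _ _ (fun e => nat_of_bool (is_circ _)) => apply: pt_is_circ
  | |- pt _ _ (fun e => nat_of_bool (is_input _)) => apply: pt_is_input
  | |- pt _ _ (fun e => nat_of_bool (is_neg _)) => apply: pt_is_neg
  | |- pt _ _ (fun e => nat_of_bool (is_conj _)) => apply: pt_is_conj
  end.

Lemma pt_prd E (wd : E -> seq bool) vs j q :
  pt wd vs j -> pt wd vs q -> pt wd vs (fun e => prd (circ (wd e)) (j e) (q e)).
Proof.
apply: (pt_app2 (F := fun x j q => prd (circ x) j q)).
apply: (@pt_ext _ _ _ (fun p => (p.2 < fanin (circ p.1.1) p.1.2) *
   (if num p.1.1 (pos p.1.1 p.1.2) == 1 then num p.1.1 (pos p.1.1 p.1.2).+1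
    else num p.1.1 ((pos p.1.1 p.1.2).+2 + p.2)))).
  case=> -[x i] r /=; rewrite /prd; case: ltnP => /= h; last by rewrite nth_default.
  move: h; rewrite /fanin node_circ mul1n; case: (ltnP i (num x 0)) => //= _; rewrite /gate_at.
  case: (num x (pos x i)) => [|[|[|n]]] /=.
  - by [].
  - by case: r.
  - by rewrite size_mkseq => h; rewrite nth_mkseq.
  - by rewrite size_mkseq => h; rewrite nth_mkseq.
by pt_auto.
Qed.

Ltac pt_hook2 ::= lazymatch goal with
  | |- pt _ _ (fun e => fanin _ _) => apply: pt_fanin
  | |- pt _ _ (fun e => prd _ _ _) => apply: pt_prd
  | |- pt _ _ (fun e => nat_of_bool (is_circ _)) => apply: pt_is_circ
  | |- pt _ _ (fun e => nat_of_bool (is_input _)) => apply: pt_is_input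
  | |- pt _ _ (fun e => nat_of_bool (is_neg _)) => apply: pt_is_neg
  | |- pt _ _ (fun e => nat_of_bool (is_conj _)) => apply: pt_is_conj
  end.

(** * A constraint satisfaction problem for circuits of weft 1 *)

Definition gate_okb (C : circuit) (j : nat) : bool :=
  all (fun q => prd C j q < j) (iota 0 (fanin C j)) &&
  [|| is_input (node C j), is_neg (node C j) |
      (1 < fanin C j) &&
      all (fun q => all (fun r => prd C j r != prd C j q) (iota 0 q)) (iota 0 (fanin C j))].

Definition circuit_okb (C : circuit) (n : nat) : bool :=
  [&& all (gate_okb C) (iota 0 n), out C < n &
      all (fun j => all (fun q => prd C j q != out C) (iota 0 (fanin C j))) (iota 0 n)].

(* For [t = true] (resp. [false]): every path from an input to [j] has fewer
   than [h] wires and at most one (resp. no) large node. *)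
Fixpoint shallow (C : circuit) (h : nat) (t : bool) (j : nat) : bool :=
  if h is h'.+1 then
    is_input (node C j) ||
    (large (node C j) ==> t) &&
    all (fun q => shallow C h' (t && ~~ large (node C j)) (prd C j q)) (iota 0 (fanin C j))
  else false.

Lemma prdP C j i : reflect (exists2 q, q < fanin C j & prd C j q = i) (i \in preds (node C j)).
Proof. exact: (iffP (nthP 0)). Qed.

Lemma all_prd C j (P : pred nat) :
  all (fun q => P (prd C j q)) (iota 0 (fanin C j)) = all P (preds (node C j)).
Proof. by rewrite -[in RHS](mkseq_nth 0 (preds (node C j))) all_map. Qed.

Lemma node_default C j : size (gates C) <= j -> node C j = Input.
Proof. exact: nth_default. Qed.

Lemma gate_okP C j : gate_okb C j = gate_ok j (node C j).
Proof.
rewrite /gate_okb (all_prd C j (fun i => i < j)) /gate_ok; congr andb.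
have uP : all (fun q => all (fun r => prd C j r != prd C j q) (iota 0 q)) (iota 0 (fanin C j))
   = uniq (preds (node C j)).
  apply/idP/idP => [/allP h|u].
    apply: contraT => /(uniqPn 0) [r [q [rq lq e]]].
    have := h q; rewrite mem_iota => /(_ lq) /allP/(_ r); rewrite mem_iota => /(_ rq) /eqP; exact.
  apply/allP => q; rewrite mem_iota => lq; apply/allP => r; rewrite mem_iota => rq.
  by rewrite nth_uniq //; [lia | apply: ltn_trans lq].
by rewrite uP /fanin; case: (node C j).
Qed.

Lemma circuit_okP C : circuit_okb C (size (gates C)) <-> circuit_ok C.
Proof.
split=> [/and3P [/allP g lo /allP w]|[g lo w]].
  split=> // [j lj|j]; first by rewrite -gate_okP; apply: g; rewrite mem_iota.
  case: (ltnP j (size (gates C))) => lj; last by rewrite /wire node_default.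
  have := w j; rewrite mem_iota add0n (all_prd C j (fun i => i != out C)) => /(_ lj) /allP h.
  by apply/negP => /h; rewrite eqxx.
apply/and3P; split=> //; apply/allP => j; rewrite mem_iota add0n => /andP [_ lj].
  by rewrite gate_okP g.
rewrite (all_prd C j (fun i => i != out C)); apply/allP => i ij; apply/negP => /eqP e.
by have := w j; rewrite /wire -e ij.
Qed.

Lemma prd_lt C j q : circuit_ok C -> j < size (gates C) -> q < fanin C j -> prd C j q < j.
Proof.
by move=> [/(_ j) g _ _] /g /andP [/allP h _] lq; apply: h; apply: mem_nth.
Qed.

Lemma fanin_gt0 C j : circuit_ok C -> j < size (gates C) -> ~~ is_input (node C j) -> 0 < fanin C j.
Proof.
move=> [/(_ j) g _ _] /g /andP [_]; rewrite /fanin.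
by case: (node C j) => //= s /andP [h _] _; apply: ltnW.
Qed.

Lemma ex_input_path C j : circuit_ok C -> j < size (gates C) ->
  exists i p, [/\ is_input (node C i), path (wire C) i p & last i p = j].
Proof.
move=> ok; elim/ltn_ind: j => j IH lj.
have [ij|ni] := boolP (is_input (node C j)); first by exists j, [::].
have f0 := fanin_gt0 ok lj ni; have lt := prd_lt ok lj f0.
have [i [p [ii pp pl]]] := IH _ lt (ltn_trans lt lj).
exists i, (rcons p j); split=> //; last by rewrite last_rcons.
by rewrite rcons_path pp pl; apply: mem_nth.
Qed.

(** The recursion over predecessors replaces the quantification over paths. Every node is reached
    from some input, so the condition on paths is never vacuous: this refutes it for [h = 0] and
    shows that a large node requires [t = true]. *)
Lemma shallowP C h t j : circuit_ok C -> j < size (gates C) ->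
  shallow C h t j <->
  (forall i p, is_input (node C i) -> path (wire C) i p -> last i p = j ->
     size p < h /\ count (fun j => large (node C j)) (i :: p) <= t).
Proof.
move=> ok; elim: h t j => [|h IH] t j lj.
  split=> // H; have [i [p [ii pp pl]]] := ex_input_path ok lj.
  by have [] := H i p ii pp pl.
have Li i : is_input (node C i) -> large (node C i) = false by case: (node C i).
split=> [/= sh i p ii|H] /=.
  case/lastP: p => [_ _|p j']; first by rewrite /= (Li _ ii).
  rewrite rcons_path last_rcons => /andP [pp wj] ej; subst j'.
  case/orP: sh => [ij|/andP [lt al]]; first by move: wj; rewrite /wire; case: (node C j) ij.
  have /prdP [q lq eq] := wj; move/allP/(_ q): al; rewrite mem_iota => /(_ lq) /IH.
  have lq' := prd_lt ok lj lq.
  move=> /(_ (ltn_trans lq' lj) i p ii pp (esym eq)) [h1 h2]; split; first by rewrite size_rcons.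
  rewrite -cats1 count_cat /= addn0; move: h2 => /=.
  by case: (large (node C j)) lt => /=; [move=> -> /=; lia | rewrite andbT; lia].
have [//|ni] := boolP (is_input (node C j)).
have ext q i p : q < fanin C j -> is_input (node C i) -> path (wire C) i p -> last i p = prd C j q ->
   size (rcons p j) < h.+1 /\ count (fun j => large (node C j)) (i :: rcons p j) <= t.
  move=> lq ii pp pl; apply: H; rewrite ?last_rcons // rcons_path pp pl.
  exact: mem_nth.
have cnt i p : count (fun j => large (node C j)) (i :: rcons p j) =
   count (fun j => large (node C j)) (i :: p) + large (node C j).
  by rewrite -rcons_cons -cats1 count_cat /= addn0.
rewrite /=; apply/andP; split.
  have f0 := fanin_gt0 ok lj ni; have lt := prd_lt ok lj f0.
  have [i [p [ii pp pl]]] := ex_input_path ok (ltn_trans lt lj).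
  by have [_] := ext _ i p f0 ii pp pl; rewrite cnt; case: (large _) => //; case: (t) => //; lia.
apply/allP => q; rewrite mem_iota => lq; have lt := prd_lt ok lj lq.
apply/IH; first exact: ltn_trans lj.
move=> i p ii pp pl; have [] := ext _ i p lq ii pp pl; rewrite size_rcons cnt => h1 h2; split=> //.
by case: (large _) h2 => /=; rewrite ?andbT ?andbF; case: (t) => /=; lia.
Qed.

(** * Certificates for the values of nodes *)

Section Certificates.
Variables (C : circuit) (k : nat).
Implicit Types (I : seq (nat * nat)).

Definition known_in I y : bool := has (fun l => (0 < l.1 <= k) && (l.2 == y.+1)) I.

(** Two consecutive entries of the increasing list of chosen inputs lie strictly on both sides of
    [y + 1]. Inputs are shifted by one because 0 is the value of the first sentinel. *)
Definition known_out I y : bool :=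
  has (fun l => has (fun l' => [&& l'.1 == l.1.+1, l'.1 <= k.+1 & l.2 < y.+1 < l'.2]) I) I.

(** If no predecessor decides the gate (claim 0), a conjunction is true and a disjunction false; a
    claim naming a deciding predecessor gives the opposite value. *)
Definition claimed I j a b : bool :=
  has (fun l => (l.1 == k.+2 + a) && (((l.2 == 0) == is_conj (node C j)) == b)) I.

(** The pairs in [I] alone prove that node [j], reached at address [a], has value [b]. A negation is
    treated as a disjunction of one predecessor with complemented output. True conjunctions and
    false disjunctions need all predecessors, in the other cases one is enough. *)
Fixpoint cert I h j a b : bool :=
  if h is h'.+1 then
    if is_input (node C j) then (if b then known_in I j else known_out I j)
    else if large (node C j) then claimed I j a b
    else if (b (+) is_neg (node C j)) == is_conj (node C j) then
      all (fun q => cert I h' (prd C j q) (2 * a + q.+1) (b (+) is_neg (node C j))) (iota 0 (fanin C j))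
    else
      has (fun q => cert I h' (prd C j q) (2 * a + q.+1) (b (+) is_neg (node C j))) (iota 0 (fanin C j))
  else false.

(** The descent stops at the large gates, where the claims made in [I] are compared with the
    certificates that [I] contains. Addresses restart from 0 below a large gate, where weft 1 leaves
    nothing to claim. *)
Fixpoint unrefuted I h j a : bool :=
  if h is h'.+1 then
    if large (node C j) then
      all (fun l => (l.1 == k.+2 + a) ==>
        if l.2 == 0 then
          all (fun q => ~~ cert I h' (prd C j q) 0 (~~ is_conj (node C j))) (iota 0 (fanin C j))
        else (l.2 <= fanin C j) && ~~ cert I h' (prd C j l.2.-1) 0 (is_conj (node C j))) I
    else all (fun q => unrefuted I h' (prd C j q) (2 * a + q.+1)) (iota 0 (fanin C j))
  else true.

Definition consistent I : bool :=
  all (fun l => [&& (l.1 == 0) ==> (l.2 == 0),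
    (l.1 == k.+1) ==> (l.2 == (size (gates C)).+1),
    (0 < l.1 <= k) ==> [&& 0 < l.2, l.2 <= size (gates C) & is_input (node C l.2.-1)] &
    all (fun l' => ((l.1 == l'.1) ==> (l.2 == l'.2)) &&
                   ((l'.1 == l.1.+1) && (l'.1 <= k.+1) ==> (l.2 < l'.2))) I]) I.

Definition check I d : bool :=
  [&& consistent I, ~~ cert I d.+1 (out C) 0 false & unrefuted I d.+1 (out C) 0].

Lemma cert_mono I I' h j a b : {subset I <= I'} -> cert I h j a b -> cert I' h j a b.
Proof.
move=> sub; have hs (P : pred (nat * nat)) : has P I -> has P I'.
  by case/hasP => l /sub lI Pl; apply/hasP; exists l.
elim: h j a b => //= h IH j a b.
case: ifP => _.
  case: b; first exact: hs.
  rewrite /known_out => /hs; apply: sub_has => l; exact: hs.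
case: ifP => _; first exact: hs.
by case: ifP => _; [apply: sub_all | apply: sub_has] => q; apply: IH.
Qed.

Variables (v : nat -> bool) (al : nat -> nat).
Hypothesis okC : circuit_ok C.
Hypothesis valv : valuation C v.

Lemma node_val j : j < size (gates C) -> ~~ is_input (node C j) ->
  v j (+) is_neg (node C j) =
    (if is_conj (node C j) then all v (preds (node C j)) else has v (preds (node C j))).
Proof.
move=> lj; have := valv lj.
by case: (node C j) => [|i|s|s] //= -> _; rewrite ?addbT ?addbF ?negbK ?orbF.
Qed.

(* A large gate is claimed by the index (plus one) of a predecessor which
   determines its value, or by [0] if there is none. *)
Definition good_claim j q : bool :=
  if q == 0 then all (fun r => v (prd C j r) == is_conj (node C j)) (iota 0 (fanin C j))
  else (q <= fanin C j) && (v (prd C j q.-1) != is_conj (node C j)).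

Fixpoint good_claims h j a : bool :=
  if h is h'.+1 then
    if large (node C j) then good_claim j (al (k.+2 + a))
    else all (fun q => good_claims h' (prd C j q) (2 * a + q.+1)) (iota 0 (fanin C j))
  else true.

Lemma large_claim j q : j < size (gates C) -> large (node C j) -> good_claim j q ->
  v j = ((q == 0) == is_conj (node C j)).
Proof.
move=> lj lg; have ni : ~~ is_input (node C j) by case: (node C j) lg.
have nn : is_neg (node C j) = false by case: (node C j) lg.
have := node_val lj ni; rewrite nn addbF /good_claim => ->.
case: (q == 0).
  rewrite (all_prd C j (fun i => v i == is_conj (node C j))).
  move: lg; rewrite /large; case: (node C j) => //= s ls h.
    by apply: sub_all h => i /eqP.
  by apply/negbTE; rewrite -all_predC; apply: sub_all h => i /eqP /= ->.
case/andP=> le; set i := prd C j q.-1 => h.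
have mi : i \in preds (node C j).
  by apply: mem_nth; move: le lg; rewrite /large -/(fanin C j); lia.
by case: (is_conj _) h => /= h; [apply/negbTE/allPn | apply/hasP]; exists i => //; case: (v i) h.
Qed.

(** With the budget [false] no large node is met, hence there is no claim to verify. *)
Lemma shallow_good h j a : shallow C h false j -> good_claims h j a.
Proof.
elim: h j a => //= h IH j a /orP [ij|].
  have ni : preds (node C j) = [::] by case: (node C j) ij.
  by rewrite /large /fanin ni.
rewrite implybF => /andP [lg]; rewrite (negbTE lg).
by apply: sub_all => q; apply: IH.
Qed.

Hypothesis al_in : forall y, y < size (gates C) -> is_input (node C y) ->
  v y = has (fun p => al p == y.+1) (iota 1 k).
Hypothesis al_lt : forall p, p <= k -> al p < al p.+1.

Lemma al_mono p p' : p' <= k.+1 -> p < p' -> al p < al p'.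
Proof.
elim: p' => // p' IH le; rewrite ltnS leq_eqVlt => /predU1P [->|lt].
  exact: al_lt.
by apply: ltn_trans (IH _ lt) (al_lt _); lia.
Qed.

Lemma cert_sound I h j a b : (forall l, l \in I -> l.2 = al l.1) ->
  j < size (gates C) -> good_claims h j a -> cert I h j a b -> v j = b.
Proof.
move=> Ial; elim: h j a b => //= h IH j a b lj.
have [ij|nij] := boolP (is_input (node C j)).
  move=> _; rewrite (al_in lj ij); case: b.
    case/hasP => l lI /andP [/andP [l0 lk] /eqP e]; apply/hasP; exists l.1.
      by rewrite mem_iota l0 add1n ltnS.
    by rewrite -Ial // e.
  case/hasP => l lI /hasP [l' lI'] /and3P [/eqP e1 le /andP [h1 h2]].
  apply/hasP => -[p]; rewrite mem_iota add1n ltnS => /andP [_ lp] /eqP ep.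
  have le2 p1 p2 : p1 <= p2 -> p2 <= k.+1 -> al p1 <= al p2.
    by rewrite leq_eqVlt => /predU1P [->|lt] // le2; apply/ltnW/al_mono.
  rewrite (Ial _ lI) -ep in h1; rewrite (Ial _ lI') e1 -ep in h2; rewrite e1 in le.
  (* A chosen position lies on one side of the gap, and by monotonicity so does its value. *)
  case: (leqP p l.1) => c.
    by have := leq_ltn_trans (le2 p l.1 c (ltnW le)) h1; rewrite ltnn.
  by have := leq_ltn_trans (le2 l.1.+1 p c (leqW lp)) h2; rewrite ltnn.
case: ifP => lg gc.
  by case/hasP => l lI /andP [/eqP e1 /eqP <-]; apply: large_claim => //; rewrite (Ial _ lI) e1.
set b' := b (+) _ => H; apply: (@addIb (is_neg (node C j))); rewrite (node_val lj nij) -/b'.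
have st q : q < fanin C j -> cert I h (prd C j q) (2 * a + q.+1) b' -> v (prd C j q) = b'.
  move=> lq; apply: IH; first exact: ltn_trans (prd_lt okC lj lq) lj.
  by move/allP: gc; apply; rewrite mem_iota.
case: eqP H => [eb /allP H|nb /hasP [q]].
  have {}H : all (fun i => v i == b') (preds (node C j)).
    rewrite -all_prd; apply/allP => q; rewrite mem_iota => lq; apply/eqP/st => //.
    by apply: H; rewrite mem_iota.
  rewrite -eb; case: b' H {st eb} => H; first by apply: sub_all H => i /eqP.
  by apply/negbTE; rewrite -all_predC; apply: sub_all H => i /eqP /= ->.
rewrite mem_iota => lq /(st _ lq) vq.
have mq : prd C j q \in preds (node C j) by apply: mem_nth.
case: (is_conj _) nb => nb; case: b' vq nb {st} => // vq _.
  by apply/negbTE/allPn; exists (prd C j q); rewrite ?vq.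
by apply/hasP; exists (prd C j q).
Qed.

Definition graph (f : nat -> nat) (Ts : seq nat) : seq (nat * nat) := [seq (p, f p) | p <- Ts].

Hypothesis al_0 : al 0 = 0.
Hypothesis al_last : al k.+1 = (size (gates C)).+1.

Lemma known_out_complete y : y < size (gates C) -> is_input (node C y) -> v y = false ->
  exists2 p, p <= k & al p < y.+1 < al p.+1.
Proof.
move=> ly iy; rewrite (al_in ly iy) => /hasPn no.
have ex : exists p, y.+1 < al p by exists k.+1; rewrite al_last.
case: (ex_minnP ex) => -[|p]; first by rewrite al_0.
move=> h1 h2; have lp : p <= k by have := h2 k.+1; rewrite al_last => /(_ ly).
exists p => //; rewrite h1 andbT ltn_neqAle leqNgt; apply/andP; split; last first.
  by apply/negP => /h2; rewrite ltnn.
case: p lp {h1 h2} => [_|p lp]; first by rewrite al_0.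
by apply: no; rewrite mem_iota; lia.
Qed.

(** An input takes at most two variables and a node that is not large has at most two predecessors,
    whence [2 ^ h]. The children of address [a] are [2a + 1] and [2a + 2], so [a + 2] at most
    doubles at each level, and the condition on [D] keeps all addresses met below [D]. *)
Lemma cert_complete D h t j a : j < size (gates C) -> shallow C h t j ->
  good_claims h j a -> a.+2 * 2 ^ h <= D ->
  exists Ts, [/\ size Ts <= 2 ^ h, all (fun p => p < k.+2 + D) Ts & cert (graph al Ts) h j a (v j)].
Proof.
elim: h t j a => // h IH t j a lj /= sh gc leD.
have p2 : 0 < 2 ^ h by rewrite expn_gt0.
have [ij|ni] := boolP (is_input (node C j)).
  case E: (v j).
    move: E; rewrite (al_in lj ij) => /hasP [p]; rewrite mem_iota => hp ep.
    exists [:: p]; split; rewrite /= ?expnS ?andbT; try lia.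
  have [p lp hp] := known_out_complete lj ij E.
  exists [:: p; p.+1]; split; rewrite /= ?expnS; try lia.
  apply/hasP; exists (p, al p); rewrite ?mem_head //; apply/hasP; exists (p.+1, al p.+1).
    by rewrite !inE eqxx orbT.
  by rewrite /= eqxx ltnS lp hp.
rewrite (negbTE ni) /= in sh; case/andP: sh => lt sh.
case: ifP gc => lg gc.
  exists [:: k.+2 + a]; split; rewrite /= ?expnS ?andbT; try nia.
  by rewrite /claimed /= eqxx -(large_claim lj lg gc) eqxx.
have f2 : fanin C j <= 2 by move: lg; rewrite /large -/(fanin C j); lia.
have st q : q < fanin C j -> exists Ts, [/\ size Ts <= 2 ^ h, all (fun p => p < k.+2 + D) Ts &
    cert (graph al Ts) h (prd C j q) (2 * a + q.+1) (v (prd C j q))].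
  move=> lq; apply: (IH (t && ~~ large (node C j))).
  - exact: ltn_trans (prd_lt okC lj lq) lj.
  - by move/allP: sh; apply; rewrite mem_iota.
  - by move/allP: gc; apply; rewrite mem_iota.
  - by rewrite expnS in leD; nia.
set b' := v j (+) _; have := node_val lj ni; rewrite -/b' => vb.
case: eqP => eb.
  have vq q : q < fanin C j -> v (prd C j q) = b'.
    move=> lq; have mq : prd C j q \in preds (node C j) by apply: mem_nth.
    move: vb eb; case: (is_conj _) => vb eb.
      by move: (vb); rewrite eb => /esym/allP/(_ _ mq) ->.
    by move: (vb); rewrite eb => /esym/hasPn/(_ _ mq) /negbTE ->.
  (* When all predecessors are needed, their lists of variables are concatenated; certificates
     survive by monotonicity. *)
  have col m : m <= fanin C j -> exists Ts, [/\ size Ts <= m * 2 ^ h, all (fun p => p < k.+2 + D) Ts &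
     forall q, q < m -> cert (graph al Ts) h (prd C j q) (2 * a + q.+1) b'].
    elim: m => [|m IHm] lm; first by exists [::].
    have [Ts [s1 a1 c1]] := IHm (ltnW lm); have [Ts' [s2 a2 c2]] := st m lm.
    exists (Ts ++ Ts'); rewrite size_cat all_cat a1 a2; split=> //; first lia.
    move=> q; rewrite ltnS leq_eqVlt => /predU1P [->|/c1]; last first.
      by apply: cert_mono => l; rewrite /graph map_cat mem_cat => ->.
    rewrite vq // in c2; move: c2; apply: cert_mono => l.
    by rewrite /graph map_cat mem_cat orbC => ->.
  have [Ts [s1 a1 c1]] := col _ (leqnn _); exists Ts; split=> //; first by rewrite expnS; nia.
  by apply/allP => q; rewrite mem_iota add0n; apply: c1.
have [q lq vq] : exists2 q, q < fanin C j & v (prd C j q) = b'.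
  move: vb eb; case: (is_conj _) => vb eb.
    have b0 : b' = false by case: b' eb {vb}.
    move: vb; rewrite b0 => /esym/negbT/allPn [i /prdP [q lq <-] /negbTE vq]; by exists q.
  have b1 : b' = true by case: b' eb {vb}.
  by move: vb; rewrite b1 => /esym/hasP [i /prdP [q lq <-] vq]; exists q.
have [Ts [s1 a1 c1]] := st q lq; exists Ts; split=> //; first by rewrite expnS; lia.
by apply/hasP; exists q; rewrite ?mem_iota // -vq.
Qed.

Lemma unrefuted_sound I h t j a : (forall l, l \in I -> l.2 = al l.1) ->
  j < size (gates C) -> shallow C h t j -> good_claims h j a -> unrefuted I h j a.
Proof.
move=> Ial; elim: h t j a => //= h IH t j a lj sh.
have sub q : q < fanin C j -> shallow C h (t && ~~ large (node C j)) (prd C j q).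
  move=> lq; case/orP: sh => [ij|/andP [_ /allP]]; last by apply; rewrite mem_iota.
  by move: lq; rewrite /fanin; case: (node C j) ij.
case: ifP => lg gc; last first.
  apply/allP => q; rewrite mem_iota add0n => lq; apply: (IH (t && ~~ large (node C j))).
  - exact: ltn_trans (prd_lt okC lj lq) lj.
  - exact: sub.
  - by move/allP: gc; apply; rewrite mem_iota.
have snd q b : q < fanin C j -> cert I h (prd C j q) 0 b -> v (prd C j q) = b.
  move=> lq; apply: cert_sound => //; first exact: ltn_trans (prd_lt okC lj lq) lj.
  by apply: shallow_good; have := sub _ lq; rewrite lg andbF.
apply/allP => l lI; apply/implyP => /eqP e; rewrite (Ial l lI) e.
move: gc; rewrite /good_claim; case: eqP => e0.
  move=> /allP gc; apply/allP => q; rewrite mem_iota add0n => lq; apply/negP => /snd.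
  move=> /(_ lq); have := gc q; rewrite mem_iota => /(_ lq) /eqP -> ; by case: (is_conj _).
case/andP=> le ne; rewrite le /=; apply/negP => /snd h'.
by move: ne; rewrite h' ?eqxx //; lia.
Qed.

(** A wrong claim would be caught by a single tuple: the variable of the claim together with a
    certificate for the actual value of one predecessor. One level below, certificates have at most
    half the size [2 ^ h], which leaves room for the claim. *)
Lemma unrefuted_good w D h t j a : 2 ^ h <= w -> 2 * 2 ^ h <= D -> a.+2 * 2 ^ h <= D ->
  (forall Ts, size Ts <= w -> all (fun p => p < k.+2 + D) Ts -> unrefuted (graph al Ts) h j a) ->
  j < size (gates C) -> shallow C h t j -> good_claims h j a.
Proof.
elim: h t j a => //= h IH t j a; rewrite expnS => lw lD1 lD2 un lj sh.
have p2 : 0 < 2 ^ h by rewrite expn_gt0.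
have sub q : q < fanin C j -> shallow C h (t && ~~ large (node C j)) (prd C j q).
  move=> lq; case/orP: sh => [ij|/andP [_ /allP]]; last by apply; rewrite mem_iota.
  by move: lq; rewrite /fanin; case: (node C j) ij.
case: ifP un => lg un; last first.
  have f2 : fanin C j <= 2 by move: lg; rewrite /large -/(fanin C j); lia.
  apply/allP => q; rewrite mem_iota add0n => lq; apply: (IH (t && ~~ large (node C j))).
  - lia.
  - lia.
  - nia.
  - move=> Ts s1 a1; have /allP := un Ts s1 a1; by apply; rewrite mem_iota.
  - exact: ltn_trans (prd_lt okC lj lq) lj.
  - exact: sub.
have aD : k.+2 + a < k.+2 + D by nia.
have cmp q : q < fanin C j -> exists Ts, [/\ size Ts <= 2 ^ h, all (fun p => p < k.+2 + D) Ts &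
    cert (graph al Ts) h (prd C j q) 0 (v (prd C j q))].
  move=> lq; apply: (@cert_complete D h false).
  - exact: ltn_trans (prd_lt okC lj lq) lj.
  - by have := sub q lq; rewrite lg andbF.
  - by apply: shallow_good; have := sub _ lq; rewrite lg andbF.
  - lia.
have un' Ts : size Ts <= 2 ^ h -> all (fun p => p < k.+2 + D) Ts ->
   let I := graph al (k.+2 + a :: Ts) in
   if al (k.+2 + a) == 0 then
     all (fun q => ~~ cert I h (prd C j q) 0 (~~ is_conj (node C j))) (iota 0 (fanin C j))
   else (al (k.+2 + a) <= fanin C j) && ~~ cert I h (prd C j (al (k.+2 + a)).-1) 0 (is_conj (node C j)).
  move=> s1 a1; have := un (k.+2 + a :: Ts); rewrite /= a1 aD => /(_ _ isT) /andP [] //; first lia.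
  by rewrite eqxx.
have mono Ts h' j' a' b : cert (graph al Ts) h' j' a' b -> cert (graph al (k.+2 + a :: Ts)) h' j' a' b.
  by apply: cert_mono => l lI; rewrite inE lI orbT.
rewrite /good_claim; case: eqP => e0.
  apply/allP => q; rewrite mem_iota add0n => lq; have [Ts [s1 a1 /mono c1]] := cmp q lq.
  have := un' Ts s1 a1; cbv zeta; case: eqP => // _ /allP/(_ q); rewrite mem_iota => /(_ lq) nc.
  apply: contraR nc => nv; have -> : ~~ is_conj (node C j) = v (prd C j q).
    by case: (v (prd C j q)) nv; case: (is_conj _).
  exact: c1.
have le : al (k.+2 + a) <= fanin C j.
  by have := un' [::] (ltnW p2) isT; cbv zeta; case: eqP => // _ /andP [].
rewrite le /=; have [|Ts [s1 a1 /mono c1]] := cmp (al (k.+2 + a)).-1; first lia.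
have := un' Ts s1 a1; cbv zeta; case: eqP => // _ /andP [_]; apply: contraNN => /eqP <-.
exact: c1.
Qed.
End Certificates.

Lemma unrefuted_anti C k I I' h j a : {subset I <= I'} ->
  unrefuted C k I' h j a -> unrefuted C k I h j a.
Proof.
move=> sub; elim: h j a => //= h IH j a; case: ifP => _; last by apply: sub_all => q; apply: IH.
move/allP => H; apply/allP => l /sub /H; case: (l.1 == _) => //=; case: ifP => _.
  by apply: sub_all => q; apply: contraNN; apply: cert_mono.
by case/andP=> ->; apply: contraNN; apply: cert_mono.
Qed.

Lemma consistent_anti C k I I' : {subset I <= I'} -> consistent C k I' -> consistent C k I.
Proof.
move=> sub /allP H; apply/allP => l /sub /H /and4P [-> -> -> h] /=.
by apply/allP => l' /sub; move/allP: h; apply.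
Qed.

(** Adding pairs can only create certificates and violations. A list of variables is thus checked by
    any tuple that extends it, and vertices of one fixed width suffice. *)
Lemma check_anti C k I I' d : {subset I <= I'} -> check C k I' d -> check C k I d.
Proof.
move=> sub /and3P [h1 h2 h3]; apply/and3P; split.
- exact: consistent_anti h1.
- by apply: contraNN h2; apply: cert_mono.
- exact: unrefuted_anti h3.
Qed.

Lemma ex_valuation C (X : nat -> bool) : circuit_ok C ->
  exists v, valuation C v /\ forall y, y < size (gates C) -> is_input (node C y) -> v y = X y.
Proof.
move=> ok; suff [v hv] : exists v : nat -> bool, forall j, j < size (gates C) ->
    v j = match node C j with Input => X j | Neg i => ~~ v i | Conj s => all v s | Disj s => has v s end.
  exists v; split; first by move=> j /hv ->; case: (node C j).
  by move=> y /hv ->; case: (node C y).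
suff: forall m, m <= size (gates C) -> exists v : nat -> bool, forall j, j < m ->
    v j = match node C j with Input => X j | Neg i => ~~ v i | Conj s => all v s | Disj s => has v s end.
  exact.
elim=> [|m IH] lm; first by exists X.
have [v hv] := IH (ltnW lm).
pose b := match node C m with Input => X m | Neg i => ~~ v i | Conj s => all v s | Disj s => has v s end.
pose v' j := if j == m then b else v j.
have stable j : j <= m -> {in preds (node C j), v' =1 v}.
  move=> lj i /prdP [q lq <-]; rewrite /v' ifN // neq_ltn.
  by rewrite (leq_trans (prd_lt ok _ lq) lj) //; exact: leq_ltn_trans lm.
exists v' => j; rewrite ltnS => lj; have st := stable j lj.
have -> : v' j = match node C j with Input => X j | Neg i => ~~ v i | Conj s => all v s | Disj s => has v s end.
  by move: lj; rewrite /v' leq_eqVlt; case: eqP => [-> _|_ /= /hv].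
case E: (node C j) st => [|i|s|s] //= st.
- by rewrite st // mem_head.
- by apply/esym/eq_in_all => i /st.
- by apply/esym/eq_in_has => i /st.
Qed.

(** Lists of one or two variables already fix the sentinels and force strict monotonicity, so
    exactly [k] inputs are chosen. Then all claims are right, and a false output would have a
    certificate, which [check] forbids. *)
Lemma csp_sound C k d al : circuit_ok C -> shallow C d.+1 true (out C) ->
  (forall Ts, size Ts <= 2 ^ d.+1 -> all (fun p => p < k.+2 + 2 ^ d.+2) Ts ->
     check C k (graph al Ts) d) ->
  exists v, [/\ valuation C v, weight C v = k & v (out C)].
Proof.
move=> ok sh chk; set n := size (gates C).
have p1 : 0 < 2 ^ d by rewrite expn_gt0.
have p2 : 1 < 2 ^ d.+1 by rewrite expnS; lia.
have D0 : 0 < 2 ^ d.+2 by rewrite expn_gt0.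
have con1 p : p < k.+2 -> consistent C k (graph al [:: p]).
  move=> lp; have /and3P [] // : check C k (graph al [:: p]) d.
  by apply: chk; rewrite //= ?andbT; lia.
have al_0 : al 0 = 0.
  have /allP/(_ (0, al 0)) := con1 0 isT; rewrite mem_head => /(_ isT) /and4P [h _ _ _].
  by apply/eqP.
have al_last : al k.+1 = n.+1.
  have /allP/(_ (k.+1, al k.+1)) := con1 k.+1 (ltnSn _).
  rewrite mem_head => /(_ isT) /and4P [_ h _ _]; apply/eqP; move: h; by rewrite eqxx.
have al_inp p : 0 < p <= k -> [/\ 0 < al p, al p <= n & is_input (node C (al p).-1)].
  move=> hp; have lp : p < k.+2 by lia.
  have /allP/(_ (p, al p)) := con1 p lp; rewrite mem_head.
  by move=> /(_ isT) /and4P [_ _ h _]; apply/and3P; move: h; rewrite hp.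
have al_lt p : p <= k -> al p < al p.+1.
  move=> lp; have /and3P [/allP c _ _] : check C k (graph al [:: p; p.+1]) d.
    by apply: chk; rewrite //= ?andbT; lia.
  have := c (p, al p); rewrite mem_head => /(_ isT) /and4P [_ _ _ /allP/(_ (p.+1, al p.+1))].
  by rewrite /= !inE eqxx orbT => /(_ isT) /andP [_]; rewrite eqxx ltnS lp.
have [v [vv vX]] := ex_valuation (fun y => has (fun p => al p == y.+1) (iota 1 k)) ok.
exists v; have lo : out C < n by case: ok.
have mono p p' : p' <= k.+1 -> p < p' -> al p < al p' by apply: al_mono.
split=> //.
  rewrite /weight -size_filter; set L := filter _ _.
  suff /perm_size -> : perm_eq L [seq (al p).-1 | p <- iota 1 k] by rewrite size_map size_iota.
  have inj : {in iota 1 k &, injective (fun p => (al p).-1)}.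
    move=> p p'; rewrite !mem_iota add1n !ltnS => hp hp' e.
    have [a1 _ _] := al_inp p hp; have [a2 _ _] := al_inp p' hp'.
    case: (ltngtP p p') => // lt; have := mono _ _ _ lt; lia.
  apply: uniq_perm; first by rewrite filter_uniq ?iota_uniq.
    by rewrite map_inj_in_uniq ?iota_uniq.
  move=> y; rewrite mem_filter mem_iota add0n leq0n /=; apply/andP/mapP.
    move=> [/andP [iy vy] ly]; move: vy; rewrite vX // => /hasP [p hp /eqP e].
    by exists p; rewrite // e.
  case=> p hp ->; have hp' : 0 < p <= k by move: hp; rewrite mem_iota add1n ltnS.
  have [a1 a2 a3] := al_inp p hp'; have ly : (al p).-1 < n by lia.
  split=> //; rewrite a3 vX //=; apply/hasP; exists p => //; by rewrite prednK.
have good : good_claims C k v al d.+1 (out C) 0.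
  apply: (@unrefuted_good C k v al ok vv vX al_0 al_last (2 ^ d.+1) (2 ^ d.+2) d.+1 true); rewrite -?expnS //.
  by move=> Ts s1 a1; have /and3P [] := chk Ts s1 a1.
have [|Ts [s1 a1 c1]] := @cert_complete C k v al ok vv vX al_0 al_last (2 ^ d.+2) d.+1 true (out C) 0 lo sh good.
  by rewrite -expnS.
have /and3P [_ nc _] := chk Ts s1 a1; case: (v (out C)) c1 nc => // ->.
by [].
Qed.

(** * From a satisfying assignment to a solution of the constraints *)

Section Complete.
Variables (C : circuit) (k d N : nat) (v : nat -> bool).
Hypothesis ok : circuit_ok C.
Hypothesis sh : shallow C d.+1 true (out C).
Hypothesis vv : valuation C v.
Hypothesis wk : weight C v = k.
Hypothesis vo : v (out C).
Hypothesis lN : (size (gates C)).+1 < N.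
Hypothesis fN : forall j, fanin C j < N.

Let n := size (gates C).
Let L := filter (fun j => is_input (node C j) && v j) (iota 0 n).
Let F := 0 :: rcons (map succn L) n.+1.

Definition witness j : nat :=
  if all (fun r => v (prd C j r) == is_conj (node C j)) (iota 0 (fanin C j)) then 0
  else (find (fun r => v (prd C j r) != is_conj (node C j)) (iota 0 (fanin C j))).+1.

(** The address [a' + 1] has parent [a' / 2], and the parity of [a'] selects the predecessor; [f] is
    fuel, and [a] itself is enough. *)
Fixpoint node_at (f a : nat) : nat :=
  if f is f'.+1 then
    if a is a'.+1 then prd C (node_at f' (a' %/ 2)) (a' %% 2) else out C
  else out C.

Definition solution p : nat := if p < k.+2 then nth 0 F p else witness (node_at (p - k.+2) (p - k.+2)).

Lemma node_at_fuel f a : a <= f -> node_at f a = node_at a a.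
Proof.
elim: f {-2}f (leqnn f) a => [|m IH] f lf a la; first by have -> : f = a by lia.
case: f lf la => [|f] lf la; first by have -> : a = 0 by lia.
case: a la => [|a] // la /=; have la2 : a %/ 2 <= a by apply: leq_div.
by rewrite (IH f) ?(IH a) //; lia.
Qed.

Lemma node_at_child a q : q < 2 ->
  node_at (2 * a + q.+1) (2 * a + q.+1) = prd C (node_at a a) q.
Proof.
move=> lq; rewrite addnS /=; have -> : (2 * a + q) %/ 2 = a by lia.
have -> : (2 * a + q) %% 2 = q by lia.
by rewrite node_at_fuel //; lia.
Qed.

Lemma good_witness j : good_claim C v j (witness j).
Proof.
rewrite /good_claim /witness; case: (boolP (all _ _)) => [h|] //=; rewrite -has_predC => h.
have := h; rewrite has_find size_iota => lt; have := nth_find 0 h; rewrite nth_iota //= add0n => ->.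
by rewrite lt.
Qed.

Lemma good_solution h j a : j = node_at a a -> good_claims C k v solution h j a.
Proof.
elim: h j a => //= h IH j a e; case: ifP => lg.
  by rewrite /solution ifN -?leqNgt ?leq_addr // addKn -e good_witness.
apply/allP => q; rewrite mem_iota add0n => lq; apply: IH; rewrite node_at_child -?e //.
by move: lg lq; rewrite /large -/(fanin C j); lia.
Qed.

Lemma size_L : size L = k.
Proof. by rewrite size_filter. Qed.

Lemma solution_mid p : 0 < p <= k -> solution p = (nth 0 L p.-1).+1.
Proof.
case: p => // p lp; rewrite /solution ifT; last lia.
by rewrite /F /= nth_rcons size_map size_L ifT // (nth_map 0) ?size_L.
Qed.

Lemma solution_last : solution k.+1 = n.+1.
Proof. by rewrite /solution ltnSn /F /= nth_rcons size_map size_L ltnn eqxx. Qed.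

Lemma mem_L y : (y \in L) = [&& is_input (node C y), v y & y < n].
Proof. by rewrite mem_filter mem_iota add0n leq0n /= -andbA. Qed.

Lemma nth_L p : 0 < p <= k -> nth 0 L p.-1 \in L.
Proof. by move=> hp; apply: mem_nth; rewrite size_L; lia. Qed.

Lemma solution_lt p : p <= k -> solution p < solution p.+1.
Proof.
case: p => [|p] lp.
  rewrite {1}/solution /=; case: (posnP k) => k0; first by have := solution_last; rewrite k0 => ->.
  by rewrite solution_mid.
rewrite solution_mid //; case: (ltngtP p.+1 k) lp => // lt _; last first.
  have -> : solution p.+2 = n.+1 by rewrite lt solution_last.
  rewrite ltnS; have /nth_L : 0 < p.+1 <= k by rewrite -lt leqnn.
  by rewrite mem_L => /and3P [].
rewrite solution_mid // ltnS; apply: (sorted_ltn_nth ltn_trans); rewrite ?inE ?size_L //=; try lia.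
by apply: sorted_filter; [exact: ltn_trans | exact: iota_ltn_sorted].
Qed.

Lemma solution_in y : y < n -> is_input (node C y) ->
  v y = has (fun p => solution p == y.+1) (iota 1 k).
Proof.
move=> ly iy; apply/idP/hasP => [vy|[p]].
  have yL : y \in L by rewrite mem_L iy vy.
  have lt : index y L < k by rewrite -size_L index_mem.
  exists (index y L).+1; first by rewrite mem_iota; lia.
  by rewrite solution_mid //= nth_index.
rewrite mem_iota add1n ltnS => hp; rewrite solution_mid // eqSS => /eqP <-.
by have := nth_L hp; rewrite mem_L => /and3P [].
Qed.

Lemma solution_bound p : solution p < N.
Proof.
rewrite /solution; case: ifP => lp.
  apply: leq_ltn_trans lN; case: p lp => // p; rewrite ltnS => lp.
  rewrite /F /= nth_rcons size_map size_L; case: ltnP => h; last by case: eqP.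
  rewrite (nth_map 0) ?size_L //; have := @nth_L p.+1 h; rewrite mem_L => /and3P [_ _]; exact: leqW.
apply: leq_ltn_trans (fN (node_at (p - k.+2) (p - k.+2))); rewrite /witness; case: ifP => // /negbT.
by rewrite -has_predC has_find size_iota.
Qed.

Lemma csp_complete : (forall p, solution p < N) /\ forall Ts, check C k (graph solution Ts) d.
Proof.
split=> [|Ts]; first exact: solution_bound.
have gr l : l \in graph solution Ts -> l.2 = solution l.1 by case/mapP => p _ ->.
have lo : out C < n by case: ok.
have good := @good_solution d.+1 (out C) 0 erefl.
apply/and3P; split; last 1 first.
- exact: (unrefuted_sound ok vv solution_in solution_lt erefl solution_last gr lo sh good).
- apply/allP => l lI; rewrite (gr l lI); apply/and4P; split.
  + by apply/implyP => /eqP ->.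
  + by apply/implyP => /eqP ->; rewrite solution_last.
  + apply/implyP => hp; rewrite solution_mid //=; have := nth_L hp.
    by rewrite mem_L => /and3P [-> _ ->].
  + apply/allP => l' lI'; rewrite (gr l' lI'); apply/andP; split; apply/implyP.
      by move/eqP ->.
    by case/andP => /eqP -> h; apply: solution_lt.
- apply/negP => /(cert_sound ok vv solution_in solution_lt gr lo good).
  by rewrite vo.
Qed.
End Complete.

(** * The gadget graph *)

(** The blue vertex [b] stands for an ordered pair [(u, v)] in base [m + 1]. Without conflict it is
    private to [u]; for a conflict with [u < v] it is shared by both, and the reversed pair has no
    neighbour. So a good red vertex has [m + 1] neighbours, one on behalf of each [v], and the other
    red vertices have none. *)
Definition coverb (m : nat) (good : pred nat) (conf : rel nat) (r b : nat) : bool :=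
  let u := b %/ m.+1 in let v := b %% m.+1 in
  good r && ((r == u) && (conf u v ==> (u < v)) || [&& r == v, conf u v & u < v]).

Definition connb (star : bool) (m u v : nat) : bool :=
  (u != v) && (star ==> ((u == m) || (v == m))).

Section Gadget.
Variables (m t : nat) (star : bool) (good : pred nat) (conf : rel nat).
Hypothesis conf_sym : symmetric conf.
Hypothesis conf_irr : irreflexive conf.
Hypothesis good_m : good m.
Let M := m.+1.

Definition conn_adj : rel 'I_M := fun u v => connb star m u v.

Lemma conn_sym : symmetric conn_adj.
Proof. by move=> u v; rewrite /conn_adj /connb eq_sym orbC. Qed.

Lemma conn_irr : irreflexive conn_adj.
Proof. by move=> u; rewrite /conn_adj /connb eqxx. Qed.

Definition cov_adj : rel ('I_M + 'I_(M * M)) := fun a b =>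
  match a, b with
  | inl r, inr b | inr b, inl r => coverb m good conf r b
  | _, _ => false
  end.

Lemma cov_sym : symmetric cov_adj.
Proof. by case=> u []. Qed.

Lemma cov_irr : irreflexive cov_adj.
Proof. by case. Qed.

Lemma cov_bip u v : cov_adj u v -> in_left u != in_left v.
Proof. by case: u; case: v. Qed.

Definition gadget : pcrbds :=
  @PCRBDSInstance M (M * M) (SGraph conn_sym conn_irr) (SGraph cov_sym cov_irr) cov_bip (t * M).

Lemma pair_lt (u v : 'I_M) : u * M + v < M * M.
Proof. have := ltn_ord u; have := ltn_ord v; rewrite /M; nia. Qed.

Definition pair_ord (u v : 'I_M) : 'I_(M * M) := Ordinal (pair_lt u v).

Lemma pair_ord_div u v : pair_ord u v %/ M = u.
Proof. by rewrite /= divnMDl // divn_small // addn0. Qed.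

Lemma pair_ord_mod u v : pair_ord u v %% M = v.
Proof. by rewrite /= modnMDl modn_small. Qed.

Lemma pair_ord_inj u v u' v' : pair_ord u v = pair_ord u' v' -> u = u' /\ v = v'.
Proof.
move=> e; split; apply: val_inj; first by rewrite /= -(pair_ord_div u v) e pair_ord_div.
by rewrite /= -(pair_ord_mod u v) e pair_ord_mod.
Qed.

Lemma pair_ord_surj (b : 'I_(M * M)) : exists u v, b = pair_ord u v.
Proof.
have lu : b %/ M < M by rewrite ltn_divLR.
have lv : b %% M < M by rewrite ltn_mod.
by exists (Ordinal lu), (Ordinal lv); apply: val_inj; rewrite /= -divn_eq.
Qed.

(* The blue vertex assigned to [r] on behalf of [v]; conflicting vertices share it. *)
Definition blue (p : 'I_M * 'I_M) : 'I_(M * M) :=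
  if conf p.1 p.2 && (p.2 < p.1) then pair_ord p.2 p.1 else pair_ord p.1 p.2.

Lemma coverb_blue (r : 'I_M) (b : 'I_(M * M)) : coverb m good conf r b <-> good r /\ exists v, b = blue (r, v).
Proof.
have [u [v ->]] := pair_ord_surj b; rewrite /coverb pair_ord_div pair_ord_mod; split.
  case/andP => gr /orP [/andP [/eqP/val_inj e uv]|/and3P [/eqP/val_inj e cuv luv]]; split=> //.
    by exists v; subst r; rewrite /blue /=; case: ifP => // /andP [c]; move: uv; rewrite c /=; lia.
  by exists u; subst r; rewrite /blue /= conf_sym cuv luv.
case=> gr [v']; rewrite gr /blue /=; case: ifP => [/andP [c l] /pair_ord_inj [-> ->]|n /pair_ord_inj [-> ->]].
  by rewrite eqxx conf_sym c l orbT.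
rewrite eqxx /=; apply/orP; left; apply/implyP => c; rewrite c /= in n.
case: (ltngtP r v') => // [|e]; first by move=> h; rewrite h in n.
by move: c; rewrite e conf_irr.
Qed.

Lemma neighborhoodP (S : {set 'I_M}) b :
  (b \in neighborhood (Gcov gadget) [set inl u | u in S]) =
  (if b is inr b' then [exists r in S, coverb m good conf r b'] else false).
Proof.
rewrite inE; case: b => [r|b].
  case: imsetP => //= no; apply/existsP => -[u /andP [/imsetP [u' _ ->]]] //=.
case: imsetP => [[] //|_] /=; apply/existsP/existsP => [[u /andP [/imsetP [r rS ->]]]|[r /andP [rS c]]] /=.
  by move=> c; exists r; rewrite rS.
by exists (inl r); rewrite imset_f.
Qed.

(** A blue vertex has at most two neighbours, and a set without blue vertices spans no edge. *)
Lemma gadget_degenerate : degenerate 3 (Gcov gadget).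
Proof.
move=> U /set0Pn [x xU]; have [/existsP [b bU]|/existsPn no] := boolP [exists b, inr b \in U].
  exists (inr b) => //; have [u [v e]] := pair_ord_surj b.
  have sub : [set y in U | adj (Gcov gadget) (inr b) y] \subset [set inl u; inl v].
    apply/subsetP => -[r|b']; rewrite !inE => /andP [_] //=.
    rewrite /coverb e pair_ord_div pair_ord_mod => /andP [_].
    by case/orP => [/andP [/eqP/val_inj -> _]|/and3P [/eqP/val_inj -> _ _]]; rewrite eqxx ?orbT.
  by apply: leq_trans (subset_leq_card sub) _; rewrite cards2; case: (_ != _).
exists x => //; case: x xU => [r|b] xU; last by have := no b; rewrite xU.
rewrite (_ : [set y in U | _] = set0) ?cards0 //; apply/setP => -[r'|b]; rewrite !inE /= ?andbF //.
by rewrite (negbTE (no b)).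
Qed.

(** Covered vertices are images under [blue] of the pairs in [P], of which there are at most
    [t * M]. Reaching the target forces equality everywhere: [t] vertices, all good, and no two
    pairs with the same image. *)
Lemma gadget_solvable_indep : solvable gadget t ->
  exists S : {set 'I_M}, [/\ #|S| = t, {in S, forall r : 'I_M, good r} & {in S &, forall u v : 'I_M, ~~ conf u v}].
Proof.
case=> S [lS _ cS]; exists S.
pose P := [set p : 'I_M * 'I_M | (p.1 \in S) && good p.1].
have PX : P \subset setX S [set: 'I_M].
  by apply/subsetP => p; rewrite !inE => /andP [-> _].
have nP : neighborhood (Gcov gadget) [set inl u | u in S] \subset inr @: (blue @: P).
  apply/subsetP => b; rewrite neighborhoodP; case: b => // b /existsP [r /andP [rS /coverb_blue [gr [v ->]]]].
  by apply/imset_f/imset_f; rewrite inE /= rS gr.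
have cX : #|setX S [set: 'I_M]| = #|S| * M by rewrite cardsX cardsT card_ord.
have c1 := leq_trans cS (subset_leq_card nP); rewrite (card_imset _ inr_inj) /= in c1.
have c2 := leq_imset_card blue P; have c3 := subset_leq_card PX; rewrite cX in c3.
have M0 : 0 < M by [].
have St : #|S| = t.
  have := leq_trans c1 (leq_trans c2 c3); rewrite leq_pmul2r // => h.
  by apply/eqP; rewrite eqn_leq h andbT.
have PE : P = setX S [set: 'I_M] by apply/eqP; rewrite eqEcard PX cX St; exact: leq_trans c1 c2.
have gS r : r \in S -> good r.
  move=> rS; have : (r, r) \in P by rewrite PE !inE rS.
  by rewrite inE => /andP [].
have nc (u v : 'I_M) : u \in S -> v \in S -> u < v -> ~~ conf u v.
  move=> uS vS lt; apply/negP => c.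
  have sub : blue @: P \subset blue @: (P :\ (v, u)).
    apply/subsetP => _ /imsetP [p pP ->]; have [->|ne] := eqVneq p (v, u).
      apply/imsetP; exists (u, v).
        by rewrite !inE /= uS gS // !andbT; apply/eqP => -[e _]; move: lt; rewrite e ltnn.
      by rewrite /blue /= conf_sym c lt /= ltnNge (ltnW lt).
    by apply: imset_f; rewrite !inE ne; move: pP; rewrite inE.
  have vP : (v, u) \in P by rewrite PE !inE vS.
  have := subset_leq_card sub; have := leq_imset_card blue (P :\ (v, u)).
  rewrite (cardsD1 (v, u) P) vP add1n in c3; rewrite St in c3.
  move=> h1 h2; have := leq_trans c3 (leq_trans c1 (leq_trans h2 h1)).
  by rewrite ltnn.
split=> // u v uS vS.
case: (ltngtP u v) => [lt|lt|/val_inj ->]; first exact: nc.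
  by rewrite conf_sym; exact: nc.
by rewrite conf_irr.
Qed.

(** The vertex [ord_max] is adjacent to all others in the clique and in the star alike, so any set
    containing it is connected. *)
Lemma gadget_indep_solvable (S : {set 'I_M}) : #|S| = t -> ord_max \in S ->
  {in S, forall r : 'I_M, good r} -> {in S &, forall u v : 'I_M, ~~ conf u v} -> solvable gadget t.
Proof.
move=> St mS gS nc; exists S; split; first by rewrite St.
  have one x y : x \in S -> y \in S -> (x == ord_max) || (y == ord_max) ->
     connect (fun x y => [&& x \in S, y \in S & adj (Gconn gadget) x y]) x y.
    move=> xS yS e; have [->|ne] := eqVneq x y; first exact: connect0.
    apply: connect1; rewrite xS yS /= /conn_adj /connb; apply/andP; split; first exact: ne.
    by apply/implyP => _; case/orP: e => /eqP -> /=; rewrite eqxx ?orbT.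
  move=> u v uS vS; apply: (@connect_trans _ _ ord_max); apply: one; rewrite ?eqxx ?orbT //.
rewrite /= -St; have cX : #|setX S [set: 'I_M]| = #|S| * M by rewrite cardsX cardsT card_ord.
(* In the absence of conflicts [blue] is injective on the pairs, and every one of them contributes
   to the coverage. *)
rewrite -cX -(card_in_imset (f := blue)); last first.
  move=> [r v] [r' v']; rewrite !inE !andbT /= => rS rS'; rewrite /blue /=.
  case: ifP => [/andP [c l]|_]; case: ifP => [/andP [c' l']|_] /pair_ord_inj [e1 e2]; subst.
  - by [].
  - by have := nc _ _ rS rS'; rewrite c.
  - by have := nc _ _ rS rS'; rewrite conf_sym c'.
  - by [].
rewrite -(card_imset _ (@inr_inj 'I_M _)); apply: subset_leq_card; apply/subsetP => _ /imsetP [_ /imsetP [[r v] pS ->] ->].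
rewrite neighborhoodP; apply/existsP; exists r; move: pS; rewrite !inE andbT /= => rS; rewrite rS.
by apply/coverb_blue; split; [exact: gS | exists v].
Qed.
End Gadget.

(** * Digit expansions and the coding of instances *)

Section Digits.
Variable L : nat.
Hypothesis L0 : 0 < L.

Definition digit u i := iteri i (fun _ a => a %/ L) u %% L.

Lemma digit0 u : digit u 0 = u %% L. Proof. by []. Qed.

Lemma digitS u i : digit u i.+1 = digit (u %/ L) i.
Proof.
rewrite /digit; congr modn; elim: i => // i IH.
by rewrite /= -IH.
Qed.

Lemma digit_lt u i : digit u i < L.
Proof. by rewrite ltn_mod. Qed.

Lemma ex_digits w (f : nat -> nat) : (forall i, f i < L) ->
  exists2 u, u < L ^ w & forall i, i < w -> digit u i = f i.
Proof.
elim: w f => [|w IH] f lf; first by exists 0.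
have [u lu hu] := IH (fun i => f i.+1) (fun i => lf i.+1).
have l0 := lf 0; have e : (u * L + f 0) %/ L = u by rewrite divnMDl // divn_small // addn0.
exists (u * L + f 0); first by rewrite expnS; nia.
case=> [|i] lt; first by rewrite digit0 modnMDl modn_small.
by rewrite digitS e hu.
Qed.

Lemma digits_inj w u v : u < L ^ w -> v < L ^ w -> (forall i, i < w -> digit u i = digit v i) -> u = v.
Proof.
elim: w u v => [|w IH] u v; first by rewrite expn0; case: u; case: v.
move=> lu lv h; rewrite (divn_eq u L) (divn_eq v L) -!digit0 h //; congr (_ * _ + _).
by apply: IH => [||i lt]; rewrite ?ltn_divLR // -?expnSr // -!digitS h.
Qed.
End Digits.

Lemma allpairs_mkseq (F : nat -> nat -> nat) a b :
  [seq F (val u) (val v) | u <- enum 'I_a, v <- enum 'I_b] = mkseq (fun q => F (q %/ b) (q %% b)) (a * b).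
Proof.
transitivity [seq F i j | i <- iota 0 a, j <- iota 0 b].
  by rewrite -(val_enum_ord a) allpairs_mapl -(val_enum_ord b) allpairs_mapr.
elim: a => [|a IH]; first by rewrite mul0n.
rewrite -addn1 iotaD allpairs_cat IH mulnDl mul1n /mkseq iotaD map_cat; congr cat.
rewrite /= cats0 !add0n -[a * b]addn0 iotaDl -map_comp; apply/eq_in_map => j; rewrite mem_iota add0n => /andP [_ lj] /=.
by rewrite divnMDl ?modnMDl ?divn_small ?modn_small ?addn0 //; lia.
Qed.

Lemma eq_allpairs_in (A B : eqType) (f g : A -> B -> nat) s t :
  [seq f u v | u <- s, v <- t] = [seq g u v | u <- s, v <- t] ->
  forall u v, u \in s -> v \in t -> f u v = g u v.
Proof.
elim: s => //= a s IH /eqP; rewrite eqseq_cat ?size_map // => /andP [/eqP e1 /eqP e2] u v.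
rewrite inE => /predU1P [->|us] vt; last exact: IH.
by move/eq_in_map: e1; apply.
Qed.

(** The word records both adjacency relations, the coverage graph being bipartite. As membership in
    the problem asks for some instance with the given code, solvability has to depend on the code
    only. *)
Lemma solvable_enc I J k : enc_pcrbds I = enc_pcrbds J -> solvable I k -> solvable J k.
Proof.
case: I => r b G1 G2 bip t; case: J => r' b' G1' G2' bip' t' /enc_seq_inj /= [e1 e2 e3]; subst r' b' t'.
move/eqP; rewrite eqseq_cat ?size_allpairs // => /andP [/eqP /eq_allpairs_in h1 /eqP /eq_allpairs_in h2].
have a1 u v : adj G1 u v = adj G1' u v.
  by have := h1 u v; rewrite !mem_enum => /(_ isT isT); do 2!case: (adj _ _ _).
have a2 u v : adj G2 (inl u) (inr v) = adj G2' (inl u) (inr v).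
  by have := h2 u v; rewrite !mem_enum => /(_ isT isT); do 2!case: (adj _ _ _).
have a3 u v : adj G2 u v = adj G2' u v.
  case: u v => [u|u] [v|v] //.
  - by apply/idP/idP => [/bip|/bip'].
  - by rewrite adj_sym a2 adj_sym.
  - by apply/idP/idP => [/bip|/bip'].
rewrite /solvable /= => -[S [h3 h4 h5]]; exists S; split=> //= [u v uS vS|].
  have := h4 u v uS vS; rewrite (@eq_connect _ _ (fun x y => [&& x \in S, y \in S & adj G1' x y])) //.
  by move=> x y /=; rewrite a1.
have <- : neighborhood G2 [set inl u | u in S] = neighborhood G2' [set inl u | u in S]; last by [].
by apply/setP => v; rewrite !inE; congr andb; apply: eq_existsb => u; rewrite a3.
Qed.

(** * The reduction *)

(* The constraint variables are numbered as follows: [0] and [k + 1] are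
   sentinels, [1, ..., k] are the chosen inputs (plus one) in increasing order,
   and [k + 2 + a] is the claim for the large gate at the address [a], the nodes
   reached from the output being numbered as in a binary heap.  A red vertex is
   a tuple of [width d] pairs (variable, value), coded by its digits. *)
Definition width (d : nat) : nat := 2 ^ d.+1.
Definition nvars (d k : nat) : nat := k.+2 + 2 ^ d.+2.
(** Shifted inputs, the last sentinel and the claims are all at most [size x + 1]. *)
Definition nvals (x : seq bool) : nat := (size x).+2.
(** One digit codes a pair as [variable * nvals x + value]. *)
Definition base (d : nat) (x : seq bool) (k : nat) : nat := nvars d k * nvals x.

Definition lvar d x k u i : nat := digit (base d x k) u i %/ nvals x.
Definition lval d x k u i : nat := digit (base d x k) u i %% nvals x.
Definition lits d x k u : seq (nat * nat) := mkseq (fun i => (lvar d x k u i, lval d x k u i)) (width d).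

Definition valid d x : bool :=
  [&& is_circ x, circuit_okb (circ x) (num x 0) & shallow (circ x) d.+1 true (out (circ x))].

Definition ntuples d x k : nat := base d x k ^ width d.

(** The number [ntuples d x k] is the extra vertex, available for every word; the tuples require a
    valid one. *)
Definition allowed d x k u : bool :=
  (u == ntuples d x k) || [&& u < ntuples d x k, valid d x & check (circ x) k (lits d x k u) d].

(** The first alternative lets a solution contain at most one vertex for each tuple of variables;
    the second one is disagreement about a common variable. *)
Definition conflict d x k u v : bool :=
  [&& u < ntuples d x k, v < ntuples d x k, u != v &
    all (fun i => lvar d x k u i == lvar d x k v i) (iota 0 (width d)) ||
    has (fun i => has (fun j => (lvar d x k u i == lvar d x k v j) && (lval d x k u i != lval d x k v j))
      (iota 0 (width d))) (iota 0 (width d))].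

(** One vertex for each tuple of variables, and the extra one. *)
Definition param d k : nat := (nvars d k ^ width d).+1.

Section Reduction.
Variables (d : nat) (x : seq bool) (k : nat).
Notation w := (width d).
Notation K := (nvars d k).
Notation N := (nvals x).
Notation m := (ntuples d x k).
Notation VR := (lvar d x k).
Notation VL := (lval d x k).
Notation CF := (conflict d x k).

Lemma base_gt0 : 0 < base d x k. Proof. by rewrite muln_gt0. Qed.

Lemma width_gt1 : 1 < w.
Proof. by have p : 0 < 2 ^ d; [rewrite expn_gt0 | rewrite /width expnS; lia]. Qed.

Lemma lvar_lt u i : VR u i < K.
Proof. by rewrite ltn_divLR // digit_lt // base_gt0. Qed.

Lemma conflict_sym : symmetric CF.
Proof.
move=> u v; rewrite /conflict andbCA [v == u]eq_sym; congr [&& _, _, _ & _ || _].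
  by apply: eq_all => i; rewrite eq_sym.
apply/hasP/hasP => -[i hi /hasP [j hj /andP [e ne]]]; exists j => //; apply/hasP; exists i => //.
  by rewrite eq_sym e eq_sym.
by rewrite eq_sym e eq_sym.
Qed.

Lemma conflict_irr : irreflexive CF.
Proof. by move=> u; rewrite /conflict eqxx /= !andbF. Qed.

Definition instance (star : bool) : pcrbds :=
  gadget m (param d k) star (allowed d x k) CF.

Lemma node_fanin_lt j : fanin (circ x) j < N.
Proof.
rewrite /fanin node_circ; case: (ltnP j (num x 0)) => // _; rewrite /gate_at.
by case: (num x (pos x j)) => [|[|[|a]]] //=; rewrite size_mkseq ltnS leqW ?num_le.
Qed.

Lemma gates_circ : size (gates (circ x)) = num x 0.
Proof. by rewrite size_mkseq. Qed.

Lemma ex_vertex (T : nat -> nat) (f : nat -> nat) :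
  (forall i, T i < K) -> (forall p, f p < N) ->
  exists2 u, u < m & forall i, i < w -> VR u i = T i /\ VL u i = f (T i).
Proof.
move=> hT hf; have [|u lu hu] := @ex_digits _ base_gt0 w (fun i => T i * N + f (T i)).
  by move=> i; rewrite /base; have := hT i; have := hf (T i); nia.
exists u => // i lt; rewrite /lvar /lval hu // divnMDl // divn_small // addn0; split=> //.
by rewrite modnMDl modn_small.
Qed.

(** Apart from the extra vertex, the chosen ones have distinct tuples of variables and are at least
    as many as such tuples, so every tuple occurs. The value of [p] is read off the vertex whose
    variables all equal [p]; compatibility carries it over to the other vertices. *)
Lemma ex_solution (S : {set 'I_m.+1}) : #|S| = param d k ->
  {in S, forall u : 'I_m.+1, allowed d x k u} -> {in S &, forall u v : 'I_m.+1, ~~ CF u v} ->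
  valid d x /\ exists al : nat -> nat, forall Ts, size Ts = w -> all (fun p => p < K) Ts -> check (circ x) k (graph al Ts) d.
Proof.
move=> cS aS nS; pose S' := S :\ ord_max.
have cS' : K ^ w <= #|S'|.
  rewrite -ltnS; have := cardsD1 ord_max S; rewrite cS /param -/S' => ->.
  by case: (ord_max \in S); rewrite ?add1n ?add0n ?leqnSn.
have sP u : u \in S' -> [/\ u \in S, u < m, valid d x & check (circ x) k (lits d x k u) d].
  rewrite !inE => /andP [ne uS]; have := aS u uS; rewrite /allowed.
  have -> : (u == m :> nat) = false by apply/negbTE; move: ne; rewrite -val_eqE.
  by case/and3P.
have K0 : 0 < K by [].
pose tau (u : 'I_m.+1) : {ffun 'I_w -> 'I_K} := [ffun i : 'I_w => Ordinal (lvar_lt u i)].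
have inj : {in S' &, injective tau}.
  move=> u v /sP [uS um _ _] /sP [vS vm _ _] e; apply/eqP; apply: contraT => ne.
  have := nS u v uS vS; rewrite /conflict um vm -val_eqE /= in ne *; rewrite ne /= negb_or => /andP [/allPn [i]].
  rewrite mem_iota add0n => /andP [_ lt] /eqP []; move/ffunP/(_ (Ordinal lt)): e.
  by rewrite !ffunE => /(congr1 val).
have full : tau @: S' = setT.
  apply/eqP; rewrite eqEcard subsetT cardsT card_ffun !card_ord card_in_imset //.
have tup (T : nat -> nat) : (forall i, T i < K) -> exists2 u, u \in S' & forall i, i < w -> VR u i = T i.
  move=> hT; have : [ffun i : 'I_w => Ordinal (hT i)] \in tau @: S' by rewrite full.
  case/imsetP => u uS e; exists u => // i lt; move/ffunP/(_ (Ordinal lt)): e.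
  by rewrite !ffunE => /(congr1 val) /= ->.
have w1 := width_gt1; have w0 : 0 < w by lia.
split.
  (* Some tuple is chosen, and tuples are allowed for valid words only. *)
  have [|u /sP [_ _ vx _] _] // := tup (fun=> 0).
pose al p := if [pick u in S' | [forall i : 'I_w, VR u i == p]] is Some u then VL u 0 else 0.
exists al => Ts sT aT.
have [|u uS uT] := tup (fun i => nth 0 Ts i).
  move=> i; case: (ltnP i (size Ts)) => h; last by rewrite nth_default.
  by move/allP: aT; apply; apply: mem_nth.
have [uS1 um _ ck] := sP u uS.
suff <- : lits d x k u = graph al Ts by [].
rewrite /lits /graph; apply: (@eq_from_nth _ (0, 0)); first by rewrite size_mkseq size_map.
move=> i; rewrite size_mkseq => lt; rewrite nth_mkseq // (nth_map 0) ?sT // uT //; congr pair.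
rewrite /al; case: pickP => [v /andP [vS /forallP vT]|no]; last first.
  have [|v vS vT] := tup (fun=> nth 0 Ts i).
    by move=> _; move/allP: aT; apply; apply: mem_nth; rewrite sT.
  by have /negP [] := no v; rewrite vS; apply/forallP => j; rewrite vT.
have [vS1 vm _ _] := sP v vS.
have v0 : VR v 0 = nth 0 Ts i by have /eqP := vT (Ordinal w0).
(* A vertex does not conflict with itself; inside one tuple [consistent] gives equal values to equal
   variables. *)
have [e|ne] := eqVneq u v.
  have /and3P [/allP c _ _] := ck; have := c (VR u i, VL u i).
  rewrite /lits map_f ?mem_iota // => /(_ isT) /and4P [_ _ _ /allP/(_ (VR u 0, VL u 0))].
  rewrite /lits map_f ?mem_iota // => /(_ isT) /andP [/implyP h _].
  by rewrite -e; apply/eqP; apply: h; rewrite /= uT // e v0.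
have := nS u v uS1 vS1; rewrite /conflict um vm -val_eqE /= in ne *; rewrite ne /= negb_or => /andP [_ /hasPn].
move=> /(_ i); rewrite mem_iota => /(_ lt) /hasPn /(_ 0); rewrite mem_iota => /(_ w0).
by rewrite uT // v0 eqxx /= negbK => /eqP.
Qed.

(** The vertices all of whose values follow [al] are in bijection with the tuples of variables, and
    they agree on common variables. *)
Lemma ex_independent al : valid d x -> (forall p, al p < N) ->
  (forall Ts, check (circ x) k (graph al Ts) d) ->
  exists S : {set 'I_m.+1}, [/\ #|S| = param d k, ord_max \in S,
    {in S, forall u : 'I_m.+1, allowed d x k u} & {in S &, forall u v : 'I_m.+1, ~~ CF u v}].
Proof.
move=> vx hal ck; pose T (u : 'I_m.+1) := [forall i : 'I_w, VL u i == al (VR u i)].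
pose S' := [set u : 'I_m.+1 | (u < m) && T u].
have TP u i : T u -> i < w -> VL u i = al (VR u i).
  by move=> /forallP h lt; have /eqP := h (Ordinal lt).
have K0 : 0 < K by [].
pose tau (u : 'I_m.+1) : {ffun 'I_w -> 'I_K} := [ffun i : 'I_w => Ordinal (lvar_lt u i)].
have dig u v : u \in S' -> v \in S' -> (forall i, i < w -> VR u i = VR v i) -> u = v.
  rewrite !inE => /andP [um Tu] /andP [vm Tv] h; apply: val_inj.
  apply: (@digits_inj _ base_gt0 w) => // i lt.
  have e1 := TP u i Tu lt; have e2 := TP v i Tv lt; have e3 := h i lt.
  rewrite /= (divn_eq (digit _ u i) N) (divn_eq (digit _ v i) N).
  by congr (_ * _ + _); [exact: e3 | rewrite -/(VL u i) -/(VL v i) e1 e2 e3].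
have inj : {in S' &, injective tau}.
  move=> u v uS vS e; apply: dig => // i lt; move/ffunP/(_ (Ordinal lt)): e.
  by rewrite !ffunE => /(congr1 val).
have full : tau @: S' = setT.
  apply/eqP; rewrite eqEsubset subsetT; apply/subsetP => f _.
  pose f' i := if insub i is Some i' then val (f i') else 0.
  have hf' i : f' i < K by rewrite /f'; case: (insub i) => [i'|]; [exact: ltn_ord | exact: K0].
  have [u um hu] := ex_vertex hf' hal.
  have um' : u < m.+1 by apply: leqW.
  apply/imsetP; exists (Ordinal um').
    rewrite inE /= um; apply/forallP => i; have [-> ->] := hu i (ltn_ord i); exact: eqxx.
  apply/ffunP => i; rewrite ffunE; apply: val_inj => /=; have [-> _] := hu i (ltn_ord i).
  by rewrite /f' valK.
have mS : ord_max \notin S' by rewrite inE ltnn.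
exists (ord_max |: S'); split.
- rewrite cardsU1 mS -(card_in_imset inj) full cardsT card_ffun !card_ord add1n //.
- exact: setU11.
- move=> u; rewrite in_setU1 => /predU1P [->|]; first by rewrite /allowed eqxx.
  rewrite inE => /andP [um Tu]; rewrite /allowed um vx /=; apply/orP; right.
  rewrite (_ : lits d x k u = graph al (mkseq (VR u) w)) //.
  rewrite /lits /graph /mkseq -map_comp; apply/eq_in_map => i; rewrite mem_iota add0n => /andP [_ lt] /=.
  by rewrite TP.
- have S'm u v : u \in S' -> v \in S' -> ~~ CF u v.
    move=> uS vS; have := uS; have := vS; rewrite !inE => /andP [vm Tv] /andP [um Tu].
    rewrite /conflict um vm /= negb_and negbK negb_or.
    have [//|ne /=] := boolP (u == v :> nat); apply/andP; split.
      apply/negP => /allP h; move/negP: ne; apply; apply/eqP; congr val; apply: dig => // i lt.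
      by apply/eqP/h; rewrite mem_iota.
    apply/hasPn => i; rewrite mem_iota => li; apply/hasPn => j; rewrite mem_iota => lj.
    by rewrite negb_and negbK; case: eqP => //= e; rewrite !TP // e.
  have cm u : ~~ CF m u by rewrite /conflict ltnn.
  move=> u v; rewrite !in_setU1 => /predU1P [-> _|uS /predU1P [->|vS]]; first exact: cm.
    by rewrite conflict_sym; exact: cm.
  exact: S'm.
Qed.

Lemma instance_correct star : WCS 1 d x k <-> solvable (instance star) (param d k).
Proof.
have am : allowed d x k m by rewrite /allowed eqxx.
split=> [[C [okC wC dC ex [v [vv wv vo]]]]|].
  have [cx eC] : is_circ x /\ circ x = C by rewrite ex; exact: enc_circuitK.
  have lo : out C < size (gates C) by case: okC.
  have sh : shallow C d.+1 true (out C).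
    apply/(shallowP _ _ okC lo) => i p ii pp pl; split; first exact: dC pp pl.
    exact: wC pp pl.
  have vx : valid d x.
    by rewrite /valid cx eC sh andbT /=; have /circuit_okP := okC; rewrite -eC gates_circ.
  have lN : (size (gates C)).+1 < N by rewrite -eC gates_circ !ltnS num_le.
  have fN j : fanin C j < N by rewrite -eC node_fanin_lt.
  have [b1 b2] := csp_complete okC sh vv wv vo lN fN.
  rewrite -eC in b1 b2.
  have [S [cS mS aS nS]] := ex_independent vx b1 b2.
  exact: (gadget_indep_solvable star conflict_sym conflict_irr am cS mS aS nS).
move=> /(gadget_solvable_indep conflict_sym conflict_irr am) [S [cS aS nS]].
 have [vx [al b2]] := ex_solution cS aS nS.
have /and3P [cx ok sh] := vx; have okC : circuit_ok (circ x) by apply/circuit_okP; rewrite gates_circ.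
have [|v [vv wv vo]] := @csp_sound (circ x) k d al okC sh _.
  (* Short lists are padded with the sentinel variable 0 up to the full width. *)
  move=> Ts sT aT; have aT' : all (fun p => p < K) (Ts ++ nseq (w - size Ts) 0).
    by rewrite all_cat aT; apply/allP => p /nseqP [->].
  have sT' : size (Ts ++ nseq (w - size Ts) 0) = w by rewrite size_cat size_nseq subnKC.
  have := b2 _ sT' aT'; apply: check_anti => l; rewrite /graph map_cat mem_cat => -> //.
exists (circ x); split=> //; last by exists v.
- move=> i p ii pp pl; have lo : out (circ x) < size (gates (circ x)) by case: okC.
  by have [_ +] := (shallowP d.+1 true okC lo).1 sh i p ii pp pl.
- move=> i p ii pp pl; have lo : out (circ x) < size (gates (circ x)) by case: okC.
  by have [+ _] := (shallowP d.+1 true okC lo).1 sh i p ii pp pl.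
- exact: is_circ_enc.
Qed.
End Reduction.

(** * The reduction is computable in polynomial time *)

Section PolynomialCircuits.
Variables (E : Type) (wd : E -> seq bool) (vs : seq (E -> nat)).

Lemma pt_large j : pt wd vs j -> pt wd vs (fun e => large (node (circ (wd e)) (j e))).
Proof. by move=> pj; apply: pt_leq; [exact: pt_const | exact: pt_fanin]. Qed.

Lemma pt_out : pt wd vs (fun e => out (circ (wd e))).
Proof. by apply: pt_num; exact: pt_const. Qed.

Lemma pt_gates : pt wd vs (fun e => size (gates (circ (wd e)))).
Proof.
apply: (@pt_ext _ _ _ (fun e => num (wd e) 0)); first by move=> e; rewrite gates_circ.
by apply: pt_num; exact: pt_const.
Qed.

Lemma pt_gate_okb j : pt wd vs j -> pt wd vs (fun e => gate_okb (circ (wd e)) (j e)).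
Proof. by apply: (pt_app1 (F := fun x j => gate_okb (circ x) j)); rewrite /gate_okb; pt_auto. Qed.
End PolynomialCircuits.

Ltac pt_hook3 := fail.
Ltac pt_hook2 ::= lazymatch goal with
  | |- pt _ _ (fun e => fanin _ _) => apply: pt_fanin
  | |- pt _ _ (fun e => prd _ _ _) => apply: pt_prd
  | |- pt _ _ (fun e => out _) => apply: pt_out
  | |- pt _ _ (fun e => size (gates _)) => apply: pt_gates
  | |- pt _ _ (fun e => nat_of_bool (large _)) => apply: pt_large
  | |- pt _ _ (fun e => nat_of_bool (gate_okb _ _)) => apply: pt_gate_okb
  | |- pt _ _ (fun e => nat_of_bool (is_circ _)) => apply: pt_is_circ
  | |- pt _ _ (fun e => nat_of_bool (is_input _)) => apply: pt_is_input
  | |- pt _ _ (fun e => nat_of_bool (is_neg _)) => apply: pt_is_neg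
  | |- pt _ _ (fun e => nat_of_bool (is_conj _)) => apply: pt_is_conj
  | |- pt _ _ _ => pt_hook3
  end.

Lemma pt_circuit_okb E (wd : E -> seq bool) vs n :
  pt wd vs n -> pt wd vs (fun e => circuit_okb (circ (wd e)) (n e)).
Proof. by apply: (pt_app1 (F := fun x n => circuit_okb (circ x) n)); rewrite /circuit_okb; pt_auto. Qed.

(** The height is a constant of the reduction, so the recursion is unrolled by induction outside the
    programs. The Boolean argument travels as a number tested for positivity. *)
Lemma pt_shallow E (wd : E -> seq bool) vs h t j :
  pt wd vs (fun e => nat_of_bool (t e)) -> pt wd vs j ->
  pt wd vs (fun e => shallow (circ (wd e)) h (t e) (j e)).
Proof.
move=> pt1 pj; apply: (@pt_ext _ _ _ (fun e => shallow (circ (wd e)) h (0 < nat_of_bool (t e)) (j e))).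
  by move=> e; rewrite lt0b.
move: pt1 pj; apply: (pt_app2 (F := fun x t j => shallow (circ x) h (0 < t) j)).
elim: h => [|h IH] /=; first exact: pt_const.
pt_auto.
apply: (@pt_ext _ _ _ (fun p : seq bool * nat * nat * nat =>
   shallow (circ p.1.1.1) h (0 < nat_of_bool ((0 < p.1.1.2) && ~~ large (node (circ p.1.1.1) p.1.2)))
      (prd (circ p.1.1.1) p.1.2 p.2))); first by move=> e; rewrite lt0b.
by apply: (pt_app2 (F := fun x t j => shallow (circ x) h (0 < t) j)) => //; pt_auto.
Qed.

Lemma pt_digit E (wd : E -> seq bool) vs L u i :
  pt wd vs L -> pt wd vs u -> pt wd vs i -> pt wd vs (fun e => digit (L e) (u e) (i e)).
Proof.
apply: (pt_app3 (F := fun _ => digit)); rewrite /digit; apply: pt_mod; last by pt_auto.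
apply: (@pt_iter _ _ _ _ _ (fun p => p.1.2) (fun p _ a => a %/ p.1.1.2)); cbn [map cat]; try by pt_auto.
  by apply: pt_pb; pt_auto.
by move=> e m _; elim: m => //= m; apply: leq_trans; exact: leq_div.
Qed.

Section PolynomialCertificates.
Variable d : nat.

Section Literals.
Variables (E : Type) (wd : E -> seq bool) (vs : seq (E -> nat)).
Implicit Types u i k : E -> nat.

Lemma pt_nvars k : pt wd vs k -> pt wd vs (fun e => nvars d (k e)).
Proof. by rewrite /nvars => pk; pt_auto. Qed.

Lemma pt_base k : pt wd vs k -> pt wd vs (fun e => base d (wd e) (k e)).
Proof. by rewrite /base /nvals => pk; pt_auto; exact: pt_nvars. Qed.

(** The exponent depends on [d] only, so there are polynomially many red vertices. *)
Lemma pt_ntuples k : pt wd vs k -> pt wd vs (fun e => ntuples d (wd e) (k e)).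
Proof. by rewrite /ntuples => pk; pt_auto; exact: pt_base. Qed.

Lemma pt_lvar k u i : pt wd vs k -> pt wd vs u -> pt wd vs i ->
  pt wd vs (fun e => lvar d (wd e) (k e) (u e) (i e)).
Proof.
move=> pk pu pi; rewrite /lvar /nvals; apply: pt_div; last by pt_auto.
by apply: pt_digit => //; exact: pt_base.
Qed.

Lemma pt_lval k u i : pt wd vs k -> pt wd vs u -> pt wd vs i ->
  pt wd vs (fun e => lval d (wd e) (k e) (u e) (i e)).
Proof.
move=> pk pu pi; rewrite /lval /nvals; apply: pt_mod; last by pt_auto.
by apply: pt_digit => //; exact: pt_base.
Qed.
End Literals.

Ltac pt_hook3 ::= lazymatch goal with
  | |- pt _ _ (fun e => nvars _ _) => apply: pt_nvars
  | |- pt _ _ (fun e => ntuples _ _ _) => apply: pt_ntuples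
  | |- pt _ _ (fun e => lvar _ _ _ _ _) => apply: pt_lvar
  | |- pt _ _ (fun e => lval _ _ _ _ _) => apply: pt_lval
  | |- pt _ _ (fun e => nat_of_bool (circuit_okb _ _)) => apply: pt_circuit_okb
  | |- pt _ _ (fun e => nat_of_bool (shallow _ _ _ _)) => apply: pt_shallow
  end.

Lemma pt_known_in E (wd : E -> seq bool) vs k u y : pt wd vs k -> pt wd vs u -> pt wd vs y ->
  pt wd vs (fun e => known_in (k e) (lits d (wd e) (k e) (u e)) (y e)).
Proof.
apply: (pt_app3 (F := fun x k u y => known_in k (lits d x k u) y)).
apply: (@pt_ext _ _ _ (fun p : seq bool * nat * nat * nat =>
  has (fun i => (0 < lvar d p.1.1.1 p.1.1.2 p.1.2 i <= p.1.1.2) &&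
                (lval d p.1.1.1 p.1.1.2 p.1.2 i == p.2.+1)) (iota 0 (width d)))).
  by move=> p; rewrite /known_in /lits has_map.
by pt_auto.
Qed.

Lemma pt_known_out E (wd : E -> seq bool) vs k u y : pt wd vs k -> pt wd vs u -> pt wd vs y ->
  pt wd vs (fun e => known_out (k e) (lits d (wd e) (k e) (u e)) (y e)).
Proof.
apply: (pt_app3 (F := fun x k u y => known_out k (lits d x k u) y)).
apply: (@pt_ext _ _ _ (fun p : seq bool * nat * nat * nat =>
  has (fun i => has (fun j => [&& lvar d p.1.1.1 p.1.1.2 p.1.2 j == (lvar d p.1.1.1 p.1.1.2 p.1.2 i).+1,
     lvar d p.1.1.1 p.1.1.2 p.1.2 j <= p.1.1.2.+1 &
     lval d p.1.1.1 p.1.1.2 p.1.2 i < p.2.+1 < lval d p.1.1.1 p.1.1.2 p.1.2 j]) (iota 0 (width d)))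
     (iota 0 (width d)))).
  by move=> p; rewrite /known_out /lits has_map; congr nat_of_bool; apply: eq_has => i /=; rewrite has_map.
by pt_auto.
Qed.

Lemma pt_claimed E (wd : E -> seq bool) vs k u j a b :
  pt wd vs k -> pt wd vs u -> pt wd vs j -> pt wd vs a -> pt wd vs b ->
  pt wd vs (fun e => claimed (circ (wd e)) (k e) (lits d (wd e) (k e) (u e)) (j e) (a e) (0 < b e)).
Proof.
apply: (pt_app5 (F := fun x k u j a b => claimed (circ x) k (lits d x k u) j a (0 < b))).
apply: (@pt_ext _ _ _ (fun p : seq bool * nat * nat * nat * nat * nat =>
  has (fun i => (lvar d p.1.1.1.1.1 p.1.1.1.1.2 p.1.1.1.2 i == p.1.1.1.1.2.+2 + p.1.2) &&
     (((lval d p.1.1.1.1.1 p.1.1.1.1.2 p.1.1.1.2 i == 0) == is_conj (node (circ p.1.1.1.1.1) p.1.1.2)) == (0 < p.2)))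
     (iota 0 (width d)))).
  by move=> p; rewrite /claimed /lits has_map.
by pt_auto.
Qed.

Lemma pt_cert E (wd : E -> seq bool) vs h k u j a b :
  pt wd vs k -> pt wd vs u -> pt wd vs j -> pt wd vs a -> pt wd vs (fun e => nat_of_bool (b e)) ->
  pt wd vs (fun e => cert (circ (wd e)) (k e) (lits d (wd e) (k e) (u e)) h (j e) (a e) (b e)).
Proof.
move=> pk pu pj pa pb'; apply: (@pt_ext _ _ _ (fun e =>
   cert (circ (wd e)) (k e) (lits d (wd e) (k e) (u e)) h (j e) (a e) (0 < nat_of_bool (b e)))).
  by move=> e; rewrite lt0b.
move: pk pu pj pa pb'; apply: (pt_app5 (F := fun x k u j a b => cert (circ x) k (lits d x k u) h j a (0 < b))).
elim: h => [|h IH] /=; first exact: pt_const.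
have rec E' (wd' : E' -> seq bool) vs' k' u' j' a' (b' : E' -> bool) :
  pt wd' vs' k' -> pt wd' vs' u' -> pt wd' vs' j' -> pt wd' vs' a' -> pt wd' vs' (fun e => nat_of_bool (b' e)) ->
  pt wd' vs' (fun e => cert (circ (wd' e)) (k' e) (lits d (wd' e) (k' e) (u' e)) h (j' e) (a' e) (b' e)).
  move=> pk pu pj pa pb'; apply: (@pt_ext _ _ _ (fun e =>
     cert (circ (wd' e)) (k' e) (lits d (wd' e) (k' e) (u' e)) h (j' e) (a' e) (0 < nat_of_bool (b' e)))).
    by move=> e; rewrite lt0b.
  by move: pk pu pj pa pb'; apply: (pt_app5 (F := fun x k u j a b => cert (circ x) k (lits d x k u) h j a (0 < b))).
apply: pt_ifb; first by pt_auto.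
  apply: pt_ifb; first by pt_auto.
    by apply: pt_known_in; pt_auto.
  by apply: pt_known_out; pt_auto.
apply: pt_ifb; first by pt_auto.
  by apply: pt_claimed; pt_auto.
apply: pt_ifb; first by pt_auto.
  apply: pt_all; first by pt_auto.
  by apply: rec; cbn [map cat]; pt_auto.
apply: pt_has; first by pt_auto.
by apply: rec; cbn [map cat]; pt_auto.
Qed.

Lemma pt_unrefuted E (wd : E -> seq bool) vs h k u j a :
  pt wd vs k -> pt wd vs u -> pt wd vs j -> pt wd vs a ->
  pt wd vs (fun e => unrefuted (circ (wd e)) (k e) (lits d (wd e) (k e) (u e)) h (j e) (a e)).
Proof.
apply: (pt_app4 (F := fun x k u j a => unrefuted (circ x) k (lits d x k u) h j a)).
elim: h => [|h IH]; first exact: pt_const.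
apply: (@pt_ext _ _ _ (fun p : seq bool * nat * nat * nat * nat =>
  let C := circ p.1.1.1.1 in let k := p.1.1.1.2 in let u := p.1.1.2 in let j := p.1.2 in let a := p.2 in
  if large (node C j) then
    all (fun i => (lvar d p.1.1.1.1 k u i == k.+2 + a) ==>
      (if lval d p.1.1.1.1 k u i == 0 then
        all (fun q => ~~ cert C k (lits d p.1.1.1.1 k u) h (prd C j q) 0 (~~ is_conj (node C j))) (iota 0 (fanin C j))
      else (lval d p.1.1.1.1 k u i <= fanin C j) &&
        ~~ cert C k (lits d p.1.1.1.1 k u) h (prd C j (lval d p.1.1.1.1 k u i).-1) 0 (is_conj (node C j)))) (iota 0 (width d))
  else all (fun q => unrefuted C k (lits d p.1.1.1.1 k u) h (prd C j q) (2 * a + q.+1)) (iota 0 (fanin C j)))).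
  by case=> -[[[x k'] u'] j'] a' /=; congr nat_of_bool; case: ifP => // _; rewrite /lits all_map.
apply: pt_ifb; first by pt_auto.
  apply: pt_all; first by pt_auto.
  apply: pt_implb; first by cbn [map cat]; pt_auto.
  apply: pt_ifb; first by cbn [map cat]; pt_auto.
    apply: pt_all; first by cbn [map cat]; pt_auto.
    by apply: pt_negb; apply: pt_cert; cbn [map cat]; pt_auto.
  apply: pt_andb; first by cbn [map cat]; pt_auto.
  by apply: pt_negb; apply: pt_cert; cbn [map cat]; pt_auto.
apply: pt_all; first by pt_auto.
by apply: (pt_app4 (F := fun x k u j a => unrefuted (circ x) k (lits d x k u) h j a)) => //; cbn [map cat]; pt_auto.
Qed.

Lemma pt_consistent E (wd : E -> seq bool) vs k u : pt wd vs k -> pt wd vs u ->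
  pt wd vs (fun e => consistent (circ (wd e)) (k e) (lits d (wd e) (k e) (u e))).
Proof.
apply: (pt_app2 (F := fun x k u => consistent (circ x) k (lits d x k u))).
apply: (@pt_ext _ _ _ (fun p : seq bool * nat * nat =>
  let C := circ p.1.1 in let k := p.1.2 in let R := lvar d p.1.1 k p.2 in let V := lval d p.1.1 k p.2 in
  all (fun i => [&& (R i == 0) ==> (V i == 0), (R i == k.+1) ==> (V i == (size (gates C)).+1),
    (0 < R i <= k) ==> [&& 0 < V i, V i <= size (gates C) & is_input (node C (V i).-1)] &
    all (fun j => ((R i == R j) ==> (V i == V j)) && ((R j == (R i).+1) && (R j <= k.+1) ==> (V i < V j)))
      (iota 0 (width d))]) (iota 0 (width d)))).
  case=> -[x k'] u' /=; congr nat_of_bool; rewrite /consistent /lits all_map; apply: eq_all => i /=.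
  by rewrite all_map.
by cbv zeta; pt_auto.
Qed.

Lemma pt_allowed E (wd : E -> seq bool) vs k u : pt wd vs k -> pt wd vs u ->
  pt wd vs (fun e => allowed d (wd e) (k e) (u e)).
Proof.
apply: (pt_app2 (F := fun x k u => allowed d x k u)); rewrite /allowed /valid /check.
apply: pt_orb; first by pt_auto.
apply: pt_andb; first by pt_auto.
apply: pt_andb; first by pt_auto.
apply: pt_andb; first by apply: pt_consistent; pt_auto.
by apply: pt_andb; [apply: pt_negb; apply: pt_cert | apply: pt_unrefuted]; pt_auto.
Qed.

Lemma pt_conflict E (wd : E -> seq bool) vs k u v : pt wd vs k -> pt wd vs u -> pt wd vs v ->
  pt wd vs (fun e => conflict d (wd e) (k e) (u e) (v e)).
Proof. by apply: (pt_app3 (F := fun x k u v => conflict d x k u v)); rewrite /conflict; pt_auto. Qed.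

(** Random access to the code of the instance, entry by entry: sizes and target, then both adjacency
    matrices row by row. *)
Definition out_num (star : bool) (x : seq bool) (k j : nat) : nat :=
  let m := ntuples d x k in
  if j == 0 then m.+1 else if j == 1 then m.+1 * m.+1 else if j == 2 then param d k * m.+1 else
  if j < 3 + m.+1 * m.+1 then nat_of_bool (connb star m ((j - 3) %/ m.+1) ((j - 3) %% m.+1)) else
  nat_of_bool (coverb m (allowed d x k) (conflict d x k)
    ((j - (3 + m.+1 * m.+1)) %/ (m.+1 * m.+1)) ((j - (3 + m.+1 * m.+1)) %% (m.+1 * m.+1))).

Definition out_len (x : seq bool) (k : nat) : nat :=
  let m := ntuples d x k in 3 + (m.+1 * m.+1 + m.+1 * (m.+1 * m.+1)).

Lemma enc_instance star x k :
  enc_pcrbds (instance d x k star) = enc_seq (mkseq (out_num star x k) (out_len x k)).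
Proof.
rewrite /enc_pcrbds /=; congr enc_seq; set m := ntuples d x k; set M := m.+1.
rewrite (allpairs_mkseq (fun u v => nat_of_bool (connb star m u v))).
rewrite (allpairs_mkseq (fun u v => nat_of_bool (coverb m (allowed d x k) (conflict d x k) u v))).
rewrite /out_len -/m -/M /mkseq iotaD map_cat; congr (_ :: _ :: _ :: _).
rewrite add0n iotaD map_cat; congr (_ ++ _).
  rewrite -[in RHS](addn0 3) iotaDl -map_comp; apply/eq_in_map => j; rewrite mem_iota add0n => /andP [_ lj].
  by rewrite [RHS]/= /out_num -/m -/M /= ltn_add2l lj addKn.
rewrite -[3 + M * M]addn0 iotaDl -map_comp; apply/eq_in_map => j _; rewrite [RHS]/=.
by rewrite /out_num -/m -/M ltnNge leq_addr /= addKn.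
Qed.

Lemma pt_out_num star E (wd : E -> seq bool) vs k j : pt wd vs k -> pt wd vs j ->
  pt wd vs (fun e => out_num star (wd e) (k e) (j e)).
Proof.
apply: (pt_app2 (F := out_num star)); rewrite /out_num /param.
apply: pt_if; first by pt_auto.
  by pt_auto.
apply: pt_if; first by pt_auto.
  by pt_auto.
apply: pt_if; first by pt_auto.
  by pt_auto.
apply: pt_if; first by pt_auto.
  by rewrite /connb; pt_auto.
rewrite /coverb; apply: pt_andb; first by apply: pt_allowed; pt_auto.
by apply: pt_orb; repeat (lazy beta; first [pt_step | apply: pt_conflict]).
Qed.

Lemma pt_out_len E (wd : E -> seq bool) vs k : pt wd vs k ->
  pt wd vs (fun e => out_len (wd e) (k e)).
Proof. by apply: (pt_app1 (F := out_len)); rewrite /out_len; pt_auto. Qed.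

Lemma pt_param E (wd : E -> seq bool) vs k : pt wd vs k -> pt wd vs (fun e => param d (k e)).
Proof. by rewrite /param => pk; pt_auto. Qed.
End PolynomialCertificates.

(** * Output, composition and hardness *)

(** Residue classes provide each program with infinitely many stacks of its own. *)
Definition stride (s a y : nat) : nat := s * y + a.

Definition unstride (s a z : nat) : option nat :=
  if (a <= z) && ((z - a) %% s == 0) then Some ((z - a) %/ s) else None.

Lemma strideK s a : 0 < s -> pcancel (stride s a) (unstride s a).
Proof.
move=> s0 y; rewrite /unstride /stride leq_addl addnK mulnC modnMl eqxx /=.
by rewrite mulnK.
Qed.

Lemma unstrideK s a : ocancel (unstride s a) (stride s a).
Proof.
move=> z; rewrite /unstride /stride; case: ifP => //= /andP [le /eqP e].
by have := divn_eq (z - a) s; rewrite e addn0 mulnC => <-; rewrite subnK.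
Qed.

Lemma splice_ran r q s S y : pcancel r q -> splice q s S (r y) = s y.
Proof. by move=> rK; rewrite /splice rK. Qed.

Lemma rev_unary n : rev (unary n) = unary n.
Proof.
by elim: n => // n IH; rewrite {1}/unary /= rev_cons IH; elim: n {IH} => //= n ->.
Qed.

Lemma computable_comp2 f g (p : nat * nat -> nat) :
  computable f -> computable g -> pt (fun=> [::]) [:: fst; snd] p ->
  computable (fun n => p (f n, g n)).
Proof.
move=> [cf Hf] [cg Hg] [cp [T [_ Hp]]].
pose rn a := ren (stride 3 a).
(* The programs for [f], [g] and [p] live on the stacks [3y + 3], [3y + 4] and [3y + 5]. So [p]
   takes its two numbers from stacks 8 and 11 and returns its value on 14. *)
exists (Seq (dup 0 3 4) (Seq (rn 3 cf) (Seq (rn 4 cg) (Seq (mv 3 8) (Seq (mv 4 11) (Seq (rn 5 cp) (mv 14 0))))))) => n.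
have sK a : pcancel (stride 3 a) (unstride 3 a) by exact: strideK.
have uK a := @unstrideK 3 a.
have [tf [sf [ef rf]]] := Hf n; have [tg [sg [eg rg]]] := Hg n.
have [tp ep _] := Hp (f n, g n).
set s0 := init [:: unary n] in ef eg *.
have e1 := @exec_dup 0 3 4 s0 isT isT isT.
set s1 := upd _ _ _ in e1.
have n3 y : unstride 3 3 (3 * y + 4) = None /\ unstride 3 3 (3 * y + 5) = None.
  by rewrite /unstride; split; rewrite ifN //; lia.
have n4 y : unstride 3 4 (3 * y + 3) = None /\ unstride 3 4 (3 * y + 5) = None.
  by rewrite /unstride; split; rewrite ifN //; lia.
have n5 y : unstride 3 5 (3 * y + 3) = None /\ unstride 3 5 (3 * y + 4) = None.
  by rewrite /unstride; split; rewrite ifN //; lia.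
have s0n z : 0 < z -> s0 z = [::] by case: z => // z _; rewrite /s0 /init /= nth_nil.
have s1z z : 4 < z -> s1 z = [::].
  by move=> h; rewrite /s1 /upd !ifN ?s0n //; lia.
have s1f y : s1 (stride 3 3 y) = s0 y.
  case: y => [|y]; first by rewrite /s1 /upd /= rev_unary cats0.
  by rewrite s1z ?s0n // /stride; lia.
have s1g y : s1 (stride 3 4 y) = s0 y.
  case: y => [|y]; first by rewrite /s1 /upd /= rev_unary cats0.
  by rewrite s1z ?s0n // /stride; lia.
have e2 := exec_ren (sK 3) (uK 3) ef s1f.
set s2 := splice _ _ _ in e2.
have s2g y : s2 (stride 3 4 y) = s0 y by rewrite /s2 /splice /stride (n3 y).1 -/(stride 3 4 y) s1g.
have e3 := exec_ren (sK 4) (uK 4) eg s2g.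
set s3 := splice _ _ _ in e3.
have r3 : s3 3 = unary (f n).
  by rewrite /s3 /splice (n4 0).1 /s2 (splice_ran _ _ 0 (sK 3)).
have r4 : s3 4 = unary (g n) by rewrite /s3 (splice_ran _ _ 0 (sK 4)).
have s3z y : s3 (stride 3 5 y) = [::].
  rewrite /s3 /splice /stride (n4 y).2 /s2 /splice (n3 y).2 s1z //; lia.
have e4 := @exec_mv 3 8 s3 isT; set s4 := upd _ _ _ in e4.
have e5 := @exec_mv 4 11 s4 isT; set s5 := upd _ _ _ in e5.
have s5p y : s5 (stride 3 5 y) = lay [::] (nth 0 (vals [:: fst; snd] (f n, g n))) y.
  have r8 : s3 8 = [::] := s3z 1.
  have r11 : s3 11 = [::] := s3z 2.
  case: y => [|[|[|y]]].
  - by rewrite /s5 /s4 /upd /=; exact: (s3z 0).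
  - by rewrite /s5 /s4 /upd /= r3 r8 rev_unary cats0.
  - by rewrite /s5 /s4 /upd /= r4 r11 rev_unary cats0.
  - rewrite /s5 /s4 /upd !ifN ?s3z /= ?nth_nil //; rewrite /stride; lia.
have e6 := exec_ren (sK 5) (uK 5) ep s5p; set s6 := splice _ _ _ in e6.
have e7 := @exec_mv 14 0 s6 isT; set s7 := upd _ _ _ in e7.
eexists; exists s7; split.
  by do 6!(eapply ExecSeq; [eassumption|]); eassumption.
have r14 : s6 14 = unary (p (f n, g n)) by rewrite /s6 (splice_ran _ _ 3 (sK 5)).
have r0 : s6 0 = [::].
  by rewrite /s6 /splice /= /s5 /s4 /upd /= /s3 /splice /= /s2 /splice /= /s1 /upd.
by rewrite /s7 /upd /= r14 r0 rev_unary cats0.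
Qed.

Section Output.
Variables (len par : seq bool -> nat -> nat) (nm : seq bool -> nat -> nat -> nat).
Hypothesis pt_len : pt fst [:: snd] (fun p => len p.1 p.2).
Hypothesis pt_par : pt fst [:: snd] (fun p => par p.1 p.2).
Hypothesis pt_nm : pt (fun p => p.1.1) [:: (fun p => p.1.2); (fun p => p.2)] (fun p => nm p.1.1 p.1.2 p.2).

Let q := unstride 2 3.
Let r := stride 2 3.

(* Numerical data on the odd stacks from [3] on, the output on stack [2]. *)
Definition outst (G : store) x v w : store := splice q (lay x v) (upd G 2 w).

Lemma outst_intro S x v : (forall y, S (r y) = lay x v y) -> S = outst S x v (S 2).
Proof.
move=> h; apply: functional_extensionality => z; rewrite /outst /splice.
have := @unstrideK 2 3 z; rewrite -/q; case: (q z) => [y <-|_]; first by rewrite -h.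
by rewrite /upd; case: eqP => // ->.
Qed.

Lemma exec_outst c G x v v' w t : exec c (lay x v) t (lay x v') ->
  exec (ren r c) (outst G x v w) t (outst G x v' w).
Proof.
move=> ex; have h y : outst G x v w (r y) = lay x v y by rewrite /outst splice_ran //; exact: strideK.
have := exec_ren (@strideK 2 3 isT) (@unstrideK 2 3) ex h; congr exec.
by apply: functional_extensionality => z; rewrite /outst /splice -/q; case: (q z).
Qed.

Lemma exec_push_out b G x v w : exec (Push 2 b) (outst G x v w) 1 (outst G x v (b :: w)).
Proof.
have := ExecPush 2 b (outst G x v w); congr exec; apply: functional_extensionality => z.
rewrite /outst /splice /upd; case: eqP => [->|ne] //=.
Qed.

Lemma outst_ran G x v w y : outst G x v w (r y) = lay x v y.
Proof. by rewrite /outst splice_ran //; exact: strideK. Qed.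

(** A stack grows at its top, so the numbers are written from the last to the first; the loop
    counter is at the same time the index of the number to be computed. *)
Lemma output_program : exists c T, pb (fun p : seq bool * nat => size p.1 + p.2) T /\
  forall x k G, G 0 = [::] -> G 1 = [::] ->
  exists t S, [/\ exec c (outst G x (nth 0 [:: k]) [::]) t S, t <= T (x, k),
    S 0 = enc_seq (mkseq (nm x k) (len x k)) & S 1 = unary (par x k)].
Proof.
have mu1 : mu fst [:: snd] =1 (fun p : seq bool * nat => size p.1 + p.2).
  by move=> p; rewrite /mu /= addn0.
have [cl [Tl [Tlb Hl]]] := pt_len; have [cp [Tp [Tpb Hp]]] := pt_par; have [cn [Tn [[e Tnb] Hn]]] := pt_nm.
have lb := pt_pb pt_len; have pb' := pt_pb pt_par.
have [en nb] := pt_pb pt_nm.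
(* Stack 3 carries the word, 5 the parameter, 7 the index and 9 the number to be written. The final
   detour of the output over stack 1 preserves its order. *)
pose inner := While 9 (Seq (Pop 9) (Push 2 true)).
pose body := Seq (Pop 7) (Seq (ren r cn) (Seq (Push 2 false) inner)).
pose m (p : seq bool * nat) := size p.1 + p.2.
pose TB (p : seq bool * nat) := (m p + len p.1 p.2 + e) ^ e + (4 * (m p + len p.1 p.2 + en) ^ en + 3).
pose L (p : seq bool * nat) := len p.1 p.2 * ((m p + len p.1 p.2 + en) ^ en + 1).
exists (Seq (ren r cl) (Seq (While 7 body) (Seq (ren r cp) (Seq (mv 2 1) (Seq (mv 1 0) (mv 7 1)))))).
exists (fun p => Tl p + ((len p.1 p.2 * (TB p + 1) + 1) + (Tp p + ((4 * L p + 1) + ((4 * L p + 1) + (4 * par p.1 p.2 + 1)))))).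
have eqm : mu fst [:: snd] = m by apply: functional_extensionality => p; rewrite mu1.
rewrite eqm in Tlb Tpb lb pb'.
split; first by rewrite /TB /L; change (pb m Tl) in Tlb; pbs.
move=> x k G G0 G1.
have [t1 e1 l1] := Hl (x, k); have [t3 e3 l3] := Hp (x, k).
have f1 := exec_outst G [::] e1; have f3 := exec_outst G (enc_seq (mkseq (nm x k) (len x k))) e3.
rewrite /= in f1 f3 l1 l3.
have inn a j w : exists t, exec inner (outst G x (nth 0 [:: k; j; a]) w) t
    (outst G x (nth 0 [:: k; j]) (nseq a true ++ w)) /\ t <= 3 * a + 1.
  elim: a w => [|a IH] w.
    exists 1; split=> //; rewrite (@nth_zeros [:: k; j] 1); apply: ExecWhileStop.
    exact: (outst_ran _ _ _ _ 3).
  have [t [et lt]] := IH (true :: w); exists (2 + t).+1; split; last lia.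
  apply: (@ExecWhileStep _ _ _ (outst G x (nth 0 [:: k; j; a]) (true :: w))).
  - by rewrite (outst_ran _ _ _ _ 3).
  - apply: (@ExecSeq _ _ _ (outst G x (nth 0 [:: k; j; a]) w) _ 1 1); last exact: exec_push_out.
    exact: (exec_outst G w (exec_pop_cat x [:: k; j] a.+1 [::])).
  - by move: et; rewrite -[true :: w]/([:: true] ++ w) catA -(nseqD _ 1) addn1.
have lp j s : j <= len x k -> exists t, exec (While 7 body) (outst G x (nth 0 [:: k; j]) (enc_seq s)) t
    (outst G x (nth 0 [:: k]) (enc_seq (map (nm x k) (iota 0 j) ++ s))) /\ t <= j * (TB (x, k) + 1) + 1.
  elim: j s => [|j IH] s lj.
    exists 1; split=> //; rewrite (@nth_zeros [:: k] 1); apply: ExecWhileStop.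
    exact: (outst_ran _ _ _ _ 2).
  have [t [et lt]] := IH (nm x k j :: s) (ltnW lj).
  have [t2 e2 l2] := Hn (x, k, j); rewrite /= in e2 l2.
  have [t4 [e4 l4]] := inn (nm x k j) j (false :: enc_seq s).
  exists (1 + (t2 + (1 + t4)) + t).+1; split.
    apply: (@ExecWhileStep _ _ _ (outst G x (nth 0 [:: k; j]) (enc_seq (nm x k j :: s)))).
    - by rewrite (outst_ran _ _ _ _ 2).
    - apply: (ExecSeq (exec_outst G (enc_seq s) (exec_pop_cat x [:: k] j.+1 [::]))).
      apply: (ExecSeq (exec_outst G (enc_seq s) e2)); apply: (ExecSeq (exec_push_out _ _ _ _ _)).
      by rewrite enc_cons.
    - by move: et; rewrite -[j.+1]addn1 iotaD map_cat -catA add0n.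
  have mE : mu (fun p : seq bool * nat * nat => p.1.1) [:: (fun p => p.1.2); (fun p => p.2)] (x, k, j) <= m (x, k) + len x k.
    by rewrite /mu /m /=; lia.
  have b1 : t2 <= (m (x, k) + len x k + e) ^ e.
    apply: leq_trans l2 _; apply: leq_trans (Tnb _) _; case: (e) => // e'; rewrite leq_exp2r //; lia.
  have b2 : nm x k j <= (m (x, k) + len x k + en) ^ en.
    by apply: leq_trans (nb (x, k, j)) _; case: (en) => // e'; rewrite leq_exp2r //; lia.
  by rewrite /TB /= in lt *; lia.
have [t2 [f2 l2]] := lp (len x k) [::] (leqnn _); rewrite cats0 -/(mkseq _ _) in f2.
set W := enc_seq (mkseq _ _) in f2 f3; set S3 := outst G x (nth 0 [:: k; par x k]) W in f3.
have S30 : S3 0 = [::] by rewrite /S3 /outst /splice /upd.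
have S31 : S3 1 = [::] by rewrite /S3 /outst /splice /upd.
have S32 : S3 2 = W by rewrite /S3 /outst /splice /upd.
have S37 : S3 7 = unary (par x k) by exact: (outst_ran G x _ W 2).
have g1 := @exec_mv 2 1 S3 isT; set S4 := upd _ _ _ in g1.
have S41 : S4 1 = rev W by rewrite /S4 /upd /= S31 S32 cats0.
have g2 := @exec_mv 1 0 S4 isT; set S5 := upd _ _ _ in g2.
have S57 : S5 7 = unary (par x k) by rewrite /S5 /S4 /upd /= S37.
have g3 := @exec_mv 7 1 S5 isT; set S6 := upd _ _ _ in g3.
have lW : size W <= L (x, k).
  have -> : L (x, k) = size (mkseq (nm x k) (len x k)) * ((m (x, k) + len x k + en) ^ en + 1).
    by rewrite size_mkseq.
  rewrite /W; have : all (fun a => a <= (m (x, k) + len x k + en) ^ en) (mkseq (nm x k) (len x k)).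
    apply/allP => a /mapP [j]; rewrite mem_iota add0n => /andP [_ lj] ->.
    apply: leq_trans (nb (x, k, j)) _; rewrite /mu /m /=.
    by case: (en) => // e'; rewrite leq_exp2r //; lia.
  elim: (mkseq _ _) => // a s IH /= /andP [la /IH ls]; rewrite enc_cons size_cat size_nseq /=.
  by rewrite mulSn; lia.
eexists; exists S6; split.
- by do 5!(eapply ExecSeq; [eassumption|]); eassumption.
- rewrite S32 S41 S57 size_rev size_nseq /=; lia.
- by rewrite /S6 /upd /= /S5 /upd /= S41 revK /S4 /upd /= S30 cats0.
- by rewrite /S6 /upd /= S57 rev_unary /S5 /upd /= cats0.
Qed.
End Output.

Lemma computable_comp1 f (p : nat -> nat) :
  computable f -> pt (fun=> [::]) [:: id] p -> computable (fun n => p (f n)).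
Proof.
move=> cf pp; apply: (@computable_comp2 f f (fun e => p e.1)) => //.
apply: (@pt_subst _ _ _ _ _ _ _ fst [:: fst] pp) => //; split=> //.
exact: (@pt_var _ _ _ 0).
Qed.

Lemma param_mono d k k' : k <= k' -> param d k <= param d k'.
Proof. by move=> le; rewrite /param ltnS leq_exp2r /width ?expn_gt0 // /nvars; lia. Qed.

(* Leaves stack [2] and the odd stacks from [3] on free. *)
Definition keep2 (y : nat) : nat := if y < 2 then y else 2 * y.

Definition unkeep2 (z : nat) : option nat :=
  if z < 2 then Some z else if odd z || (z == 2) then None else Some z./2.

Lemma keep2K : pcancel keep2 unkeep2.
Proof.
move=> y; rewrite /keep2 /unkeep2; case: (ltnP y 2) => h; first by rewrite h.
by rewrite ifN ?ifN; [congr Some|..]; lia.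
Qed.

Lemma unkeep2K : ocancel unkeep2 keep2.
Proof.
move=> z; rewrite /keep2 /unkeep2; case: (ltnP z 2) => h /=; first by rewrite h.
by case: ifP => //= /negbT h'; rewrite ifN; lia.
Qed.

(** The given reduction to circuits is followed by the construction. Its output is no longer than
    [size x] plus its running time and its parameter is at most [g k], so a polynomial in both is
    again of the required form. *)
Lemma W1_hard (K : pcrbds -> Prop) (star : bool) :
  (forall d x k, K (instance d x k star)) -> W_hard 1 (PCRBDS K).
Proof.
move=> KI P [d [c [f [g [e [cf cg H]]]]]].
have plen : pt fst [:: snd] (fun p : seq bool * nat => out_len d p.1 p.2).
  by apply: pt_out_len; pt_auto.
have ppar : pt fst [:: snd] (fun p : seq bool * nat => param d p.2).
  by apply: pt_param; pt_auto.
have pnum : pt (fun p : seq bool * nat * nat => p.1.1) [:: (fun p => p.1.2); (fun p => p.2)]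
    (fun p => out_num d star p.1.1 p.1.2 p.2).
  by apply: pt_out_num; pt_auto.
have [c2 [T [[C Tb] H2]]] := output_program (par := fun _ => param d) plen ppar pnum.
(* The base of the final power is then at least 15, which absorbs the constant factors of the moves
   between the programs. *)
pose C' := C + 14.
exists (Seq (ren keep2 c) (Seq (mv 0 2) (Seq (mv 2 3) (Seq (mv 1 5) c2)))),
  (fun k => (f k + g k + C'.+2) ^ C'.+1), (fun k => param d (g k)), (e.+1 * C'.+1).
split.
- apply: (@computable_comp2 f g (fun p => (p.1 + p.2 + C'.+2) ^ C'.+1)) => //.
  have v1 : pt (fun=> [::]) [:: fst; snd] (@fst nat nat) by apply: (@pt_var _ _ _ 0).
  by pt_auto.
- apply: computable_comp1 => //; apply: pt_param; exact: (@pt_var _ _ _ 0).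
move=> x k; have [t1 [s1 [k1 [e1 r1 l1 lk PQ]]]] := H x k.
set s0 := init _ in e1; set x1 := s1 0 in PQ.
have s0z z : 1 < z -> s0 z = [::] by case: z => [|[|z]] // _; rewrite /s0 /init /= nth_nil.
have s0k y : s0 (keep2 y) = s0 y.
  by rewrite /keep2; case: ltnP => // h; rewrite !s0z //; lia.
have f1 := exec_ren keep2K unkeep2K e1 s0k; set S1 := splice _ _ _ in f1.
have S10 : S1 0 = x1 by [].
have S11 : S1 1 = unary k1 by [].
have S1z z : odd z || (z == 2) -> 1 < z -> S1 z = [::].
  by move=> h1 h2; rewrite /S1 /splice /unkeep2 ifN ?h1 -?leqNgt // s0z.
have g1 := @exec_mv 0 2 S1 isT; set S2 := upd _ _ _ in g1.
have S22 : S2 2 = rev x1 by rewrite /S2 /upd /= S10 S1z // cats0.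
have g2 := @exec_mv 2 3 S2 isT; set S3 := upd _ _ _ in g2.
have S31 : S3 1 = unary k1 by [].
have g3 := @exec_mv 1 5 S3 isT; set S4 := upd _ _ _ in g3.
have h4 y : S4 (stride 2 3 y) = lay x1 (nth 0 [:: k1]) y.
  case: y => [|[|y]].
  - by rewrite /S4 /upd /= /S3 /upd /= S22 revK /S2 /upd /= S1z // cats0.
  - by rewrite /S4 /upd /= S31 rev_unary /S3 /upd /= /S2 /upd /= S1z // cats0.
  - rewrite /stride; have -> : 2 * y.+2 + 3 = (2 * y).+2.+4.+1 by lia.
    rewrite /S4 /upd /= /S3 /upd /= /S2 /upd /= S1z //= ?nth_nil //.
    by rewrite mul2n odd_double.
have S42 : S4 2 = [::] by [].
have [//|//|t2 [S5 [f2 l2 r0 r1']]] := H2 x1 k1 S4.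
have eS : outst S4 x1 (nth 0 [:: k1]) [::] = S4 by rewrite [RHS](outst_intro h4) S42.
rewrite eS in f2.
exists (t1 + ((4 * size (S1 0)).+1 + ((4 * size (S2 2)).+1 + ((4 * size (S3 1)).+1 + t2)))), S5, (param d k1).
split=> //.
- by do 4!(eapply ExecSeq; [eassumption|]); eassumption.
- rewrite S10 S22 S31 size_rev size_nseq.
  have lx1 : size x1 <= size x + t1 by exact: exec_size 0 e1.
  have {}l2 := leq_trans l2 (Tb (x1, k1)); rewrite /= in l2.
  pose A := size x + t1 + g k; pose Z := (A + C'.+1) ^ C'.
  have l3 : t2 <= Z.
    apply: leq_trans l2 _; apply: leq_trans (_ : (A + C'.+1) ^ C <= _).
      by case: (posnP C) => [->|C0]; [rewrite !expn0 | rewrite leq_exp2r // /A /C'; lia].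
    by rewrite leq_pexp2l /C' //; lia.
  have l4 : A + C'.+1 <= Z.
    by rewrite -{1}(expn1 (A + C'.+1)) leq_pexp2l /C' //; lia.
  apply: (@leq_trans ((A + C'.+1) ^ C'.+1)).
    have : 15 * Z <= (A + C'.+1) ^ C'.+1 by rewrite expnS leq_mul2r /C'; lia.
    by rewrite /A /C' in l4 *; lia.
  (* What remains separates [k] from [x]: the base is at most [f k + g k + C' + 2] times
     [(size x).+1 ^ e.+1]. *)
  rewrite expnM -expnMn leq_exp2r // expnS; set Y := (size x).+1 ^ e in l1 *.
  have Y0 : 0 < Y by rewrite expn_gt0.
  rewrite /A; move: (C'.+1) => D; nia.
- exact: param_mono.
- rewrite PQ r0 -enc_instance; split=> [/(instance_correct d x1 k1 star).1 sol|[I [eI _ sol]]].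
    by exists (instance d x1 k1 star).
  by apply/(instance_correct d x1 k1 star).2; exact: solvable_enc (esym eI) sol.
Qed.

Theorem theorem7p1 :
  [/\ W_hard 1 (PCRBDS (fun _ => True)),
      W_hard 1 (PCRBDS (fun I => degenerate 3 (Gcov I) /\ is_clique (Gconn I))) &
      W_hard 1 (PCRBDS (fun I => degenerate 3 (Gcov I) /\ is_star (Gconn I)))].
Proof.
have deg d x k star : degenerate 3 (Gcov (instance d x k star)).
  by apply: gadget_degenerate; rewrite /allowed eqxx.
split.
- by apply: (@W1_hard _ false).
- apply: (@W1_hard _ false) => d x k; split=> // u v.
  by rewrite /= /conn_adj /connb andbT.
- apply: (@W1_hard _ true) => d x k; split=> //; exists ord_max => u v.
  by rewrite /= /conn_adj /connb.
Qed.
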